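(* Let $\mathcal{M}\subset B(\mathcal{H})$ be a unital operator space with $C^*$-envelope $C^*_e(\mathcal{M})$, and regard $\mathcal{M}$ as a subspace of $C^*_e(\mathcal{M})$ via the canonical completely isometric embedding. Suppose that $\pi:C^*_e(\mathcal{M})\rightarrow B(\mathcal{H}_\pi)$ is an isometric $*$-representation and let $\psi:C^*_e(\mathcal{M})\rightarrow B(\mathcal{H}_\pi)$ be a unital completely positive map satisfying $\psi|_{\mathcal{M}}=\pi|_{\mathcal{M}}$. Then the following statements hold. (i) The map $\psi$ is completely isometric. (ii) $C^*_e(\mathrm{Im}\,\psi)\cong C^*_e(\mathcal{M})$.
   Context: A unital operator space is a linear subspace $\mathcal{M}\subset B(\mathcal{H})$, $\mathcal{H}$ a Hilbert space, containing the identity; $C^*(\mathcal{M})$ is the $C^*$-algebra it generates. $*$-representations of unital $C^*$-algebras are on Hilbert spaces and are unital. A $C^*$-cover of $\mathcal{M}$ is a pair $(\mathfrak{A},\iota)$ with $\iota:\mathcal{M}\to B(\mathcal{K})$ unital completely isometric linear and $\mathfrak{A}=C^*(\iota(\mathcal{M}))$. The $C^*$-envelope is a $C^*$-cover $(C^*_e(\mathcal{M}),\varepsilon)$ such that for every $C^*$-cover $(\mathfrak{A},\iota)$ there is a $*$-homomorphism $\theta:\mathfrak{A}\to C^*_e(\mathcal{M})$ with $\theta\circ\iota=\varepsilon$; it always exists. $\varepsilon$ is the canonical embedding. $\cong$ denotes $*$-isomorphism of $C^*$-algebras. *)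

(* Defs.v *)
From HB Require Import structures.
From mathcomp Require Import all_boot all_order all_algebra.
From mathcomp Require Import sesquilinear complex.
From mathcomp Require Import all_classical all_reals.
From mathcomp Require Import topology normedtype.

Set Implicit Arguments.
Unset Strict Implicit.
Unset Printing Implicit Defensive.

Import Order.TTheory GRing.Theory Num.Theory.
Import numFieldNormedType.Exports.

Local Open Scope classical_set_scope.
Local Open Scope complex_scope.
Local Open Scope ring_scope.

(* Inner products are linear in the first and conjugate-linear in the second
   argument. Norms take values in R[i], hence the square below is in R[i]. *)
HB.mixin Record isHilbert (R : realType) H of CompleteNormedModule R[i] H := {
  hdot : {dot H for (@Num.conj R[i])} ;
  hdot_normE : forall x : H, hdot x x = `|x| ^+ 2
}.

#[short(type="hilbertType")]
HB.structure Definition Hilbert (R : realType) :=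
  {H of isHilbert R H & CompleteNormedModule R[i] H}.

(* Operators on H are plain functions H -> H, with the pointwise linear
   structure, composition as product and [id] as unit. *)
Section Operators.
Context {R : realType} {H : hilbertType R}.
Implicit Types (S T : H -> H) (A M : set (H -> H)).

Definition bounded_op : set (H -> H) := [set T | linear T /\ continuous T].

Definition is_adjoint T S := forall x y : H, hdot (T x) y = hdot x (S y).

Definition rnorm (x : H) : R := complex.Re `|x|.

Definition opnorm T : R :=
  sup [set rnorm (T x) | x in [set x | rnorm x <= 1]].

(* The norm of the Hilbert space direct sum of n copies of H. *)
Definition l2norm n (x : 'I_n -> H) : R := Num.sqrt (\sum_i rnorm (x i) ^+ 2).

(* A matrix of operators on H seen as an operator on this direct sum. *)
Definition mxact n (X : 'M[H -> H]_n) (x : 'I_n -> H) : 'I_n -> H :=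
  fun i => \sum_j X i j (x j).

Definition mxopnorm n (X : 'M[H -> H]_n) : R :=
  sup [set l2norm (mxact X x) | x in [set x | l2norm x <= 1]].

(* In R[i], [0 <= z] says that z is real and nonnegative. *)
Definition mxop_ge0 n (X : 'M[H -> H]_n) :=
  forall x : 'I_n -> H, 0 <= \sum_i hdot (mxact X x i) (x i).

Definition mx_in M n : set 'M[H -> H]_n := [set X | forall i j, M (X i j)].

Definition op_subspace M :=
  [/\ M `<=` bounded_op, M 0 &
      forall (a : R[i]) S T, M S -> M T -> M (a *: S + T)].

Definition unital_operator_space M := op_subspace M /\ M id.

Definition norm_closed A := forall T, bounded_op T ->
  (forall e : R, 0 < e -> exists2 S, A S & opnorm (T - S) < e) -> A T.

Definition Cstar_subalgebra A :=
  [/\ op_subspace A,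
      forall S T, A S -> A T -> A (S \o T),
      forall S T, A T -> is_adjoint T S -> A S &
      norm_closed A].

Definition Cstar M : set (H -> H) := smallest Cstar_subalgebra M.

End Operators.

(* A map defined on a set A of operators on H is a total function of which only
   the values on A matter. *)
Section Maps.
Context {R : realType} {H K : hilbertType R}.
Implicit Types (A : set (H -> H)) (B : set (K -> K)).
Implicit Types (f : (H -> H) -> (K -> K)).

Definition linear_on A f := forall (a : R[i]) S T, A S -> A T ->
  f (a *: S + T) = a *: f S + f T.

Definition star_hom A B f :=
  [/\ set_fun A B f, linear_on A f,
      forall S T, A S -> A T -> f (S \o T) = f S \o f T &
      forall S T, A S -> A T -> is_adjoint T S -> is_adjoint (f T) (f S)].

Definition star_rep A f := star_hom A bounded_op f /\ f id = id.

Definition star_isomorphic A B := exists2 f, star_hom A B f & set_bij A B f.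

Definition isometric_on A f := forall T, A T -> opnorm (f T) = opnorm T.

Definition completely_isometric A f := forall n (X : 'M[H -> H]_n),
  mx_in A X -> mxopnorm (map_mx f X) = mxopnorm X.

Definition completely_positive A f := forall n (X : 'M[H -> H]_n),
  mx_in A X -> mxop_ge0 X -> mxop_ge0 (map_mx f X).

Definition ucp A f :=
  [/\ set_fun A bounded_op f, linear_on A f, f id = id &
      completely_positive A f].

(* [Cstar_cover M i] : the pair (Cstar (i @` M), i) is a C*-cover of M. *)
Definition Cstar_cover A f :=
  [/\ set_fun A bounded_op f, linear_on A f, f id = id &
      completely_isometric A f].

End Maps.

(* [Cstar_envelope M e] : the pair (Cstar (e @` M), e) is a C*-envelope of M. *)
Definition Cstar_envelope (R : realType) (H K : hilbertType R)
    (M : set (H -> H)) (e : (H -> H) -> (K -> K)) :=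
  Cstar_cover M e /\
  forall (L : hilbertType R) (i : (H -> H) -> (L -> L)), Cstar_cover M i ->
    exists2 t, star_hom (Cstar (i @` M)) (Cstar (e @` M)) t &
               forall T, M T -> t (i T) = e T.

(* Main.v *)
Require Import Defs.
From HB Require Import structures.
From mathcomp Require Import all_boot all_order all_algebra.
From mathcomp Require Import sesquilinear complex.
From mathcomp Require Import all_classical all_reals.
From mathcomp Require Import topology normedtype sequences.
From mathcomp Require Import ring lra.

(** Let [A] be the envelope and [B = pi(A)]. By Arveson's theorem [psi \o pi^-1]
    extends to a ucp map [Psi] on all of [B(Hpi)], which fixes [pi(M)] pointwise.
    Among the ucp maps that fix [pi(M)] and are dominated by [Psi] in every matrix
    norm, Zorn's lemma gives a minimal one [F], and minimality makes [F] idempotent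
    (Hamana). By the Choi-Effros argument [F (z x w) = F (z (F x) w)] for [z], [w]
    in [B], so the GNS-Stinespring construction for the positive kernel
    [((z, xi), (w, eta)) |-> <F (w^* z) xi, eta>] represents [B] by a *-homomorphism
    [s] with [|s X| = |F X|] for every matrix [X] over [B]. As [F] fixes [pi(M)],
    [s \o pi] gives a C*-cover of [M], and universality of [A] provides [th] with
    [th \o s \o pi = id] on [A]. Hence, for every matrix [X] over [A],
    [|X| <= |s (pi X)| = |F (pi X)| <= |Psi (pi X)| = |psi X| <= |X|].
    For (ii), [psi^-1] exhibits [A] as a C*-cover of the image of [psi], whose
    envelope is then reached from [A] by an isometric surjective *-homomorphism. *)

Set Implicit Arguments.
Unset Strict Implicit.
Unset Printing Implicit Defensive.

Import Order.TTheory GRing.Theory Num.Theory.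
Import numFieldNormedType.Exports.

Local Open Scope classical_set_scope.
Local Open Scope complex_scope.
Local Open Scope ring_scope.

Import ComplexField.Normc.
#[local] Arguments normc {R} x : simpl never.
Local Notation Re := complex.Re.
Local Notation Im := complex.Im.

(** * Inner products, bounded operators and adjoints *)

(** The universal property of the envelope only sees C*-covers, whereas [psi] is not multiplicative
    and the range of an idempotent ucp map is a C*-algebra only for the product [F (x y)]. As
    C*-algebras are concrete here, that product must be realised on a Hilbert space; this is the
    purpose of the GNS step. The sandwich identity is first available at the fixed points of [F],
    such as the elements of [pi(M)]; the operators satisfying it form a C*-algebra, so it spreads to
    [B]. Domination by [Psi] in all matrix norms, on top of minimality, is what ties the resulting
    cover to [psi].

    One scalar device stands in for functional calculus and square roots: if
    [a + z b + conj z c + |z|^2 d] is nonnegative for all complex [z], then [c] is the conjugate of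
    [b] and [|b|^2 <= a d]. Applied to block matrices with [c] on the diagonal and [X], [adj X] off
    it, it extracts norm bounds and adjoints from positivity. Weak compactness is replaced by limits
    of matrix coefficients along an ultrafilter, from which [kernel_ucp] rebuilds operators. *)

Section Conj.
Context {R : realType}.
Implicit Types a b : R[i].
Lemma conjcD a b : (a + b)^*%C = a^*%C + b^*%C. Proof. exact: rmorphD. Qed.
Lemma conjcM a b : (a * b)^*%C = a^*%C * b^*%C. Proof. exact: rmorphM. Qed.
Lemma conjcN a : (- a)^*%C = - a^*%C. Proof. exact: rmorphN. Qed.
Lemma conjcB a b : (a - b)^*%C = a^*%C - b^*%C. Proof. exact: rmorphB. Qed.
Lemma conjc_sum I r (P : pred I) (F : I -> R[i]) :
  (\sum_(i <- r | P i) F i)^*%C = \sum_(i <- r | P i) (F i)^*%C.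
Proof. exact: rmorph_sum. Qed.
Lemma normc_ge0 a : 0 <= normc a. Proof. by case: a => u v; exact: sqrtr_ge0. Qed.
Lemma normcJ' a : normc a^*%C = normc a.
Proof. by case: a => u v; rewrite /normc/= sqrrN. Qed.
Lemma normcE' a : `|a| = (normc a)%:C. Proof. by case: a. Qed.
Lemma normcR (x : R) : 0 <= x -> normc x%:C = x.
Proof. by move=> a0; rewrite /normc/= expr0n addr0 sqrtr_sqr ger0_norm. Qed.
Lemma Re_le_normc a : Re a <= normc a.
Proof. by rewrite -lecR; apply: le_trans (normc_ge_Re a); rewrite lecR ler_norm. Qed.
Lemma mulcJ a : a * a^*%C = (normc a ^+ 2)%:C.
Proof. by rewrite -sqr_normc normcE' rmorphXn. Qed.
End Conj.

Section Dot.
Context {R : realType} {H : hilbertType R}.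
Implicit Types (x y z : H) (a : R[i]).

Lemma dotDl x y z : hdot (x + y) z = hdot x z + hdot y z.
Proof. exact: linearDl. Qed.
Lemma dotDr x y z : hdot z (x + y) = hdot z x + hdot z y.
Proof. exact: linearDr. Qed.
Lemma dotZl a x z : hdot (a *: x) z = a * hdot x z.
Proof. exact: linearZl_LR. Qed.
Lemma dotZr a x z : hdot z (a *: x) = a^*%C * hdot z x.
Proof. exact: linearZr_LR. Qed.
Lemma dotC x y : hdot y x = (hdot x y)^*%C.
Proof. by rewrite (hermC (@hdot R H)) expr0 mul1r. Qed.
Lemma dot0l z : hdot 0 z = 0.
Proof. exact: linear0l. Qed.
Lemma dot0r z : hdot z 0 = 0.
Proof. by rewrite dotC dot0l conjc0. Qed.
Lemma dotNl x z : hdot (- x) z = - hdot x z.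
Proof. exact: linearNl. Qed.
Lemma dotNr x z : hdot z (- x) = - hdot z x.
Proof. exact: linearNr. Qed.
Lemma dotBl x y z : hdot (x - y) z = hdot x z - hdot y z.
Proof. by rewrite dotDl dotNl. Qed.
Lemma dotBr x y z : hdot z (x - y) = hdot z x - hdot z y.
Proof. by rewrite dotDr dotNr. Qed.
Lemma dot_suml I r (P : pred I) (F : I -> H) z :
  hdot (\sum_(i <- r | P i) F i) z = \sum_(i <- r | P i) hdot (F i) z.
Proof. by elim/big_rec2: _ => [|i u v _ <-]; rewrite ?dot0l ?dotDl. Qed.
Lemma dot_sumr I r (P : pred I) (F : I -> H) z :
  hdot z (\sum_(i <- r | P i) F i) = \sum_(i <- r | P i) hdot z (F i).
Proof. by elim/big_rec2: _ => [|i u v _ <-]; rewrite ?dot0r ?dotDr. Qed.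

Lemma rnormE x : `|x| = (rnorm x)%:C.
Proof. by rewrite /rnorm RRe_real// normr_real. Qed.
Lemma rnorm_ge0 x : 0 <= rnorm x.
Proof. by rewrite -ler0c -rnormE normr_ge0. Qed.
Lemma dotxx x : hdot x x = (rnorm x ^+ 2)%:C.
Proof. by rewrite hdot_normE rnormE rmorphXn. Qed.
Lemma Redotxx x : Re (hdot x x) = rnorm x ^+ 2.
Proof. by rewrite dotxx. Qed.
Lemma rnormD x y : rnorm (x + y) <= rnorm x + rnorm y.
Proof. by rewrite -lecR rmorphD/= -!rnormE ler_normD. Qed.
Lemma rnormZ a x : rnorm (a *: x) = normc a * rnorm x.
Proof. by apply: complexI; rewrite rmorphM/= -!rnormE normrZ. Qed.
Lemma rnormN x : rnorm (- x) = rnorm x.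
Proof. by rewrite /rnorm normrN. Qed.
Lemma rnormB x y : rnorm (x - y) = rnorm (y - x).
Proof. by rewrite -rnormN opprB. Qed.
Lemma rnorm0 : rnorm (0 : H) = 0.
Proof. by rewrite /rnorm normr0. Qed.
Lemma rnorm0_eq0 x : rnorm x = 0 -> x = 0.
Proof. by move=> x0; apply/eqP; rewrite -normr_eq0 rnormE x0. Qed.
End Dot.

Section Quadratic.
Context {R : realType}.
Implicit Types (a b c d z : R[i]).

(** Common source of the Cauchy-Schwarz inequalities and adjoint identities below: a positivity
    statement is tested on [z] times one vector plus another. The values at [0], [1], [-1], [i],
    [-i] settle the imaginary parts, the minimum over [z] the inequality. *)
Lemma quad_ge0 a b c d :
  (forall z, 0 <= a + z * b + z^*%C * c + z * z^*%C * d) ->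
  c = b^*%C /\ normc b ^+ 2 <= Re a * Re d.
Proof.
case: a b c d => [a a'] [b b'] [c c'] [d d'] h.
have k x y := h (x +i* y).
move: k => {}h.
have {}h x y : a' + (x * b' + y * b) + (x * c' - y * c) + (x ^+ 2 + y ^+ 2) * d' = 0 /\
   0 <= a + (x * b - y * b') + (x * c + y * c') + (x ^+ 2 + y ^+ 2) * d.
  have := h x y; rewrite lecE/= => /andP[/eqP h1 h2]; split; [rewrite -h1|apply: le_trans h2 _]; lra.
have [h0 p0] := h 0 0; have [h1 p1] := h 1 0; have [h2 p2] := h (-1) 0.
have [h3 p3] := h 0 1; have [h4 p4] := h 0 (-1).
have ec : c = b by lra.
have ec' : c' = - b' by lra.
subst c c'; split => //.
rewrite /normc sqr_sqrtr ?addr_ge0 ?sqr_ge0//.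
have d0 : 0 <= d.
  rewrite leNgt; apply/negP => d0.
  have a0 : 0 <= a by lra.
  (* If [d] were negative, at these two opposite real points the quadratic term would be [-(a + 1)]
     while the linear terms cancel in the sum. *)
  have [_] := h (Num.sqrt ((a + 1) / (- d))) 0.
  have [_] := h (- Num.sqrt ((a + 1) / (- d))) 0.
  rewrite !sqrrN sqr_sqrtr; last by rewrite divr_ge0//; lra.
  rewrite expr0n/= addr0.
  have -> : (a + 1) / (- d) * d = - (a + 1) by field; lra.
  lra.
have a0 : 0 <= a by lra.
case: (eqVneq d 0) => [d00|dn0].
  subst d; rewrite mulr0.
  have [->->] : b = 0 /\ b' = 0; last by rewrite expr0n/= addr0.
  have A x y : 0 <= a + 2 * (x * b - y * b') by have [_] := h x y; lra.
  suff: b ^+ 2 + b' ^+ 2 <= 0.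
    have := sqr_ge0 b; have := sqr_ge0 b' => *.
    by split; apply/eqP; rewrite -sqrf_eq0; apply/eqP; lra.
  rewrite leNgt; apply/negP => p.
  (* With [d = 0] the real part is affine in [z]; at this point it equals [a - 2 (a + 1) < 0]. *)
  have := A (- (a + 1) / (b ^+ 2 + b' ^+ 2) * b) ((a + 1) / (b ^+ 2 + b' ^+ 2) * b').
  have -> : - (a + 1) / (b ^+ 2 + b' ^+ 2) * b * b - (a + 1) / (b ^+ 2 + b' ^+ 2) * b' * b'
     = - (a + 1) by field; rewrite gt_eqF.
  lra.
have dp : 0 < d by rewrite lt_def dn0.
have [_] := h (- b / d) (b' / d).
have -> : a + (- b / d * b - b' / d * b') + (- b / d * b + b' / d * - b') +
   ((- b / d) ^+ 2 + (b' / d) ^+ 2) * d = (a * d - (b ^+ 2 + b' ^+ 2)) / d by field.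
by rewrite pmulr_lge0 ?invr_gt0//= => hh; lra.
Qed.
End Quadratic.

Section CS.
Context {R : realType} {H : hilbertType R}.
Implicit Types (x y z : H) (a : R[i]).

Lemma dot_CS2 x y : normc (hdot x y) ^+ 2 <= rnorm x ^+ 2 * rnorm y ^+ 2.
Proof.
have [|_] := @quad_ge0 R (hdot y y) (hdot x y) (hdot y x) (hdot x x).
  move=> z; have -> : hdot y y + z * hdot x y + z^*%C * hdot y x + z * z^*%C * hdot x x
    = hdot (z *: x + y) (z *: x + y).
    by rewrite !(dotDl, dotDr, dotZl, dotZr); ring.
  by rewrite dotxx ler0c sqr_ge0.
by rewrite !dotxx/= mulrC.
Qed.

Lemma dot_CS x y : normc (hdot x y) <= rnorm x * rnorm y.
Proof.
by rewrite -ler_sqr ?exprMn ?dot_CS2// nnegrE ?mulr_ge0 ?rnorm_ge0 ?normc_ge0.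
Qed.
End CS.

Section Linear.
Context {C : pzRingType} {U V : lmodType C} (T : U -> V) (hT : linear T).

Lemma linTD x y : T (x + y) = T x + T y.
Proof. by have := hT 1 x y; rewrite !scale1r. Qed.
Lemma linT0 : T 0 = 0.
Proof. by apply: (addrI (T 0)); rewrite -linTD !addr0. Qed.
Lemma linTZ a x : T (a *: x) = a *: T x.
Proof. by rewrite -[a *: x]addr0 hT linT0 addr0. Qed.
Lemma linTN x : T (- x) = - T x.
Proof. by rewrite -scaleN1r linTZ scaleN1r. Qed.
Lemma linTB x y : T (x - y) = T x - T y.
Proof. by rewrite linTD linTN. Qed.
Lemma linT_sum I r (P : pred I) (F : I -> U) :
  T (\sum_(i <- r | P i) F i) = \sum_(i <- r | P i) T (F i).
Proof. by elim/big_rec2: _ => [|i u v _ <-]; rewrite ?linT0 ?linTD. Qed.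
End Linear.

Section Bounded.
Context {R : realType}.
Implicit Types H K : hilbertType R.

(** Estimates are carried by bounds instead of [opnorm], whose supremum is meaningful only once
    boundedness is known. *)
Definition opbound {H K} (T : H -> K) (c : R) := forall x, rnorm (T x) <= c * rnorm x.

Lemma ball_rnorm {H} (x y : H) (e : R) : ball x e%:C y <-> rnorm (x - y) < e.
Proof. by rewrite -ball_normE/= rnormE ltcR. Qed.

Lemma linear_continuousP {H} (T : H -> H) : linear T ->
  continuous T <-> exists2 c, 0 <= c & opbound T c.
Proof.
move=> lT; split=> [cT|[c c0 Tc] x].
  have /cvgrPdist_lt/(_ 1 ltr01) := cT 0.
  rewrite (linT0 lT) => /nbhs_ballP[e /= e0 he].
  (* Radii live in [R[i]]; positivity makes them real. *)
  have [d ed] : exists d, e = d%:C.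
    by apply/complex_realP; rewrite ger0_real ?ltW.
  subst e; have d0 : 0 < d by rewrite -ltcR.
  exists (2 / d) => [|x]; first by rewrite divr_ge0 ?ltW.
  have [->|x0] := eqVneq x 0; first by rewrite (linT0 lT) !rnorm0 mulr0.
  have xp : 0 < rnorm x.
    rewrite lt_def rnorm_ge0 andbT; apply: contraNneq x0.
    by move=> /rnorm0_eq0 ->.
  (* Rescaled to norm [d / 2], the vector lies in the open ball of radius [d]; this yields the bound
     [2 / d]. *)
  have := he ((d / 2 / rnorm x)%:C *: x).
  have a0 : 0 < d / 2 / rnorm x by rewrite !divr_gt0.
  have na : normc (d / 2 / rnorm x)%:C = d / 2 / rnorm x.
    by apply: normcR; exact: ltW.
  rewrite ball_rnorm sub0r rnormN rnormZ na mulfVK ?gt_eqF//.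
  rewrite ltr_pdivrMr// ltr_pMr// ltr1n => /(_ isT)/=.
  rewrite sub0r normrN rnormE ltcR (linTZ lT) rnormZ na => /ltW.
  rewrite -ler_pdivlMl// => h; apply: le_trans h _.
  by rewrite le_eqVlt; apply/orP; left; apply/eqP; field; rewrite !gt_eqF.
apply/cvgrPdist_lt => e e0.
have [d ed] : exists d, e = d%:C.
  by apply/complex_realP; rewrite ger0_real ?ltW.
subst e; have d0 : 0 < d by rewrite -ltcR.
apply/nbhs_ballP; exists (d / (c + 1))%:C => /=.
  by rewrite ltcR divr_gt0// ltr_wpDl.
move=> y /ball_rnorm h.
rewrite rnormE ltcR -(linTB lT); apply: le_lt_trans (Tc _) _.
apply: (@le_lt_trans _ _ ((c + 1) * rnorm (x - y))).
  by rewrite ler_wpM2r ?rnorm_ge0// lerDl.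
by rewrite mulrC -ltr_pdivlMr// ltr_wpDl.
Qed.

Lemma bounded_opP {H} (T : H -> H) : bounded_op T <->
  linear T /\ exists2 c, 0 <= c & opbound T c.
Proof. by split=> -[lT /(linear_continuousP lT)]. Qed.

Lemma bounded_linear {H} (T : H -> H) : bounded_op T -> linear T.
Proof. by case. Qed.

Lemma opnorm_has_sup {H} (T : H -> H) : bounded_op T ->
  has_sup [set rnorm (T x) | x in [set x | rnorm x <= 1]].
Proof.
move=> /bounded_opP[lT [c c0 Tc]]; split.
  by exists (rnorm (T 0)), 0; rewrite //= rnorm0.
exists c => _ [x /= x1 <-]; apply: le_trans (Tc x) _.
by rewrite -[leRHS]mulr1 ler_wpM2l.
Qed.

Lemma opnorm_ge0 {H} (T : H -> H) : bounded_op T -> 0 <= opnorm T.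
Proof.
move=> bT; apply: (@le_trans _ _ (rnorm (T 0))); first exact: rnorm_ge0.
apply: sup_upper_bound (opnorm_has_sup bT) _ _.
by exists 0 => //=; rewrite rnorm0.
Qed.

Lemma opnorm_bound {H} (T : H -> H) : bounded_op T -> opbound T (opnorm T).
Proof.
move=> bT x; have [lT _] := bT.
have [->|x0] := eqVneq x 0; first by rewrite (linT0 lT) !rnorm0 mulr0.
have xp : 0 < rnorm x.
  rewrite lt_def rnorm_ge0 andbT; apply: contraNneq x0.
  by move=> /rnorm0_eq0 ->.
have xi : 0 <= (rnorm x)^-1 by rewrite invr_ge0 ltW.
rewrite -ler_pdivrMr//.
have -> : rnorm (T x) / rnorm x = rnorm (T ((rnorm x)^-1%:C *: x)).
  by rewrite (linTZ lT) rnormZ normcR// mulrC.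
apply: sup_upper_bound (opnorm_has_sup bT) _ _.
by exists ((rnorm x)^-1%:C *: x) => //=; rewrite rnormZ normcR// mulVf ?gt_eqF.
Qed.

Lemma opnorm_le {H} (T : H -> H) c : 0 <= c -> opbound T c -> opnorm T <= c.
Proof.
move=> c0 Tc; apply: ge_sup; first by exists (rnorm (T 0)), 0; rewrite //= rnorm0.
move=> _ [x /= x1 <-]; apply: le_trans (Tc x) _.
by rewrite -[leRHS]mulr1 ler_wpM2l.
Qed.

Lemma seq_complete {H} (u : nat -> H) :
  (forall e : R, 0 < e -> exists N, forall n m, (N <= n)%N -> (N <= m)%N ->
     rnorm (u n - u m) <= e) ->
  exists l, forall e : R, 0 < e -> exists N, forall n, (N <= n)%N -> rnorm (u n - l) <= e.
Proof.
move=> cu.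
have : cvg (u @ \oo).
  apply: cauchy_cvg; apply/cauchy_exP => e e0.
  have [d ed] : exists d, e = d%:C.
    by apply/complex_realP; rewrite ger0_real ?ltW.
  subst e; have d0 : 0 < d by rewrite -ltcR.
  have [N hN] := cu _ (divr_gt0 d0 (ltr0Sn _ 1)).
  exists (u N); exists N => //= n Nn; apply/ball_rnorm.
  by apply: le_lt_trans (hN _ _ _ Nn) _ => //; rewrite ltr_pdivrMr// ltr_pMr ?ltr1n.
move=> /cvg_ex[l ul]; exists l => e e0.
have /cvgrPdist_le/(_ e%:C) := ul; rewrite ltcR => /(_ e0)[N _ hN].
by exists N => n /hN/=; rewrite rnormE lecR rnormB.
Qed.

End Bounded.

(** * Riesz representation, operators from sesquilinear forms, adjoints *)

Section Riesz.
Context {R : realType}.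
Implicit Types H K : hilbertType R.

Lemma inv_succ_le (e : R) : 0 < e ->
  exists N, forall n, (N <= n)%N -> n.+1%:R^-1 <= e.
Proof.
move=> e0; exists (Num.trunc e^-1) => n Nn.
rewrite invf_ple ?posrE//; apply: ltW.
have := truncnS_gt e^-1; move/lt_le_trans; apply.
by rewrite ler_nat ltnS.
Qed.

Lemma dot_inj {H} (u v : H) : (forall y, hdot u y = hdot v y) -> u = v.
Proof.
move=> h; apply/eqP; rewrite -subr_eq0; apply/eqP/rnorm0_eq0/eqP.
by rewrite -sqrf_eq0 -Redotxx dotBl h subrr.
Qed.

Lemma dot_injr {H} (u v : H) : (forall y, hdot y u = hdot y v) -> u = v.
Proof. by move=> h; apply: dot_inj => y; rewrite dotC h -dotC. Qed.

Lemma rnorm_le {H} (u : H) c : 0 <= c -> (forall y, normc (hdot u y) <= c * rnorm y) -> rnorm u <= c.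
Proof.
move=> c0 h; have := h u; rewrite dotxx normcR ?sqr_ge0//.
have [->//|u0] := eqVneq (rnorm u) 0.
have up : 0 < rnorm u by rewrite lt_def u0 rnorm_ge0.
by rewrite expr2 ler_pM2r.
Qed.

(** The representing vector is the minimiser of the real functional [J x = |x|^2 - 2 Re (phi x)].
    Completeness enters through a minimising sequence, without orthogonal projections. *)
Lemma riesz {H} (phi : H -> R[i]) (c : R) : 0 <= c ->
  (forall x y, phi (x + y) = phi x + phi y) ->
  (forall a x, phi (a *: x) = a * phi x) ->
  (forall x, normc (phi x) <= c * rnorm x) ->
  exists y, forall x, phi x = hdot x y.
Proof.
move=> c0 pD pZ pc.
pose J x : R := rnorm x ^+ 2 - (Re (phi x)) *+ 2.
have JE x : (J x)%:C = hdot x x - phi x - (phi x)^*%C.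
  rewrite /J dotxx; case: (phi x) => u v; apply/eqP.
  by rewrite eq_complex/=; apply/andP; split; apply/eqP; lra.
have Jlb x : - c ^+ 2 <= J x.
  have := le_trans (Re_le_normc _) (pc x); have := sqr_ge0 (rnorm x - c).
  by rewrite /J; lra.
pose D := inf [set J x | x in setT].
have hD : has_inf [set J x | x in setT].
  by split; [exists (J 0), 0|exists (- c ^+ 2) => _ [x _ <-]].
have DJ x : D <= J x by apply: ge_inf hD.2 _ _; exists x.
have /choice[u uD] (n : nat) : exists x, J x <= D + n.+1%:R^-1.
  have n0 : 0 < n.+1%:R^-1 :> R by rewrite invr_gt0.
  have [_ [x _ <-] xD] := inf_adherent n0 hD.
  by exists x; exact: ltW.
(* Parallelogram law for [J]: the linear part drops out, so a minimising sequence is Cauchy. *)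
have par x y : rnorm (x - y) ^+ 2 = (J x + J y) *+ 2 - J (2^-1 *: (x + y)) *+ 4.
  apply: complexI; rewrite rmorphB/= !rmorphMn rmorphD/= !JE -dotxx.
  rewrite !(dotDl, dotDr, dotZl, dotZr, dotNl, dotNr, pZ, pD).
  have h2 : (2^-1 : R[i])^*%C = 2^-1 by rewrite conjc_inv conjc_nat.
  have -> : (2^-1 * (phi x + phi y))^*%C = 2^-1 * ((phi x)^*%C + (phi y)^*%C).
    by rewrite -[X in _ = X * _]h2 -rmorphD -rmorphM.
  rewrite h2.
  by field.
have [e e0|l ul] := @seq_complete R H u.
  have e20 : 0 < e ^+ 2 / 4 by rewrite divr_gt0// exprn_gt0.
  have [N hN] := inv_succ_le e20; exists N => n m Nn Nm.
  have e00 := ltW e0; rewrite -ler_sqr ?nnegrE ?rnorm_ge0// par.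
  have := uD n; have := uD m; have := hN _ Nn; have := hN _ Nm.
  have := DJ (2^-1 *: (u n + u m)).
  move: (J _) (J _) (J _) (n.+1%:R^-1) (m.+1%:R^-1) (e ^+ 2) => a b c' d f g; lra.
exists l => h; apply/eqP; rewrite -subr_eq0; apply/eqP/eq0_normc.
(* Along the complex line through [u n] in direction [h], the point [u n] minimises [J] up to
   [1 / (n + 1)]; the discriminant then bounds the derivative of [J] there. *)
have key n : normc (phi h - hdot h (u n)) ^+ 2 <= n.+1%:R^-1 * rnorm h ^+ 2.
  have [|_] := @quad_ge0 R (n.+1%:R^-1)%:C (hdot h (u n) - phi h)
     (hdot (u n) h - (phi h)^*%C) (hdot h h).
    move=> z; have : 0 <= ((J (z *: h + u n) - D) + (D + n.+1%:R^-1 - J (u n)))%:C.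
      by rewrite ler0c addr_ge0// subr_ge0.
    move/le_trans; apply; rewrite [X in X%:C](_ : _ = J (z *: h + u n) - J (u n) + n.+1%:R^-1); last ring.
    rewrite rmorphD rmorphB [X in X - _ + _]JE [X in _ - X + _]JE.
    rewrite !(dotDl, dotDr, dotZl, dotZr, pZ, pD).
    rewrite conjcD conjcM.
    by rewrite le_eqVlt; apply/orP; left; apply/eqP; ring.
  by rewrite dotxx /= -[X in normc X]opprB normcN.
apply/eqP; rewrite eq_le normc_ge0 andbT; apply/ler_addgt0Pr => e e0.
have e1 : 0 < e / 2 / (rnorm h + 1) by rewrite !divr_gt0// ltr_wpDl ?rnorm_ge0.
have [N1 h1] := inv_succ_le (exprn_gt0 2 e1).
have [N2 h2] := ul _ e1.
pose n := maxn N1 N2.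
rewrite add0r (_ : phi h - hdot h l = (phi h - hdot h (u n)) + hdot h (u n - l)); last first.
  by rewrite dotBr; ring.
apply: le_trans (le_normcD _ _) _.
have hh : e / 2 / (rnorm h + 1) * (rnorm h + 1) = e / 2.
  by rewrite mulfVK// gt_eqF// ltr_wpDl ?rnorm_ge0.
have hp := rnorm_ge0 h.
have k1 : normc (phi h - hdot h (u n)) <= e / 2.
  rewrite -ler_sqr ?nnegrE ?normc_ge0//; last by rewrite divr_ge0// ltW.
  apply: le_trans (key n) _; rewrite -hh exprMn.
  apply: ler_pM; rewrite ?invr_ge0 ?sqr_ge0//; first by apply: h1; rewrite leq_maxl.
  by rewrite ler_sqr ?nnegrE ?addr_ge0// lerDl.
have k2 : normc (hdot h (u n - l)) <= e / 2.
  apply: le_trans (dot_CS _ _) _; rewrite -hh mulrC.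
  apply: ler_pM; rewrite ?rnorm_ge0//; first by apply: h2; rewrite leq_maxr.
  by rewrite lerDl.
by rewrite [leRHS](_ : e = e / 2 + e / 2); [exact: lerD|field].
Qed.

Lemma sesqui_op {H K} (b : H -> K -> R[i]) (c : R) : 0 <= c ->
  (forall a x x' y, b (a *: x + x') y = a * b x y + b x' y) ->
  (forall a x y y', b x (a *: y + y') = a^*%C * b x y + b x y') ->
  (forall x y, normc (b x y) <= c * rnorm x * rnorm y) ->
  exists T : H -> K, [/\ linear T, opbound T c & forall x y, hdot (T x) y = b x y].
Proof.
move=> c0 bl br bc.
have b0r x : b x 0 = 0.
  have := br 1 x 0 0; rewrite scaler0 addr0 conjc1 mul1r => /eqP.
  by rewrite eq_sym -subr_eq0 addrK => /eqP.
have /choice[T hT] x : exists v : K, forall y, hdot v y = b x y.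
  (* [riesz] represents linear functionals, hence the conjugate of [b x]. *)
  have [|y z|a y|y|v hv] := @riesz K (fun y => (b x y)^*%C) (c * rnorm x).
  - by rewrite mulr_ge0 ?rnorm_ge0.
  - by rewrite -[y]scale1r br scale1r conjc1 mul1r conjcD.
  - by rewrite -[a *: y]addr0 br b0r addr0 conjcM conjcK.
  - by rewrite normcJ'.
  by exists v => y; rewrite dotC -hv conjcK.
exists T; split => //.
  by move=> a x y; apply: dot_inj => z; rewrite dotDl dotZl !hT bl.
move=> x; apply: rnorm_le => [|y]; first by rewrite mulr_ge0 ?rnorm_ge0.
by rewrite hT.
Qed.

Lemma adjoint_exists {H} (T : H -> H) : bounded_op T ->
  exists2 S, bounded_op S & is_adjoint T S.
Proof.
move=> bT; have [lT _] := bT.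
have [||||S [lS Sc hS]] := @sesqui_op H H (fun y x => hdot y (T x)) (opnorm T).
- exact: opnorm_ge0.
- by move=> a x x' y; rewrite dotDl dotZl.
- by move=> a x y y'; rewrite lT dotDr dotZr.
- move=> x y; apply: le_trans (dot_CS _ _) _; rewrite [leRHS]mulrAC mulrC.
  by rewrite ler_wpM2r ?rnorm_ge0// opnorm_bound.
exists S; first by apply/bounded_opP; split=> //; exists (opnorm T); [exact: opnorm_ge0|].
by move=> x y; rewrite dotC -hS -dotC.
Qed.

Lemma adjoint_uniq {H} (T S S' : H -> H) : is_adjoint T S -> is_adjoint T S' -> S = S'.
Proof. by move=> h h'; apply/funext => y; apply: dot_injr => x; rewrite -h h'. Qed.

Lemma is_adjointC {H} (T S : H -> H) : is_adjoint T S -> is_adjoint S T.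
Proof. by move=> h x y; rewrite dotC -h -dotC. Qed.

(** Total by the default [T], so that it can be written before boundedness is established. *)
Definition adj {H} (T : H -> H) : H -> H := xget T [set S | bounded_op S /\ is_adjoint T S].

Lemma adjP {H} (T : H -> H) : bounded_op T -> is_adjoint T (adj T).
Proof.
move=> bT; rewrite /adj; case: xgetP => [_ -> []//|h].
by have [S bS aS] := adjoint_exists bT; case: (h S).
Qed.

Lemma adj_bounded {H} (T : H -> H) : bounded_op T -> bounded_op (adj T).
Proof.
move=> bT; rewrite /adj; case: xgetP => [_ -> []//|h].
by have [S bS aS] := adjoint_exists bT; case: (h S).
Qed.

Lemma adj_eq {H} (T S : H -> H) : bounded_op T -> is_adjoint T S -> adj T = S.
Proof. by move=> bT; apply: adjoint_uniq; exact: adjP. Qed.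

Lemma adjK {H} (T : H -> H) : bounded_op T -> adj (adj T) = T.
Proof. by move=> bT; apply: adj_eq; [exact: adj_bounded|exact/is_adjointC/adjP]. Qed.

Lemma adj_dotl {H} (T : H -> H) x y : bounded_op T -> hdot (adj T x) y = hdot x (T y).
Proof. by move=> bT; rewrite dotC -adjP// -dotC. Qed.

End Riesz.

Section BoundedAlgebra.
Context {R : realType} {H : hilbertType R}.
Implicit Types S T : H -> H.

Lemma bounded_op_lin (a : R[i]) S T : bounded_op S -> bounded_op T -> bounded_op (a *: S + T).
Proof.
move=> /bounded_opP[lS [c c0 Sc]] /bounded_opP[lT [d d0 Td]].
apply/bounded_opP; split=> [b x y|].
  rewrite !fctE lS lT !scalerDr !scalerA -!addrA; congr (_ + _).
    by rewrite mulrC.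
  by rewrite addrCA.
exists (normc a * c + d) => [|x]; first by rewrite addr_ge0 ?mulr_ge0 ?normc_ge0.
rewrite !fctE; apply: le_trans (rnormD _ _) _; rewrite rnormZ mulrDl lerD//.
by rewrite -mulrA ler_wpM2l ?normc_ge0.
Qed.

Lemma bounded_op0 : bounded_op (0 : H -> H).
Proof.
apply/bounded_opP; split=> [a x y|]; first by rewrite -[LHS]/(0 : H) -[RHS]/(a *: (0 : H) + 0) scaler0 addr0.
by exists 0 => // x; rewrite mul0r -[X in rnorm X]/(0 : H) rnorm0.
Qed.

Lemma bounded_op_id : bounded_op (@id H).
Proof. by apply/bounded_opP; split=> //; exists 1 => // x; rewrite mul1r. Qed.

Lemma bounded_op_comp S T : bounded_op S -> bounded_op T -> bounded_op (S \o T).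
Proof.
move=> /bounded_opP[lS [c c0 Sc]] /bounded_opP[lT [d d0 Td]].
apply/bounded_opP; split=> [a x y|]; first by rewrite /= lT lS.
exists (c * d) => [|x]; first exact: mulr_ge0.
by apply: le_trans (Sc _) _; rewrite -mulrA ler_wpM2l.
Qed.

Lemma bounded_op_subspace : op_subspace (@bounded_op R H).
Proof.
by split; [|exact: bounded_op0|move=> *; exact: bounded_op_lin].
Qed.

Lemma op_subspaceZ (A : set (H -> H)) a T : op_subspace A -> A T -> A (a *: T).
Proof. by case=> _ A0 AD AT; rewrite -[_ *: _]addr0; exact: AD. Qed.

Lemma op_subspaceD (A : set (H -> H)) S T : op_subspace A -> A S -> A T -> A (S + T).
Proof. by case=> _ A0 AD AS AT; rewrite -[S]scale1r; exact: AD. Qed.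

Lemma op_subspaceB (A : set (H -> H)) S T : op_subspace A -> A S -> A T -> A (S - T).
Proof. by case=> _ A0 AD AS AT; rewrite addrC -scaleN1r; exact: AD. Qed.

Lemma op_subspace_sum (A : set (H -> H)) I r (P : pred I) F : op_subspace A ->
  (forall i, A (F i)) -> A (\sum_(i <- r | P i) F i).
Proof.
by move=> sA AF; elim/big_rec: _ => [|i x _ Ax]; [case: sA|exact: op_subspaceD].
Qed.

Lemma adj_id : adj (@id H) = id.
Proof. by apply: adj_eq => //; exact: bounded_op_id. Qed.

Lemma adj_comp S T : bounded_op S -> bounded_op T -> adj (S \o T) = adj T \o adj S.
Proof.
move=> bS bT; apply: adj_eq; first exact: bounded_op_comp.
by move=> x y; rewrite /= adjP// adjP.
Qed.

Lemma adj_lin a S T : bounded_op S -> bounded_op T ->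
  adj (a *: S + T) = a^*%C *: adj S + adj T.
Proof.
move=> bS bT; apply: adj_eq; first exact: bounded_op_lin.
by move=> x y; rewrite !fctE dotDl dotZl dotDr dotZr conjcK !adjP.
Qed.

Lemma opnorm_adj T : bounded_op T -> opbound (adj T) (opnorm T).
Proof.
move=> bT x; apply: rnorm_le => [|y]; first by rewrite mulr_ge0 ?opnorm_ge0 ?rnorm_ge0.
rewrite adj_dotl//; apply: le_trans (dot_CS _ _) _; rewrite mulrAC mulrC.
by rewrite ler_wpM2r ?rnorm_ge0// opnorm_bound.
Qed.
End BoundedAlgebra.

(** * Operator matrices over finite index types *)

Section Families.
Context {R : realType}.
Implicit Types H K : hilbertType R.

(** Families over arbitrary finite types replace square matrices: blocks are indexed by sum types,
    single operators by [unit], list entries by a sigma type, without arithmetic on sizes. Working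
    with forms keeps the arguments scalar. *)
Definition opform {H} {I J : finType} (X : J -> I -> H -> H) (x : I -> H) (y : J -> H) :=
  \sum_j \sum_i hdot (X j i (x i)) (y j).

Definition fam_ge0 {H} {I : finType} (X : I -> I -> H -> H) := forall x, 0 <= opform X x x.

Definition sqn {H} {I : finType} (x : I -> H) : R := \sum_i rnorm (x i) ^+ 2.

(* [fbound X c]: the operator from the Hilbert sum over [I] to the one over [J]
   with matrix [X] has norm at most [c]; squared to avoid square roots of sums. *)
Definition fbound {H} {I J : finType} (X : J -> I -> H -> H) (c : R) :=
  forall x y, normc (opform X x y) ^+ 2 <= c ^+ 2 * (sqn x * sqn y).

Lemma sqn_ge0 {H} {I : finType} (x : I -> H) : 0 <= sqn x.
Proof. by apply: sumr_ge0 => i _; exact: sqr_ge0. Qed.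

(* [k T x y] is to be thought of as [hdot (f T x) y], for an [f] that need not
   be available yet as an operator-valued map. *)
Definition kcp {H K} (A : set (H -> H)) (k : (H -> H) -> K -> K -> R[i]) :=
  forall (I : finType) (X : I -> I -> H -> H), (forall i j, A (X i j)) -> fam_ge0 X ->
  forall v : I -> K, 0 <= \sum_i \sum_j k (X i j) (v j) (v i).

Definition klin {H K} (A : set (H -> H)) (k : (H -> H) -> K -> K -> R[i]) :=
  forall a S T x y, A S -> A T -> k (a *: S + T) x y = a * k S x y + k T x y.

(** Enumeration carries positivity from ordinals to all finite types; the right-hand side is the
    shape in which complete positivity is used and checked below. *)
Lemma cp_kcp {H K} (A : set (H -> H)) (f : (H -> H) -> (K -> K)) :
  completely_positive A f <-> kcp A (fun T x y => hdot (f T x) y).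
Proof.
split=> [cf I X AX X0 v|kf n X AX X0 x].
  have AM : mx_in A (\matrix_(i < #|I|, j < #|I|) X (enum_val i) (enum_val j)).
    by move=> i j; rewrite mxE.
  have := cf _ _ AM; rewrite /mxop_ge0 => h.
  suff: mxop_ge0 (\matrix_(i < #|I|, j < #|I|) X (enum_val i) (enum_val j)).
    move=> /h/(_ (fun i => v (enum_val i))).
    rewrite [X in _ -> _ <= X]big_enum_val; congr (_ <= _).
    apply: eq_bigr => i _; rewrite [RHS]big_enum_val/= dot_suml.
    by apply: eq_bigr => j _; rewrite !mxE.
  move=> x; have := X0 (fun i => x (enum_rank i)); congr (_ <= _).
  rewrite /opform big_enum_val; apply: eq_bigr => i _.
  rewrite big_enum_val dot_suml enum_valK.
  by apply: eq_bigr => j _; rewrite !mxE enum_valK.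
have := kf _ (fun i j => X i j) (fun i j => AX i j) => h.
have := h _ x; have X0' : fam_ge0 (fun i j => X i j).
  move=> y; have := X0 y; congr (_ <= _); apply: eq_bigr => i _.
  by rewrite /mxact dot_suml.
move=> /(_ X0'); congr (_ <= _); apply: eq_bigr => i _.
by rewrite /mxact dot_suml; apply: eq_bigr => j _; rewrite mxE.
Qed.

Definition blk {T} {I J : Type} (P : I -> I -> T) (Y : I -> J -> T) (X : J -> I -> T)
    (Q : J -> J -> T) (s t : I + J) : T :=
  match s, t with
  | inl i, inl i' => P i i' | inl i, inr j => Y i j
  | inr j, inl i => X j i | inr j, inr j' => Q j j'
  end.

Lemma sum_blk {T} {I J : finType} (P : I -> I -> T) Y X Q (F : I + J -> I + J -> T -> R[i]) :
  \sum_s \sum_t F s t (blk P Y X Q s t) =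
  \sum_i \sum_i' F (inl i) (inl i') (P i i') + \sum_i \sum_j F (inl i) (inr j) (Y i j) +
  (\sum_j \sum_i F (inr j) (inl i) (X j i) + \sum_j \sum_j' F (inr j) (inr j') (Q j j')).
Proof.
rewrite big_sumType/=; congr (_ + _); rewrite -big_split/=; apply: eq_bigr => i _;
  by rewrite big_sumType.
Qed.

(** Scaling the first block by [z] is a congruence and preserves positivity; the values of [k] on
    the scaled matrices form a polynomial in [z] to which [quad_ge0] applies. So the off-diagonal
    values are conjugate and dominated by the corners. *)
Lemma kcp_block {H K} (A : set (H -> H)) k {I J : finType} P Y X Q (v : I -> K) (w : J -> K) :
  op_subspace A -> kcp A k -> klin A k ->
  (forall s t, A (blk P Y X Q s t)) -> fam_ge0 (blk P Y X Q) ->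
  let x := \sum_j \sum_i k (X j i) (v i) (w j) in
  \sum_i \sum_j k (Y i j) (w j) (v i) = x^*%C /\
  normc x ^+ 2 <= Re (\sum_i \sum_i' k (P i i') (v i') (v i)) *
                  Re (\sum_j \sum_j' k (Q j j') (w j') (w j)).
Proof.
move=> sA kA lA AX X0 /=; rewrite [X in _ <= X]mulrC.
have [A_b A0 _] := sA.
have k0 x y : k 0 x y = 0.
  have := lA 1 0 0 x y A0 A0; rewrite scaler0 addr0 mul1r => /eqP.
  by rewrite -subr_eq0 opprD addNKr oppr_eq0 => /eqP.
have kZ a T x y : A T -> k (a *: T) x y = a * k T x y.
  by move=> AT; rewrite -[a *: T]addr0 lA// k0 addr0.
apply: quad_ge0 => z.
pose B := blk (fun i i' => (z * z^*%C) *: P i i') (fun i j => z^*%C *: Y i j)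
   (fun j i => z *: X j i) Q.
have AB s t : A (B s t).
  by case: s t => [i|j] [i'|j']; [have := AX (inl i) (inl i')|have := AX (inl i) (inr j')|
    have := AX (inr j) (inl i')|exact: AX (inr j) (inr j')]; exact: op_subspaceZ.
have B0 : fam_ge0 B.
  move=> x; have := X0 (fun s => if s is inl i then z *: x (inl i) else x s).
  have lX s t : linear (blk P Y X Q s t) := bounded_linear (A_b _ (AX s t)).
  congr (_ <= _); rewrite /opform.
  rewrite (sum_blk P Y X Q (fun s t T => hdot (T _) _)).
  rewrite (sum_blk _ _ _ _ (fun s t T => hdot (T (x t)) (x s))).
  congr (_ + _ + (_ + _)); apply: eq_bigr => i _; apply: eq_bigr => j _//.
  - by have /= -> := linTZ (lX (inl i) (inl j)); rewrite fctE dotZl dotZr dotZl mulrA.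
  - by rewrite fctE dotZr dotZl.
  - by have /= -> := linTZ (lX (inr i) (inl j)); rewrite fctE.
have := kA _ _ AB B0 (fun s => match s with inl i => v i | inr j => w j end).
rewrite (sum_blk _ _ _ _ (fun s t T => k T _ _)).
move=> /le_trans; apply; rewrite le_eqVlt; apply/orP; left; apply/eqP.
have kS (I' J' : finType) a (Z : I' -> J' -> H -> H) (v' : J' -> K) (w' : I' -> K) :
    (forall i j, A (Z i j)) ->
    \sum_i \sum_j k (a *: Z i j) (v' j) (w' i) = a * \sum_i \sum_j k (Z i j) (v' j) (w' i).
  move=> AZ; rewrite mulr_sumr; apply: eq_bigr => i _; rewrite mulr_sumr.
  by apply: eq_bigr => j _; rewrite kZ.
have AP i j : A (P i j) := AX (inl i) (inl j).
have AY i j : A (Y i j) := AX (inl i) (inr j).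
have AX' i j : A (X i j) := AX (inr i) (inl j).
rewrite !kS//.
by ring.
Qed.

Lemma opform_dot {H} {I J : finType} (X : J -> I -> H -> H) x y :
  opform X x y = \sum_j hdot (\sum_i X j i (x i)) (y j).
Proof. by apply: eq_bigr => j _; rewrite dot_suml. Qed.

Lemma dot_fam_CS {H} {I : finType} (x y : I -> H) :
  normc (\sum_i hdot (x i) (y i)) ^+ 2 <= sqn x * sqn y.
Proof.
have sE (u : I -> H) : \sum_i hdot (u i) (u i) = (sqn u)%:C.
  by rewrite /sqn rmorph_sum; apply: eq_bigr => i _; exact: dotxx.
have [|_] := @quad_ge0 R (\sum_i hdot (y i) (y i)) (\sum_i hdot (x i) (y i))
  (\sum_i hdot (y i) (x i)) (\sum_i hdot (x i) (x i)).
  move=> z; have : 0 <= \sum_i hdot (z *: x i + y i) (z *: x i + y i).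
    by apply: sumr_ge0 => i _; rewrite dotxx ler0c sqr_ge0.
  move=> /le_trans; apply; rewrite !mulr_sumr -!big_split/= le_eqVlt.
  apply/orP; left; apply/eqP/eq_bigr => i _.
  by rewrite !(dotDl, dotDr, dotZl, dotZr); ring.
by rewrite !sE/= mulrC.
Qed.

Lemma fboundP {H} {I J : finType} (X : J -> I -> H -> H) c :
  fbound X c <-> forall x, sqn (fun j => \sum_i X j i (x i)) <= c ^+ 2 * sqn x.
Proof.
split=> h x; last first.
  move=> y; rewrite opform_dot; apply: le_trans (dot_fam_CS _ _) _.
  by rewrite mulrA ler_wpM2r ?sqn_ge0.
(* The form is tested at [y = X x]. *)
set y := fun j => _; have := h x y; rewrite opform_dot.
have -> : \sum_j hdot (\sum_i X j i (x i)) (y j) = (sqn y)%:C.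
  by rewrite /sqn rmorph_sum; apply: eq_bigr => i _; exact: dotxx.
rewrite normcR ?sqn_ge0// mulrA.
have [->|y0] := eqVneq (sqn y) 0.
  by rewrite mulr_ge0 ?sqr_ge0 ?sqn_ge0.
by rewrite expr2 ler_pM2r// lt_def y0 sqn_ge0.
Qed.
End Families.

Section MatrixNorm.
Context {R : realType}.
Implicit Types H K : hilbertType R.

Lemma sum_unit (V : nmodType) (F : unit -> V) : \sum_i F i = F tt.
Proof. by rewrite (bigD1 tt)//= big1 ?addr0// => -[]. Qed.

Lemma form_diag {H} {W : Type} {I : finType} (k : (H -> H) -> W -> W -> R[i]) (S : H -> H) (v : I -> W) :
  (forall x y, k 0 x y = 0) ->
  \sum_i \sum_j k (if i == j then S else 0) (v j) (v i) = \sum_i k S (v i) (v i).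
Proof.
move=> k0; apply: eq_bigr => i _.
rewrite (bigD1 i)//= eqxx big1 ?addr0// => j ji.
by rewrite eq_sym (negPf ji) k0.
Qed.

Lemma sum_dotxx {H} {I : finType} (u : I -> H) : \sum_i hdot (u i) (u i) = (sqn u)%:C.
Proof. by rewrite /sqn rmorph_sum; apply: eq_bigr => i _; exact: dotxx. Qed.

(** The sum of all entry norms is a crude bound, taken because only its finiteness matters later. *)
Lemma fbound_entries {H} {I J : finType} (X : J -> I -> H -> H) :
  (forall i j, bounded_op (X i j)) -> exists2 c, 0 <= c & fbound X c.
Proof.
move=> bX; pose c := \sum_j \sum_i opnorm (X j i).
have c0 : 0 <= c by do 2![apply: sumr_ge0 => *]; exact: opnorm_ge0.
exists c => //; apply/fboundP => x.
have ub i : rnorm (x i) <= Num.sqrt (sqn x).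
  rewrite -ler_sqr ?nnegrE ?rnorm_ge0 ?sqrtr_ge0// sqr_sqrtr ?sqn_ge0//.
  by rewrite /sqn (bigD1 i)//= lerDl sumr_ge0// => *; exact: sqr_ge0.
have rs (L : finType) (F : L -> H) : rnorm (\sum_i F i) <= \sum_i rnorm (F i).
  elim/big_rec2: _ => [|i u v _ h]; first by rewrite rnorm0.
  by apply: le_trans (rnormD _ _) _; rewrite lerD2l.
have h j : rnorm (\sum_i X j i (x i)) <= (\sum_i opnorm (X j i)) * Num.sqrt (sqn x).
  apply: le_trans (rs _ _) _; rewrite mulr_suml; apply: ler_sum => i _.
  by apply: le_trans (opnorm_bound (bX j i) _) _; rewrite ler_wpM2l ?opnorm_ge0.
have sq (L : finType) (F : L -> R) : (forall i, 0 <= F i) -> \sum_i F i ^+ 2 <= (\sum_i F i) ^+ 2.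
  move=> F0; rewrite [leRHS]expr2 mulr_suml; apply: ler_sum => i _.
  rewrite expr2 ler_wpM2l// (bigD1 i)//= lerDl sumr_ge0//.
apply: le_trans (sq _ _ _) _ => [j|]; first exact: rnorm_ge0.
rewrite -[X in _ * X](sqr_sqrtr (sqn_ge0 x)) -exprMn ler_sqr ?nnegrE.
- by rewrite mulr_suml; apply: ler_sum => j _; exact: h.
- by apply: sumr_ge0 => j _; exact: rnorm_ge0.
- by rewrite mulr_ge0 ?sqrtr_ge0.
Qed.

Lemma l2norm_fboundP {H} n (X : 'M[H -> H]_n) c : 0 <= c ->
  fbound X c <-> forall x, l2norm (mxact X x) <= c * l2norm x.
Proof.
move=> c0; rewrite fboundP; split=> h x.
  rewrite -ler_sqr ?nnegrE ?mulr_ge0 ?sqrtr_ge0//.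
  by rewrite exprMn !sqr_sqrtr ?sqn_ge0//; exact: h.
have := h x; rewrite -ler_sqr ?nnegrE ?mulr_ge0 ?sqrtr_ge0//.
by rewrite exprMn !sqr_sqrtr ?sqn_ge0.
Qed.

Lemma mxact_lin {H} n (X : 'M[H -> H]_n) a x : (forall i j, linear (X i j)) ->
  mxact X (fun i => a *: x i) = fun i => a *: mxact X x i.
Proof.
move=> lX; apply/funext => i; rewrite /mxact scaler_sumr.
by apply: eq_bigr => j _; rewrite (linTZ (lX i j)).
Qed.

Lemma l2normZ {H} n (x : 'I_n -> H) (a : R) : 0 <= a ->
  l2norm (fun i => a%:C *: x i) = a * l2norm x.
Proof.
move=> a0; rewrite /l2norm -[in RHS](ger0_norm a0) -sqrtr_sqr -sqrtrM ?sqr_ge0//.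
congr Num.sqrt; rewrite mulr_sumr; apply: eq_bigr => i _.
by rewrite rnormZ normcR// exprMn.
Qed.

Lemma l2norm0 {H} n : l2norm (fun _ : 'I_n => 0 : H) = 0.
Proof. by rewrite /l2norm big1 ?sqrtr0// => i _; rewrite rnorm0 expr0n. Qed.

Lemma mxopnorm_ubound {H} n (X : 'M[H -> H]_n) c : 0 <= c -> fbound X c ->
  ubound [set l2norm (mxact X x) | x in [set x | l2norm x <= 1]] c.
Proof.
move=> c0 /(l2norm_fboundP _ c0) Xc _ [x /= x1 <-]; apply: le_trans (Xc x) _.
by rewrite -[leRHS]mulr1 ler_wpM2l.
Qed.

Lemma mxopnorm_le {H} n (X : 'M[H -> H]_n) c : 0 <= c -> fbound X c -> mxopnorm X <= c.
Proof.
move=> c0 Xc; apply: ge_sup (mxopnorm_ubound c0 Xc).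
by exists (l2norm (mxact X (fun=> 0))), (fun=> 0); rewrite //= l2norm0.
Qed.

Lemma mxopnorm_bound {H} n (X : 'M[H -> H]_n) : (forall i j, bounded_op (X i j)) ->
  0 <= mxopnorm X /\ fbound X (mxopnorm X).
Proof.
move=> bX; have [c c0 Xc] := fbound_entries bX.
have hs : has_sup [set l2norm (mxact X x) | x in [set x | l2norm x <= 1]].
  split; last by exists c; exact: mxopnorm_ubound.
  by exists (l2norm (mxact X (fun=> 0))), (fun=> 0); rewrite //= l2norm0.
have lX i j : linear (X i j) := bounded_linear (bX i j).
have n0 : 0 <= mxopnorm X.
  apply: (@le_trans _ _ (l2norm (mxact X (fun=> 0)))); first exact: sqrtr_ge0.
  by apply: sup_upper_bound hs _ _; exists (fun=> 0); rewrite //= l2norm0.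
split=> //; apply/l2norm_fboundP => // x.
have [x0|x0] := eqVneq (l2norm x) 0.
  by have /(l2norm_fboundP _ c0)/(_ x) := Xc; rewrite x0 !mulr0.
have xp : 0 < l2norm x by rewrite lt_def x0 sqrtr_ge0.
have xi : 0 <= (l2norm x)^-1 by rewrite invr_ge0 ltW.
rewrite -ler_pdivrMr//.
have -> : l2norm (mxact X x) / l2norm x = l2norm (mxact X (fun i => (l2norm x)^-1%:C *: x i)).
  by rewrite mxact_lin// l2normZ// mulrC.
apply: sup_upper_bound hs _ _.
by exists (fun i => (l2norm x)^-1%:C *: x i) => //=; rewrite l2normZ// mulVf.
Qed.

(** Reduces norm inequalities to the transfer of bounds, the form in which complete contractivity
    and the GNS construction are available. *)
Lemma mxopnorm_mono {H K} n (X : 'M[H -> H]_n) (Y : 'M[K -> K]_n) :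
  (forall i j, bounded_op (X i j)) ->
  (forall c, 0 <= c -> fbound X c -> fbound Y c) -> mxopnorm Y <= mxopnorm X.
Proof. by move=> /mxopnorm_bound[n0 Xn] h; apply: mxopnorm_le n0 (h _ n0 Xn). Qed.

Lemma fbound1 {H} (T : H -> H) c : 0 <= c ->
  fbound (fun _ _ : unit => T) c <-> opbound T c.
Proof.
move=> c0; rewrite fboundP.
have s1 (u : unit -> H) : sqn u = rnorm (u tt) ^+ 2.
  by rewrite /sqn (bigD1 tt)//= big1 ?addr0// => -[].
split=> h x.
  have := h (fun=> x); rewrite !s1 sum_unit.
  by rewrite -exprMn ler_sqr ?nnegrE ?mulr_ge0 ?rnorm_ge0.
rewrite !s1 sum_unit.
by rewrite -exprMn ler_sqr ?nnegrE ?mulr_ge0 ?rnorm_ge0.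
Qed.
End MatrixNorm.

(** * Unital completely positive maps contract matrix norms and commute with adjoints *)

Section CompleteContraction.
Context {R : realType} {H K : hilbertType R}.
Implicit Types (A : set (H -> H)).

Definition selfadjoint_unital A :=
  [/\ op_subspace A, A id & forall T, A T -> A (adj T)].

(** Paulsen's matrix: at [(x, y)] its form is [c |x|^2 + c |y|^2 + 2 Re <X x, y>], nonnegative by
    the arithmetic-geometric mean inequality. It turns norm bounds into positivity. *)
Lemma norm_block_ge0 {I J : finType} (X : J -> I -> H -> H) (c : R) : 0 <= c ->
  (forall j i, bounded_op (X j i)) -> fbound X c ->
  fam_ge0 (blk (fun i i' : I => if i == i' then c%:C *: id else 0) (fun i j => adj (X j i)) X
               (fun j j' : J => if j == j' then c%:C *: id else 0)).
Proof.
move=> c0 bX Xc u; pose F s t (T : H -> H) := hdot (T (u t)) (u s).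
set B := blk _ _ _ _; change (0 <= \sum_s \sum_t F s t (B s t)).
rewrite sum_blk {}/F.
rewrite !(form_diag (k := fun T x y => hdot (T x) y)); try by move=> *; exact: dot0l.
set x := fun i => u (inl i); set y := fun j => u (inr j).
have d (L : finType) (v : L -> H) : \sum_i hdot ((c%:C *: id) (v i)) (v i) = (c * sqn v)%:C.
  rewrite rmorphM/= -sum_dotxx mulr_sumr; apply: eq_bigr => i _.
  by rewrite fctE dotZl.
rewrite (d _ x) (d _ y).
have -> : \sum_i \sum_j hdot (adj (X j i) (u (inr j))) (u (inl i)) = (opform X x y)^*%C.
  rewrite exchange_big conjc_sum; apply: eq_bigr => j _; rewrite conjc_sum.
  by apply: eq_bigr => i _; rewrite adj_dotl// -dotC.
rewrite -/(opform X x y) addrACA -addrA (addrA (opform X x y)) addcJ addrCA -rmorphD/=.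
have -> : 2%:R * (Re (opform X x y))%:C = (2 * Re (opform X x y))%:C :> R[i].
  by rewrite rmorphM rmorph_nat.
rewrite -rmorphD ler0c/=.
have h : normc (opform X x y) <= (c * sqn x + c * sqn y) / 2.
  rewrite -ler_sqr ?nnegrE ?normc_ge0//; last first.
    by rewrite divr_ge0 ?addr_ge0 ?mulr_ge0 ?sqn_ge0.
  apply: le_trans (Xc x y) _; have := sqr_ge0 (c * (sqn x - sqn y)).
  by move: (sqn x) (sqn y) => a b; lra.
have := Re_le_normc (- opform X x y); rewrite normcN raddfN/=; lra.
Qed.

Lemma op_if A (b : bool) (c : R[i]) : op_subspace A -> A id -> A (if b then c *: id else 0).
Proof. by move=> sA A1; case: b; [exact: op_subspaceZ|case: sA]. Qed.

Lemma selfadjoint_block A {I J : finType} (X : J -> I -> H -> H) (c : R) :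
  selfadjoint_unital A -> (forall j i, A (X j i)) -> forall s t,
  A (blk (fun i i' : I => if i == i' then c%:C *: id else 0) (fun i j => adj (X j i)) X
               (fun j j' : J => if j == j' then c%:C *: id else 0) s t).
Proof.
by move=> [sA A1 Aa] AX [i|j] [i'|j']; [exact: op_if|exact: Aa|exact: AX|exact: op_if].
Qed.

Lemma klin_fun A (f : (H -> H) -> (K -> K)) :
  linear_on A f -> klin A (fun T x y => hdot (f T x) y).
Proof. by move=> lf a S T x y AS AT; rewrite lf// fctE dotDl dotZl. Qed.

Lemma linear_on0 A (f : (H -> H) -> (K -> K)) : op_subspace A -> linear_on A f -> f 0 = 0.
Proof.
move=> [_ A0 _] lf; have /eqP := lf 1 0 0 A0 A0.
by rewrite !scale1r addr0 -subr_eq0 opprD addNKr oppr_eq0 => /eqP.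
Qed.

Lemma linear_onZ A (f : (H -> H) -> (K -> K)) a T : op_subspace A -> linear_on A f ->
  A T -> f (a *: T) = a *: f T.
Proof.
move=> sA lf AT; have [_ A0 _] := sA.
by rewrite -[a *: T]addr0 lf// (linear_on0 sA lf) addr0.
Qed.

(** The image of Paulsen's matrix is positive and keeps its corners because the map is unital;
    Cauchy-Schwarz for the off-diagonal entries is the bound. *)
Lemma ucp_fbound A (f : (H -> H) -> (K -> K)) {I J : finType} (X : J -> I -> H -> H) c :
  selfadjoint_unital A -> ucp A f -> 0 <= c -> (forall j i, A (X j i)) ->
  fbound X c -> fbound (fun j i => f (X j i)) c.
Proof.
move=> uA [fb lf f1 cf] c0 AX Xc v w.
have [sA A1 Aa] := uA.
have AB := selfadjoint_block c uA AX.
have bX j i : bounded_op (X j i) by have [+ _ _] := sA; apply; exact: AX.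
have /cp_kcp kf := cf.
have [_] := kcp_block v w sA kf (klin_fun lf) AB (norm_block_ge0 c0 bX Xc).
have k0 (x y : K) : hdot (f 0 x) y = 0 by rewrite (linear_on0 sA lf) dot0l.
rewrite !(form_diag (k := fun T x y => hdot (f T x) y))//.
rewrite (linear_onZ _ sA lf A1) f1.
have d (L : finType) (u : L -> K) : \sum_i hdot ((c%:C *: id) (u i)) (u i) = (c * sqn u)%:C.
  rewrite rmorphM/= -sum_dotxx mulr_sumr; apply: eq_bigr => i _.
  by rewrite fctE dotZl.
by rewrite !d/= mulrACA -expr2.
Qed.

Lemma ucp_opbound A (f : (H -> H) -> (K -> K)) T c :
  selfadjoint_unital A -> ucp A f -> 0 <= c -> A T -> opbound T c -> opbound (f T) c.
Proof.
move=> uA uf c0 AT Tc; apply/fbound1 => //.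
by apply: (ucp_fbound uA uf c0 (X := fun _ _ : unit => T)) => //; exact/fbound1.
Qed.

(** The conjugate symmetry in [kcp_block], read on Paulsen's matrix of the single operator [T]. *)
Lemma ucp_adj A (f : (H -> H) -> (K -> K)) T :
  selfadjoint_unital A -> ucp A f -> A T -> f (adj T) = adj (f T).
Proof.
move=> uA uf AT; have [fb lf f1 /cp_kcp kf] := uf; have [sA A1 Aa] := uA.
have bT : bounded_op T by have [+ _ _] := sA; apply.
apply/esym/adj_eq; first exact: fb.
move=> x y; have := @opnorm_ge0 _ _ _ bT => n0.
have Tc : fbound (fun _ _ : unit => T) (opnorm T) by apply/fbound1 => //; exact: opnorm_bound.
have AB := selfadjoint_block (opnorm T) uA (fun _ _ : unit => AT).
have [+ _] := kcp_block (fun=> x) (fun=> y) sA kf (klin_fun lf) AB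
  (norm_block_ge0 n0 (fun _ _ => bT) Tc).
by rewrite !sum_unit dotC => /(congr1 conjc); rewrite !conjcK.
Qed.

End CompleteContraction.

(** * Recovering an operator-valued map from its matrix coefficients *)

Section KernelMap.
Context {R : realType} {H K : hilbertType R}.

Lemma bounded_selfadjoint_unital : selfadjoint_unital (@bounded_op R H).
Proof.
by split; [exact: bounded_op_subspace|exact: bounded_op_id|exact: adj_bounded].
Qed.

Variable k : (H -> H) -> K -> K -> R[i].
Hypothesis kpos : kcp bounded_op k.
Hypothesis kl : klin bounded_op k.
Hypothesis k1 : forall x y, k id x y = hdot x y.

Let kZ a T x y : bounded_op T -> k (a *: T) x y = a * k T x y.
Proof.
move=> bT; have b0 := @bounded_op0 R H.
have k0 : k 0 x y = 0.
  have := kl 1 x y b0 b0; rewrite scaler0 addr0 mul1r => /eqP.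
  by rewrite -subr_eq0 opprD addNKr oppr_eq0 => /eqP.
by rewrite -[a *: T]addr0 kl// k0 addr0.
Qed.

Let kadj T x y : bounded_op T -> k (adj T) x y = (k T y x)^*%C.
Proof.
move=> bT; have n0 := opnorm_ge0 bT.
have Tc : fbound (fun _ _ : unit => T) (opnorm T) by apply/fbound1 => //; exact: opnorm_bound.
have AB := selfadjoint_block (opnorm T) bounded_selfadjoint_unital (fun _ _ : unit => bT).
have [+ _] := kcp_block (fun=> y) (fun=> x) bounded_op_subspace kpos kl AB
  (norm_block_ge0 n0 (fun _ _ => bT) Tc).
by rewrite !sum_unit.
Qed.

(** Sesquilinearity of [k] in the vectors has to be derived. The block matrix is the congruence of
    Paulsen's matrix for [T] by the row of coefficients [a], and [k1] evaluates its corners; so a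
    combination of values is controlled by the same combination of vectors. *)
Let kbound n (a : 'I_n -> R[i]) (x : 'I_n -> K) y T (c : R) : bounded_op T -> 0 <= c -> opbound T c ->
  normc (\sum_i a i * k T (x i) y) <= c * rnorm (\sum_i a i *: x i) * rnorm y.
Proof.
move=> bT c0 Tc.
pose P (i j : 'I_n) : H -> H := (c%:C * ((a i)^*%C * a j)) *: id.
pose X (_ : unit) (i : 'I_n) : H -> H := a i *: T.
pose Y (i : 'I_n) (_ : unit) : H -> H := (a i)^*%C *: adj T.
pose Q (_ _ : unit) : H -> H := c%:C *: id.
have sb := @bounded_op_subspace R H.
have b1 := @bounded_op_id R H.
have bd s t : bounded_op (blk P Y X Q s t).
  by case: s t => [i|[]] [j|[]]; apply: op_subspaceZ => //; exact: adj_bounded.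
have B0 : fam_ge0 (blk P Y X Q).
  move=> u; pose F s t (T : H -> H) := hdot (T (u t)) (u s).
  set B := blk _ _ _ _; change (0 <= \sum_s \sum_t F s t (B s t)).
  rewrite sum_blk {}/F {}/B exchange_big/= sum_unit.
  pose v := \sum_i a i *: u (inl i); pose w := u (inr tt).
  have h := norm_block_ge0 c0 (fun _ _ : unit => bT) _.
  have {h}/(_ (fun s => if s is inl _ then v else w)) := h ((fbound1 T c0).2 Tc).
  rewrite /opform; set B := blk _ _ _ _.
  pose F (s t : unit + unit) (T : H -> H) := hdot (T (if t is inl _ then v else w)) (if s is inl _ then v else w).
  move=> h; have {h} : 0 <= \sum_s \sum_t F s t (B s t) := h.
  rewrite sum_blk {}/F {}/B !sum_unit !eqxx.
  congr (_ <= _ + _ + (_ + _)).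
  - rewrite fctE dotZl /v dot_suml mulr_sumr; apply: eq_bigr => i _.
    rewrite dot_sumr mulr_sumr; apply: eq_bigr => j _.
    by rewrite /P fctE dotZl dotZl dotZr; ring.
  - rewrite dot_sumr; apply: eq_bigr => i _.
    by rewrite dotZr sum_unit /Y fctE dotZl.
  - rewrite (linT_sum (bounded_linear bT)) dot_suml; apply: eq_bigr => i _.
    by rewrite (linTZ (bounded_linear bT)) /X fctE.
have [_] := kcp_block x (fun=> y) bounded_op_subspace kpos kl bd B0.
rewrite !sum_unit.
under eq_bigr => i _ do rewrite kZ//.
have -> : \sum_i \sum_j k (P i j) (x j) (x i) = (c * rnorm (\sum_i a i *: x i) ^+ 2)%:C.
  rewrite rmorphM/= -dotxx dot_suml mulr_sumr exchange_big; apply: eq_bigr => i _.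
  rewrite dot_sumr mulr_sumr; apply: eq_bigr => j _.
  by rewrite kZ// k1 dotZl dotZr; ring.
rewrite kZ// k1 dotxx -rmorphM/= => h.
rewrite -ler_sqr ?nnegrE ?normc_ge0 ?mulr_ge0 ?rnorm_ge0//.
by apply: le_trans h _; rewrite !exprMn le_eqVlt; apply/orP; left; apply/eqP; ring.
Qed.

(** Serves limits and extensions that are known only coefficient by coefficient: positivity and [k1]
    force [k T] to be a bounded sesquilinear form, which [sesqui_op] turns into an operator. *)
Lemma kernel_ucp : exists f : (H -> H) -> (K -> K), ucp bounded_op f /\
  forall T x y, bounded_op T -> hdot (f T x) y = k T x y.
Proof.
have /choice[f hf] (T : H -> H) : exists S : K -> K, bounded_op T ->
    bounded_op S /\ forall x y, hdot (S x) y = k T x y.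
  case: (pselect (bounded_op T)) => [bT|nT]; last by exists id.
  have kl' (S : H -> H) a x x' y : bounded_op S -> k S (a *: x + x') y = a * k S x y + k S x' y.
    move=> bS; apply/esym/eqP; rewrite -subr_eq0; apply/eqP/eq0_normc/eqP.
    rewrite eq_le normc_ge0 andbT.
    (* The combination [a x + x' - (a x + x')] is zero, so [kbound] makes the same combination of
       values vanish. *)
    pose c (i : 'I_3) : R[i] := [:: a; 1; -1]`_i.
    pose z (i : 'I_3) : K := [:: x; x'; a *: x + x']`_i.
    have := @kbound _ c z y S (opnorm S) bS (opnorm_ge0 bS) (opnorm_bound bS).
    rewrite !big_ord_recr !big_ord0/= /c /z/= !add0r !scale1r scaleN1r subrr rnorm0.
    by rewrite mulr0 mul0r !mul1r mulN1r.
  have [|||S [lS Sc hS]] := @sesqui_op R K K (k T) (opnorm T) (opnorm_ge0 bT).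
  - by move=> *; exact: kl'.
  (* Linearity in the first vector passes to the second through the adjoint. *)
  - have e x y : k T x y = (k (adj T) y x)^*%C by rewrite kadj// conjcK.
    move=> a x y y'; rewrite !e kl' ?conjcD ?conjcM//; exact: adj_bounded.
  - move=> x y; pose c (i : 'I_1) : R[i] := 1.
    have := @kbound _ c (fun=> x) y T (opnorm T) bT (opnorm_ge0 bT) (opnorm_bound bT).
    by rewrite !big_ord_recr !big_ord0/= !add0r scale1r mul1r.
  exists S => _; split => //.
  by apply/bounded_opP; split=> //; exists (opnorm T) => //; exact: opnorm_ge0.
have fE T x y : bounded_op T -> hdot (f T x) y = k T x y.
  by move=> bT; have [_] := hf _ bT; apply.
exists f; split=> //; split.
- by move=> T bT; have [] := hf _ bT.
- move=> a S T bS bT; apply/funext => x; apply: dot_inj => y.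
  by rewrite fE ?kl// ?fctE ?dotDl ?dotZl ?fE//; exact: bounded_op_lin.
- apply/funext => x; apply: dot_inj => y.
  by rewrite fE ?k1//; exact: bounded_op_id.
- apply/cp_kcp => I X bX X0 v.
  by under eq_bigr => i _ do under eq_bigr => j _ do rewrite fE//; exact: kpos.
Qed.
End KernelMap.

(** * Star-homomorphisms are completely positive *)

Section FamilyAction.
Context {R : realType} {H : hilbertType R} {I : finType}.
Implicit Types (X Y : I -> I -> H -> H) (x y : I -> H).

Definition fact X x : I -> H := fun j => \sum_i X j i (x i).
Definition fmul X Y : I -> I -> H -> H := fun i j => \sum_k (X i k \o Y k j).

Lemma fct_sumE (J : Type) (r : seq J) (P : pred J) (F : J -> H -> H) (x : H) :
  (\sum_(j <- r | P j) F j) x = \sum_(j <- r | P j) F j x.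
Proof. by elim/big_rec2: _ => [//|i u v _ <-]. Qed.

Lemma fact_mul X Y x : (forall i j, linear (X i j)) ->
  fact (fmul X Y) x = fact X (fact Y x).
Proof.
move=> lX; apply/funext => i; rewrite /fact /fmul.
under [RHS]eq_bigr => k _ do rewrite (linT_sum (lX _ _)).
rewrite exchange_big; apply: eq_bigr => j _.
by rewrite fct_sumE.
Qed.

Lemma fbound_mul X Y c d : (forall i j, linear (X i j)) ->
  fbound X c -> fbound Y d -> fbound (fmul X Y) (c * d).
Proof.
move=> lX /fboundP Xc /fboundP Yd; apply/fboundP => x.
rewrite -[fun j => _]/(fact _ _) fact_mul//; apply: le_trans (Xc _) _.
by rewrite exprMn -[leRHS]mulrA; apply: ler_wpM2l; [exact: sqr_ge0|exact: Yd].
Qed.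

Lemma sqn_delta (i : I) (x : H) : sqn (fun j : I => if j == i then x else 0) = rnorm x ^+ 2.
Proof.
rewrite /sqn (bigD1 i)//= eqxx big1 ?addr0// => j /negPf ->.
by rewrite rnorm0 expr0n.
Qed.

Lemma fact_delta X i (x : H) : (forall i j, linear (X i j)) ->
  fact X (fun j => if j == i then x else 0) = fun j => X j i x.
Proof.
move=> lX; apply/funext => j; rewrite /fact (bigD1 i)//= eqxx big1 ?addr0// => k /negPf ->.
by rewrite (linT0 (lX _ _)).
Qed.

Lemma fbound_entry X c i j : 0 <= c -> (forall i j, linear (X i j)) -> fbound X c ->
  opbound (X i j) c.
Proof.
move=> c0 lX /fboundP Xc x; have := Xc (fun k => if k == j then x else 0).
rewrite -[fun j => _]/(fact _ _) fact_delta// sqn_delta => h.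
rewrite -ler_sqr ?nnegrE ?mulr_ge0 ?rnorm_ge0// exprMn; apply: le_trans h.
by rewrite /sqn (bigD1 i)//= lerDl sumr_ge0// => *; exact: sqr_ge0.
Qed.

Lemma opformD X x x' y : (forall i j, linear (X i j)) ->
  opform X (fun i => x i + x' i) y = opform X x y + opform X x' y.
Proof.
move=> lX; rewrite /opform -big_split; apply: eq_bigr => i _; rewrite -big_split.
by apply: eq_bigr => j _; rewrite (linTD (lX _ _)) dotDl.
Qed.

Lemma opformZ X a x y : (forall i j, linear (X i j)) ->
  opform X (fun i => a *: x i) y = a * opform X x y.
Proof.
move=> lX; rewrite /opform mulr_sumr; apply: eq_bigr => i _; rewrite mulr_sumr.
by apply: eq_bigr => j _; rewrite (linTZ (lX _ _)) dotZl.
Qed.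

Lemma opformDr X x y y' : opform X x (fun i => y i + y' i) = opform X x y + opform X x y'.
Proof.
rewrite /opform -big_split; apply: eq_bigr => i _; rewrite -big_split.
by apply: eq_bigr => j _; rewrite dotDr.
Qed.

Lemma opformZr X a x y : opform X x (fun i => a *: y i) = a^*%C * opform X x y.
Proof.
rewrite /opform mulr_sumr; apply: eq_bigr => i _; rewrite mulr_sumr.
by apply: eq_bigr => j _; rewrite dotZr.
Qed.

Lemma fam_ge0_CS X x y : (forall i j, linear (X i j)) -> fam_ge0 X ->
  opform X y x = (opform X x y)^*%C /\
  normc (opform X x y) ^+ 2 <= Re (opform X x x) * Re (opform X y y).
Proof.
move=> lX X0; rewrite [X in _ <= X]mulrC; apply: quad_ge0 => z.
have := X0 (fun i => z *: x i + y i); move=> /le_trans; apply.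
rewrite opformD// !opformDr !opformZ// !opformZr le_eqVlt.
by apply/orP; left; apply/eqP; ring.
Qed.

(** Families supported at one index isolate the entries of the matrix. *)
Lemma opform_adjointP X i j : (forall i j, linear (X i j)) ->
  (forall x y, opform X y x = (opform X x y)^*%C) -> is_adjoint (X i j) (X j i).
Proof.
move=> lX Xs x y.
have d u v k l : opform X (fun m => if m == k then u else 0) (fun m => if m == l then v else 0)
    = hdot (X l k u) v.
  rewrite opform_dot (bigD1 l)//= eqxx [X in _ + X]big1 ?addr0.
    by have := @fact_delta X k u lX => /(congr1 (fun f => f l)); rewrite /fact => ->.
  by move=> m /negPf ->; rewrite dot0r.
by have := Xs (fun m => if m == i then y else 0) (fun m => if m == j then x else 0);
  rewrite !d => ->; rewrite -dotC.
Qed.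
End FamilyAction.

Section LimitOperator.
Context {R : realType} {H : hilbertType R}.

(** Completeness of [H] gives pointwise limits; as the Cauchy estimate is proportional to [|x|], the
    limit is bounded and approached in operator norm, so closedness of [A] applies. *)
Lemma norm_closed_lim (A : set (H -> H)) (S : nat -> H -> H) :
  A `<=` bounded_op -> norm_closed A -> (forall n, A (S n)) ->
  (forall e : R, 0 < e -> exists N, forall n m x, (N <= n)%N -> (N <= m)%N ->
     rnorm (S n x - S m x) <= e * rnorm x) ->
  exists2 T, A T & forall e : R, 0 < e -> exists N, forall n x, (N <= n)%N ->
     rnorm (S n x - T x) <= e * rnorm x.
Proof.
move=> Ab Acl AS cS.
have /choice[T hT] x : exists l, forall e : R, 0 < e -> exists N, forall n, (N <= n)%N ->
    rnorm (S n x - l) <= e.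
  apply: (@seq_complete _ _ (fun n => S n x)) => e e0.
  have x0 : 0 < rnorm x + 1 by rewrite ltr_wpDl ?rnorm_ge0.
  have [N hN] := cS _ (divr_gt0 e0 x0); exists N => n m Nn Nm.
  apply: le_trans (hN _ _ _ Nn Nm) _.
  by rewrite mulrAC ler_pdivrMr// ler_wpM2l ?lerDl//; exact: ltW.
have key (e : R) : 0 < e -> exists N, forall n x, (N <= n)%N -> rnorm (S n x - T x) <= e * rnorm x.
  move=> e0; have [N hN] := cS _ e0; exists N => n x Nn.
  apply/ler_addgt0Pr => d d0; have [M hM] := hT x _ d0.
  (* The threshold [M] depends on [x]; passing through a common larger index leaves an estimate that
     depends on [N] alone. *)
  rewrite (_ : S n x - T x = (S n x - S (maxn N M) x) + (S (maxn N M) x - T x)).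
    apply: le_trans (rnormD _ _) _; apply: lerD.
      by apply: hN => //; exact: leq_maxl.
    by apply: hM; exact: leq_maxr.
  by rewrite addrA subrK.
exists T => //; apply: Acl.
  have lT : linear T.
    move=> a x y; apply/eqP; rewrite -subr_eq0; apply/eqP/rnorm0_eq0/eqP.
    rewrite eq_le rnorm_ge0 andbT; apply/ler_addgt0Pr => e e0; rewrite add0r.
    pose k := rnorm (a *: x + y) + normc a * rnorm x + rnorm y + 1.
    have k0 : 0 < k by rewrite /k ltr_wpDl// !addr_ge0 ?rnorm_ge0 ?mulr_ge0 ?normc_ge0 ?rnorm_ge0.
    have [N hN] := key _ (divr_gt0 e0 k0).
    have lS := bounded_linear (Ab _ (AS N)).
    rewrite (_ : T _ - _ = - (S N (a *: x + y) - T (a *: x + y)) + a *: (S N x - T x) + (S N y - T y)).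
      apply: le_trans (rnormD _ _) _; apply: le_trans (lerD (rnormD _ _) (lexx _)) _.
      rewrite rnormN rnormZ.
      have h := hN N _ (leqnn N).
      apply: le_trans (lerD (lerD (h _) (ler_wpM2l (normc_ge0 a) (h x))) (h y)) _.
      rewrite mulrCA -!mulrDr mulrAC ler_pdivrMr//.
      by apply: ler_wpM2l; [exact: ltW|rewrite /k lerDl].
    by rewrite lS; apply: dot_inj => z; rewrite !(dotDl, dotNl, dotZl); ring.
  apply/bounded_opP; split=> //.
  have [N hN] := key _ ltr01.
  exists (1 + opnorm (S N)) => [|x]; first by rewrite addr_ge0 ?opnorm_ge0//; exact: Ab.
  rewrite -[T x](subKr (S N x)) addrC; apply: le_trans (rnormD _ _) _.
  rewrite rnormN mulrDl; apply: lerD; first exact: hN.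
  by apply: opnorm_bound; exact: Ab.
move=> e e0; have e2 : 0 < e / 2 by rewrite divr_gt0.
have [N hN] := key _ e2; exists (S N) => //.
apply: (@le_lt_trans _ _ (e / 2)); last by rewrite ltr_pdivrMr// ltr_pMr ?ltr1n.
by apply: opnorm_le => [|x]; [exact: ltW|rewrite !fctE rnormB; exact: hN].
Qed.
End LimitOperator.

Section Resolvent.
Context {R : realType} {H : hilbertType R} {I : finType}.
Implicit Types (X Y Z : I -> I -> H -> H).

Definition fone : I -> I -> H -> H := fun i j => if i == j then id else 0.

Lemma fact_one (x : I -> H) : fact fone x = x.
Proof.
apply/funext => i; rewrite /fact /fone (bigD1 i)//= eqxx big1 ?addr0// => j.
by rewrite eq_sym => /negPf ->.
Qed.

Lemma geometric_le (r : R) n k : 0 <= r < 1 ->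
  \sum_(n <= m < k) r ^+ m <= r ^+ n / (1 - r).
Proof.
move=> /andP[r0 r1]; have r1' : 0 < 1 - r by rewrite subr_gt0.
have [nk|/ltnW kn] := leqP n k; last first.
  by rewrite big_geq// divr_ge0 ?exprn_ge0// ltW.
rewrite -(subnKC nk); elim: (k - n)%N => [|d IH].
  by rewrite addn0 big_geq// divr_ge0 ?exprn_ge0// ltW.
rewrite ler_pdivlMr//; move: IH; rewrite ler_pdivlMr// => IH.
suff: (\sum_(n <= m < n + d.+1) r ^+ m) * (1 - r) = r ^+ n - r ^+ (n + d.+1).
  by move=> ->; rewrite lerBlDr lerDl exprn_ge0.
elim: d {IH} => [|d IH].
  by rewrite addn1 big_nat1 exprS; ring.
by rewrite addnS big_nat_recr/= ?leq_addr// mulrDl IH !exprS; ring.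
Qed.

Lemma expr_small (r e : R) : 0 <= r < 1 -> 0 < e -> exists N, forall n, (N <= n)%N -> r ^+ n <= e.
Proof.
move=> /andP[r0 r1] e0.
have /cvgrPdist_le/(_ e e0)[N _ hN] : GRing.exp r @ \oo --> 0 by apply: cvg_expr; rewrite ger0_norm.
by exists N => n /hN/=; rewrite sub0r normrN; apply: le_trans; exact: ler_norm.
Qed.

(** [Z] is the sum of the powers of [Y], formed entry by entry inside [A]. The equation says that
    [Z] is a left inverse of [1 - Y], in a form to which a homomorphism can be applied. *)
Lemma neumann (A : set (H -> H)) Y r : op_subspace A -> A id ->
  (forall S T, A S -> A T -> A (S \o T)) -> norm_closed A ->
  (forall i j, A (Y i j)) -> 0 <= r < 1 -> fbound Y r ->
  exists2 Z, (forall i j, A (Z i j)) & forall i j, Z i j = fone i j + fmul Z Y i j.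
Proof.
move=> sA A1 AM Acl AY r01 Yr; have [Ab A0 _] := sA; have /andP[r0 r1] := r01.
pose D n := iter n (fun X => fmul X Y) fone.
have A_mul X : (forall i j, A (X i j)) -> forall i j, A (fmul X Y i j).
  by move=> AX i j; apply: op_subspace_sum => // k; exact: AM.
have AD n i j : A (D n i j).
  elim: n i j => [|n IH] i j; last exact: A_mul.
  by rewrite /D/= /fone; case: ifP.
have lA (T : H -> H) : A T -> linear T by move=> /Ab/bounded_linear.
have Dr n : fbound (D n) (r ^+ n).
  elim: n => [|n IH].
    apply/fboundP => x; rewrite -[fun j => _]/(fact _ _) fact_one.
    by rewrite expr0 expr1n mul1r.
  by rewrite exprSr; apply: fbound_mul => // i j; exact: lA.
pose Z n i j := \sum_(0 <= k < n) D k i j.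
have AZ n i j : A (Z n i j) by exact: op_subspace_sum.
have Zd n m i j x : (n <= m)%N -> rnorm (Z m i j x - Z n i j x) <= r ^+ n / (1 - r) * rnorm x.
  move=> nm; rewrite /Z !fct_sumE (big_cat_nat (leq0n n) nm)//= addrC addKr.
  apply: (@le_trans _ _ (\sum_(n <= k < m) r ^+ k * rnorm x)).
    elim/big_rec2: _ => [|k u v _ h]; first by rewrite rnorm0.
    apply: le_trans (rnormD _ _) _; apply: lerD => //.
    apply: fbound_entry => //; first exact: exprn_ge0.
    by move=> *; exact: lA.
  by rewrite -mulr_suml ler_wpM2r ?rnorm_ge0// geometric_le.
have /choice[W hW] (p : I * I) : exists T, A T /\ forall e : R, 0 < e -> exists N, forall n x,
    (N <= n)%N -> rnorm (Z n p.1 p.2 x - T x) <= e * rnorm x.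
  have [e e0|T AT hT] := @norm_closed_lim _ _ A (fun n => Z n p.1 p.2) Ab Acl (fun n => AZ n _ _);
    last by exists T.
  have r1' : 0 < 1 - r by rewrite subr_gt0.
  have [N hN] := expr_small r01 (mulr_gt0 e0 r1').
  have h n m x : (N <= n)%N -> (n <= m)%N -> rnorm (Z m p.1 p.2 x - Z n p.1 p.2 x) <= e * rnorm x.
    move=> Nn nm; apply: le_trans (Zd _ _ _ _ _ nm) _.
    by rewrite ler_wpM2r ?rnorm_ge0// ler_pdivrMr//; exact: hN.
  exists N => n m x Nn Nm; have [nm|/ltnW mn] := leqP n m.
    by rewrite rnormB; exact: h.
  exact: h.
exists (fun i j => W (i, j)) => [i j|i j]; first by have [] := hW (i, j).
have ZS n : Z n.+1 i j = fone i j + fmul (Z n) Y i j.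
  rewrite /Z big_nat_recl//; congr (_ + _).
  apply/funext => x; rewrite fct_sumE /fmul fct_sumE.
  under [RHS]eq_bigr => k _ do rewrite /= fct_sumE.
  by rewrite exchange_big; apply: eq_bigr => k _; rewrite /D iterS /fmul fct_sumE.
apply/funext => x; apply/eqP; rewrite -subr_eq0; apply/eqP/rnorm0_eq0/eqP.
rewrite eq_le rnorm_ge0 andbT; apply/ler_addgt0Pr => e e0; rewrite add0r.
pose c := rnorm x + \sum_k rnorm (Y k j x) + 1.
have c0 : 0 < c by rewrite ltr_wpDl// addr_ge0 ?rnorm_ge0 ?sumr_ge0// => *; exact: rnorm_ge0.
have ec := divr_gt0 e0 c0.
have /choice[N hN] p : exists N, forall n x, (N <= n)%N ->
    rnorm (Z n p.1 p.2 x - W p x) <= e / c * rnorm x by have [_] := hW p; apply.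
(* One index serves the finitely many entries at once. *)
pose M := \max_(p : I * I) N p.
have hM n p y : (M <= n)%N -> rnorm (Z n p.1 p.2 y - W p y) <= e / c * rnorm y.
  by move=> Mn; apply: hN; apply: leq_trans Mn; exact: leq_bigmax.
have -> : W (i, j) x - (fone i j + fmul (fun i j => W (i, j)) Y i j) x =
   - (Z M.+1 i j x - W (i, j) x) + \sum_k (Z M i k (Y k j x) - W (i, k) (Y k j x)).
  rewrite ZS !fctE /fmul !fct_sumE sumrB.
  by apply: dot_inj => z; rewrite !(dotDl, dotNl, dotZl); ring.
apply: le_trans (rnormD _ _) _; rewrite rnormN.
have := hM M.+1 (i, j) x (leqnSn M) => /= h1.
have h2 : rnorm (\sum_k (Z M i k (Y k j x) - W (i, k) (Y k j x))) <= e / c * \sum_k rnorm (Y k j x).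
  rewrite mulr_sumr; elim/big_rec2: _ => [|k u v _ h]; first by rewrite rnorm0.
  by apply: le_trans (rnormD _ _) _; apply: lerD => //; exact: hM (i, k) _ (leqnn M).
apply: le_trans (lerD h1 h2) _; rewrite -mulrDr mulrAC ler_pdivrMr//.
by apply: ler_wpM2l; [exact: ltW|rewrite /c lerDl].
Qed.
End Resolvent.

Section PositiveOperators.
Context {R : realType} {K : hilbertType R} {I : finType}.

(* Positivity without functional calculus: the hypothesis says that no [- e] with
   [0 < e] is an approximate eigenvalue of the selfadjoint [T]. *)
Lemma fam_ge0_of_resolvent (T : I -> I -> K -> K) : (forall i j, bounded_op (T i j)) ->
  (forall x y, opform T y x = (opform T x y)^*%C) ->
  (forall e : R, 0 < e -> exists2 d, 0 < d &
     forall x, d * sqn x <= sqn (fun i => fact T x i + e%:C *: x i)) ->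
  fam_ge0 T.
Proof.
move=> bT Ts Tr x0; have lT i j : linear (T i j) := bounded_linear (bT i j).
pose F x := Re (opform T x x).
have FE x : opform T x x = (F x)%:C.
  rewrite RRe_real//; have := Ts x x; case: (opform T x x) => a b [] /eqP.
  by rewrite complex_real -subr_eq0 opprK -mulr2n mulrn_eq0.
rewrite FE ler0c leNgt; apply/negP => Fx0.
have [c c0 Tc] := fbound_entries bT.
have Fc x : normc (opform T x x) <= c * sqn x.
  rewrite -ler_sqr ?nnegrE ?normc_ge0 ?mulr_ge0 ?sqn_ge0//.
  by apply: le_trans (Tc x x) _; rewrite exprMn expr2.
have Fl x : - (c * sqn x) <= F x.
  rewrite lerNl; apply: le_trans (Fc x).
  by have := Re_le_normc (- opform T x x); rewrite normcN raddfN.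
have x0n : 0 < sqn x0.
  rewrite lt_def sqn_ge0 andbT; apply/eqP => s0.
  by have := Fl x0; rewrite s0 mulr0 oppr0 leNgt Fx0.
(* The supremum of [E] is the infimum of the numerical range of [T], negative because of [x0]. *)
pose E := [set l : R | forall x, l * sqn x <= F x].
have Ec : E (- c) by move=> x; rewrite mulNr.
have El l : E l -> l <= F x0 / sqn x0 by move=> /(_ x0); rewrite ler_pdivlMr.
have hE : has_sup E by split; [exists (- c)|exists (F x0 / sqn x0) => l /El].
pose l0 := sup E.
have l0n : l0 < 0.
  apply: (@le_lt_trans _ _ (F x0 / sqn x0)); last by rewrite ltr_pdivrMr// mul0r.
  by apply: ge_sup; [exists (- c)|move=> l /El].
have l0E x : l0 * sqn x <= F x.
  have [s0|s0] := eqVneq (sqn x) 0; first by have := Ec x; rewrite s0 !mulr0.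
  have sp : 0 < sqn x by rewrite lt_def s0 sqn_ge0.
  rewrite -ler_pdivlMr//; apply: ge_sup; first by exists (- c).
  by move=> l /(_ x); rewrite ler_pdivlMr.
(* The hypothesis at [e = - l0] bounds [T - l0] from below. *)
have [d d0 hd] : exists2 d, 0 < d & forall x, d * sqn x <= sqn (fun i => fact T x i + (- l0)%:C *: x i).
  by apply: Tr; rewrite oppr_gt0.
pose S i j : K -> K := if i == j then (- l0)%:C *: id + T i j else T i j.
have bS i j : bounded_op (S i j).
  by rewrite /S; case: ifP => // _; apply: bounded_op_lin => //; exact: bounded_op_id.
have lS i j : linear (S i j) := bounded_linear (bS i j).
have SE x : fact S x = fun i => fact T x i + (- l0)%:C *: x i.
  apply/funext => i; rewrite /fact (bigD1 i)//= [in RHS](bigD1 i)//= /S eqxx fctE.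
  rewrite [_ *: _ + _]addrC -!addrA; congr (_ + _); rewrite addrC; congr (_ + _).
  by apply: eq_bigr => j; rewrite eq_sym => /negPf ->.
have SF x y : opform S x y = opform T x y + (- l0)%:C * \sum_i hdot (x i) (y i).
  rewrite !opform_dot mulr_sumr -big_split; apply: eq_bigr => i _.
  by rewrite -[\sum_j _]/(fact S x i) SE dotDl dotZl.
have SFx x : opform S x x = (F x - l0 * sqn x)%:C.
  by rewrite SF FE sum_dotxx -rmorphM -rmorphD/= mulNr.
have S0 : fam_ge0 S by move=> x; rewrite SFx ler0c subr_ge0.
have [s s0 Ss] := fbound_entries bS.
pose s' := s + 1; have sp : 0 < s' by rewrite ltr_wpDl.
(* For the positive [S = T - l0], Cauchy-Schwarz with [y = S x] gives [|S x|^2 <= s' <S x, x>]; the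
   lower bound on [|S x|] then bounds the form of [S] below by [d / s']. *)
have key x : d * sqn x <= s' * (F x - l0 * sqn x).
  apply: le_trans (hd x) _; rewrite -SE.
  set y := fact S x; have [_] := fam_ge0_CS x y lS S0.
  have -> : opform S x y = (sqn y)%:C by rewrite opform_dot -[\sum_j _]/(\sum_j hdot (y j) (y j)) sum_dotxx.
  rewrite normcR ?sqn_ge0// SFx/=.
  have [->|y0] := eqVneq (sqn y) 0.
    by move=> _; apply: mulr_ge0; [exact: ltW|rewrite subr_ge0].
  have yp : 0 < sqn y by rewrite lt_def y0 sqn_ge0.
  have Sy : Re (opform S y y) <= s' * sqn y.
    apply: le_trans (Re_le_normc _) _.
    rewrite -ler_sqr ?nnegrE ?normc_ge0//; last by rewrite mulr_ge0 ?sqn_ge0// ltW.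
    apply: le_trans (Ss y y) _; rewrite exprMn [sqn y ^+ 2]expr2.
    apply: ler_wpM2r; first by rewrite mulr_ge0 ?sqn_ge0.
    by rewrite ler_sqr ?nnegrE// ?lerDl//; exact: ltW.
  move=> h; have := le_trans h (ler_wpM2l _ Sy).
  rewrite subr_ge0 => /(_ (l0E x)); rewrite expr2 [leRHS]mulrA ler_pM2r// [leRHS]mulrC.
  exact.
(* [l0] could be raised by [d / s'], against its maximality. *)
have : E (l0 + d / s').
  move=> x; rewrite mulrDl addrC -lerBrDr mulrAC ler_pdivrMr// [leRHS]mulrC.
  exact: key.
move=> /(sup_upper_bound hE); rewrite -/l0 gerDl leNgt.
by rewrite divr_gt0.
Qed.
End PositiveOperators.

Section StarHomomorphism.
Context {R : realType} {H K : hilbertType R}.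

Lemma linear_onD (A : set (H -> H)) (t : (H -> H) -> (K -> K)) S T :
  linear_on A t -> A S -> A T -> t (S + T) = t S + t T.
Proof. by move=> lt AS AT; have := lt 1 S T AS AT; rewrite !scale1r. Qed.

Lemma linear_onB (A : set (H -> H)) (t : (H -> H) -> (K -> K)) S T :
  linear_on A t -> A S -> A T -> t (S - T) = t S - t T.
Proof. by move=> lt AS AT; rewrite addrC -scaleN1r lt// scaleN1r addrC. Qed.

Lemma linear_on_sum (A : set (H -> H)) (t : (H -> H) -> (K -> K)) I r (P : pred I) F :
  op_subspace A -> linear_on A t -> (forall i, A (F i)) ->
  t (\sum_(i <- r | P i) F i) = \sum_(i <- r | P i) t (F i).
Proof.
move=> sA lt AF.
suff: A (\sum_(i <- r | P i) F i) /\ t (\sum_(i <- r | P i) F i) = \sum_(i <- r | P i) t (F i) by case.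
elim/big_rec2: _ => [|i u v _ [Av tv]].
  by split; [case: sA|exact: linear_on0 sA lt].
split; first exact: op_subspaceD.
by rewrite (linear_onD lt)// tv.
Qed.

Lemma sqnZ {L : hilbertType R} {I : finType} a (x : I -> L) : sqn (fun i => a *: x i) = normc a ^+ 2 * sqn x.
Proof. by rewrite /sqn mulr_sumr; apply: eq_bigr => i _; rewrite rnormZ exprMn. Qed.

(* If [0 <= X <= c] then [X + e = (c + e) (1 - (c - X) / (c + e))] is inverted over
   [A] by a Neumann series, and the image of the inverse bounds [t X + e] below. *)
Theorem star_hom_cp (A : set (H -> H)) (t : (H -> H) -> (K -> K)) :
  Cstar_subalgebra A -> A id -> star_hom A bounded_op t -> t id = id ->
  completely_positive A t.
Proof.
move=> [sA AM Aa Acl] A1 [tb lt tM ta] t1; have [Ab A0 _] := sA.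
apply/cp_kcp => I X AX X0.
pose T i j := t (X i j).
change (fam_ge0 T).
have lA (S : H -> H) : A S -> linear S by move=> /Ab/bounded_linear.
have lX i j : linear (X i j) := lA _ (AX i j).
have bT i j : bounded_op (T i j) by exact: tb.
have lT i j : linear (T i j) := bounded_linear (bT i j).
have Xs x y : opform X y x = (opform X x y)^*%C by have [] := fam_ge0_CS x y lX X0.
have Ts x y : opform T y x = (opform T x y)^*%C.
  rewrite /opform conjc_sum; under [RHS]eq_bigr => j _ do rewrite conjc_sum.
  rewrite [RHS]exchange_big; apply: eq_bigr => j _; apply: eq_bigr => i _.
  have /ta := opform_adjointP j i lX Xs => /(_ (AX _ _) (AX _ _)) ad.
  by rewrite ad -dotC.
apply: fam_ge0_of_resolvent => // e e0.
have [c c0 Xc] : exists2 c, 0 <= c & fbound X c by apply: fbound_entries => i j; exact: Ab.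
have ce : 0 < c + e by rewrite ltr_wpDl.
pose S i j : H -> H := c%:C *: fone i j - X i j.
have oneE (L : hilbertType R) (x : I -> L) i : \sum_j fone i j (x j) = x i.
  by rewrite -[LHS]/(fact fone x i) fact_one.
have A1d (i j : I) : A (fone i j) by rewrite /fone; case: ifP.
have AS i j : A (S i j) by apply: op_subspaceB => //; exact: op_subspaceZ.
have lS i j : linear (S i j) := lA _ (AS i j).
have Sx x : fact S x = fun i => c%:C *: x i - fact X x i.
  apply/funext => i; rewrite /fact -(oneE _ x i) scaler_sumr -sumrB.
  by apply: eq_bigr => j _; rewrite /S !fctE.
have SF x : opform S x x = (c * sqn x)%:C - opform X x x.
  rewrite !opform_dot rmorphM/= -sum_dotxx mulr_sumr -sumrB; apply: eq_bigr => i _.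
  by rewrite -[\sum_j _]/(fact S x i) Sx dotBl dotZl.
have XR x : opform X x x = (Re (opform X x x))%:C by rewrite RRe_real// ger0_real// X0.
have Xle x : Re (opform X x x) <= c * sqn x.
  apply: le_trans (Re_le_normc _) _.
  rewrite -ler_sqr ?nnegrE ?normc_ge0 ?mulr_ge0 ?sqn_ge0//.
  by apply: le_trans (Xc x x) _; rewrite exprMn expr2.
have S0 : fam_ge0 S by move=> x; rewrite SF XR -rmorphB ler0c subr_ge0.
have SR x : 0 <= Re (opform S x x) <= c * sqn x.
  rewrite SF XR -rmorphB/= subr_ge0 Xle/= lerBlDr lerDl.
  by rewrite -ler0c -XR X0.
(* Cauchy-Schwarz for the positive form of [c - X], whose values at [x] are at most [c |x|^2]. *)
have Sc : fbound S c.
  move=> x y; have [_ h] := fam_ge0_CS x y lS S0; apply: le_trans h _.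
  rewrite expr2 mulrACA.
  have /andP[s1 s2] := SR x; have /andP[s3 s4] := SR y.
  exact: ler_pM.
pose Y i j : H -> H := ((c + e)^-1)%:C *: S i j.
have AY i j : A (Y i j) by exact: op_subspaceZ.
have Yr : fbound Y (c / (c + e)).
  apply/fboundP => x; have /fboundP/(_ x) := Sc.
  have -> : (fun j => \sum_i Y j i (x i)) = fun j => ((c + e)^-1)%:C *: fact S x j.
    by apply/funext => j; rewrite /fact scaler_sumr.
  move=> h; rewrite sqnZ normcR ?invr_ge0 ?(ltW ce)// exprMn [leRHS]mulrAC [leLHS]mulrC.
  by apply: ler_wpM2r; first exact: sqr_ge0.
have r01 : 0 <= c / (c + e) < 1.
  by rewrite divr_ge0 ?(ltW ce)//= ltr_pdivrMr// mul1r ltrDl.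
have [Z AZ ZE] := neumann sA A1 AM Acl AY r01 Yr.
pose W i j := t (Z i j).
have bW i j : bounded_op (W i j) by exact: tb.
have lW i j : linear (W i j) := bounded_linear (bW i j).
have t1d (i j : I) : t (fone i j) = fone i j.
  by rewrite /fone; case: ifP; rewrite // (linear_on0 sA lt).
have WE i j : W i j = fone i j + \sum_k (W i k \o t (Y k j)).
  rewrite /W {1}ZE (linear_onD lt)//; last by apply: op_subspace_sum => // k; exact: AM.
  rewrite t1d /fmul (linear_on_sum _ _ sA lt)//; last by move=> k; exact: AM.
  by congr (_ + _); apply: eq_bigr => k _; exact: tM.
have tYE x k : fact (fun k j => t (Y k j)) x k = ((c + e)^-1)%:C *: (c%:C *: x k - fact T x k).
  have tY i j : t (Y i j) = ((c + e)^-1)%:C *: (c%:C *: fone i j - T i j).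
    rewrite /Y (linear_onZ _ sA lt)// /S addrC -scaleN1r lt//; last exact: op_subspaceZ.
    by rewrite (linear_onZ _ sA lt)// t1d scaleN1r addrC.
  rewrite /fact -(oneE _ x k) scaler_sumr -sumrB scaler_sumr.
  by apply: eq_bigr => j _; rewrite tY !fctE.
(* The Neumann equation after [t], rearranged: [W (t X + e) / (c + e) = 1]. *)
have Wx x : x = fact W (fun k => ((c + e)^-1)%:C *: (fact T x k + e%:C *: x k)).
  have h : fact W x = fun i => x i + fact W (fact (fun k j => t (Y k j)) x) i.
    rewrite -fact_mul//; apply/funext => i.
    rewrite -(oneE _ x i) /fact -big_split; apply: eq_bigr => j _.
    by rewrite {1}WE fctE.
  apply/funext => i; have := congr1 (fun f => f i) h => /= {}h.
  apply: (addIr (fact W (fact (fun k j => t (Y k j)) x) i)); rewrite -{}h.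
  rewrite /fact -big_split; apply: eq_bigr => j _.
  rewrite /= -(linTD (lW i j)).
  congr (W i j _); rewrite -[X in _ + X]/(fact (fun k j => t (Y k j)) x j) tYE.
  have vc : ((c + e)^-1)%:C * (c%:C + e%:C) = 1 :> R[i].
    by rewrite -rmorphD -rmorphM mulVf ?gt_eqF.
  apply: dot_inj => w; rewrite -[\sum_i0 _]/(fact T x j) !(dotZl, dotDl, dotNl).
  by rewrite -[LHS]mul1r -vc; ring.
have [z z0 Wz] := fbound_entries bW.
(* From [|x| <= z |(t X + e) x| / (c + e)]; the [+ 1] covers [z = 0]. *)
exists ((c + e) ^+ 2 / (z ^+ 2 + 1)) => [|x].
  by rewrite divr_gt0 ?exprn_gt0// ltr_wpDl ?sqr_ge0.
pose y i := fact T x i + e%:C *: x i; rewrite -/y.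
have /fboundP/(_ (fun k => ((c + e)^-1)%:C *: y k)) := Wz.
have -> : sqn (fun k => ((c + e)^-1)%:C *: y k) = (c + e)^-1 ^+ 2 * sqn y.
  by rewrite sqnZ normcR// invr_ge0 ltW.
rewrite -[fun j => _]/(fact W _).
have -> : fact W (fun k => ((c + e)^-1)%:C *: y k) = x by rewrite [RHS]Wx.
move=> h.
have z1 : 0 < z ^+ 2 + 1 by rewrite ltr_wpDl ?sqr_ge0.
rewrite mulrAC ler_pdivrMr// mulrC -ler_pdivlMr ?exprn_gt0//; apply: le_trans h _.
rewrite exprVn [leLHS]mulrCA [leLHS]mulrC.
apply: ler_wpM2r; first by rewrite invr_ge0 sqr_ge0.
by rewrite [leRHS]mulrC mulrDl mul1r lerDl sqn_ge0.
Qed.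

Lemma star_hom_ucp (A : set (H -> H)) (t : (H -> H) -> (K -> K)) :
  Cstar_subalgebra A -> A id -> star_hom A bounded_op t -> t id = id -> ucp A t.
Proof. by move=> cA A1 ht t1; have [tb lt _ _] := ht; split=> //; exact: star_hom_cp. Qed.

Lemma Cstar_selfadjoint (A : set (H -> H)) : Cstar_subalgebra A -> A id -> selfadjoint_unital A.
Proof.
move=> [sA AM Aa Acl] A1; split=> // T AT; apply: (Aa _ T) => //.
by apply: adjP; have [+ _ _] := sA; apply.
Qed.
End StarHomomorphism.

(** * Generated C*-algebras and images of isometric star-homomorphisms *)

Section CstarGenerated.
Context {R : realType} {H : hilbertType R}.
Implicit Types (A M : set (H -> H)).

Lemma bounded_Cstar : Cstar_subalgebra (@bounded_op R H).
Proof.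
split=> //; [exact: bounded_op_subspace|exact: bounded_op_comp|].
move=> S T bT aS; rewrite (_ : S = adj T); first exact: adj_bounded.
by apply/esym/adj_eq.
Qed.

Lemma Cstar_min A M : Cstar_subalgebra A -> M `<=` A -> Cstar M `<=` A.
Proof. by move=> cA MA; exact: smallest_sub. Qed.

Lemma sub_Cstar M : M `<=` Cstar M.
Proof. exact: sub_smallest. Qed.

Lemma Cstar_id A : Cstar_subalgebra A -> Cstar A = A.
Proof. by move=> cA; exact: smallest_id. Qed.

Lemma Cstar_Cstar M : M `<=` bounded_op -> Cstar_subalgebra (Cstar M).
Proof.
move=> Mb; split.
- split; first exact: Cstar_min bounded_Cstar Mb.
    by move=> A [cA _]; have [[_ A0 _] _ _ _] := cA.
  by move=> a S T CS CT A [cA MA]; have [[_ _ h] _ _ _] := cA; apply: h; [exact: CS|exact: CT].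
- by move=> S T CS CT A [cA MA]; have [_ h _ _] := cA; apply: h; [exact: CS|exact: CT].
- by move=> S T CT aS A [cA MA]; have [_ _ h _] := cA; apply: h aS; exact: CT.
- move=> T bT hT A [cA MA]; have [_ _ _ h] := cA; apply: h => // e e0.
  by have [S CS ST] := hT e e0; exists S => //; exact: CS.
Qed.

Lemma opnorm_mx1 (T : H -> H) : bounded_op T -> mxopnorm (const_mx T : 'M_1) = opnorm T.
Proof.
move=> bT.
have fE c : 0 <= c -> fbound (const_mx T : 'M[H -> H]_1) c <-> opbound T c.
  move=> c0; rewrite -fbound1// !fboundP; split=> h x.
    have := h (fun=> x tt); rewrite /sqn !big_ord_recl !big_ord0 !sum_unit !addr0.
    by rewrite mxE.
  have := h (fun=> x 0); rewrite /sqn !sum_unit !big_ord_recl !big_ord0 !addr0.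
  by rewrite mxE.
have bX i j : bounded_op ((const_mx T : 'M[H -> H]_1) i j) by rewrite mxE.
have [n0 hn] := mxopnorm_bound bX.
apply/eqP; rewrite eq_le; apply/andP; split.
  apply: mxopnorm_le; first exact: opnorm_ge0.
  by apply/fE; [exact: opnorm_ge0|exact: opnorm_bound].
by apply: opnorm_le => //; exact/fE.
Qed.
End CstarGenerated.

Section StarImage.
Context {R : realType} {H K : hilbertType R}.
Variables (A : set (H -> H)) (t : (H -> H) -> (K -> K)).

Lemma isometric_inj : op_subspace A -> linear_on A t -> isometric_on A t ->
  forall S T, A S -> A T -> t S = t T -> S = T.
Proof.
move=> sA lt it S T AS AT e; have [Ab _ _] := sA.
have AD : A (S - T) by exact: op_subspaceB.
have tD : t (S - T) = 0.
  by rewrite addrC -scaleN1r lt// e scaleN1r addNr.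
have o0 : opnorm (S - T) = 0.
  rewrite -it// tD; apply/eqP; rewrite eq_le opnorm_ge0 ?andbT; last exact: bounded_op0.
  by apply: opnorm_le => // x; rewrite mul0r -[X in rnorm X]/(0 : K) rnorm0.
apply/funext => x; apply/eqP; rewrite -subr_eq0; apply/eqP/rnorm0_eq0/eqP.
rewrite eq_le rnorm_ge0 andbT.
by have := opnorm_bound (Ab _ AD) x; rewrite o0 mul0r !fctE.
Qed.

Lemma ci_isometric : A `<=` bounded_op -> set_fun A bounded_op t ->
  completely_isometric A t -> isometric_on A t.
Proof.
move=> Ab tb ct T AT; rewrite -!opnorm_mx1; [|exact: Ab|exact: tb].
have <- := ct _ (const_mx T : 'M_1); last by move=> i j; rewrite mxE.
by congr mxopnorm; apply/matrixP => i j; rewrite !mxE.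
Qed.

Hypotheses (cA : Cstar_subalgebra A) (ht : star_hom A bounded_op t).

(** Isometry makes the preimages of a convergent sequence Cauchy, hence convergent in the closed
    algebra [A]. Closure under adjoints comes from their uniqueness. *)
Lemma star_image_Cstar : isometric_on A t -> Cstar_subalgebra (t @` A).
Proof.
have [sA AM Aa Acl] := cA; have [tb lt tM ta] := ht; have [Ab A0 _] := sA.
move=> it; split.
- split.
  + by move=> _ [a Aa' <-]; exact: tb.
  + by exists 0 => //; exact: linear_on0 sA lt.
  + move=> c _ _ [a Ata <-] [b Atb <-]; exists (c *: a + b); last exact: lt.
    by have [_ _] := sA; apply.
- by move=> _ _ [a Ata <-] [b Atb <-]; exists (a \o b); [exact: AM|exact: tM].
- move=> S _ [a Ata <-] aS; have Aad : A (adj a) := Aa _ _ Ata (adjP (Ab _ Ata)).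
  exists (adj a) => //; apply: adjoint_uniq aS; apply: ta => //; exact/adjP/Ab.
- move=> T bT hT.
  have /choice[a ha] n : exists a, A a /\ opnorm (T - t a) < n.+1%:R^-1.
    by have [|_ [a Ata <-] h] := hT n.+1%:R^-1; [rewrite invr_gt0|exists a].
  have Aan n : A (a n) by have [] := ha n.
  have bTa n : bounded_op (T - t (a n)).
    by apply: op_subspaceB => //; [exact: bounded_op_subspace|exact: tb].
  have Ta n x : rnorm (T x - t (a n) x) <= n.+1%:R^-1 * rnorm x.
    apply: le_trans (opnorm_bound (bTa n) x) _; apply: ler_wpM2r; first exact: rnorm_ge0.
    by have [_ /ltW] := ha n.
  have tB p q : A p -> A q -> t (p - q) = t p - t q.
    by move=> Ap Aq; rewrite addrC -scaleN1r lt// scaleN1r addrC.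
  have isob p c : 0 <= c -> A p -> opbound (t p) c -> opbound p c.
    move=> c0 Ap /(opnorm_le c0); rewrite it// => h x.
    by apply: le_trans (opnorm_bound (Ab _ Ap) x) _; rewrite ler_wpM2r ?rnorm_ge0.
  have isob' p c : 0 <= c -> A p -> opbound p c -> opbound (t p) c.
    move=> c0 Ap /(opnorm_le c0); rewrite -it// => h x.
    by apply: le_trans (opnorm_bound (tb _ Ap) x) _; rewrite ler_wpM2r ?rnorm_ge0.
  have [e e0|b Atb hb] := norm_closed_lim Ab Acl Aan.
    have [N hN] := inv_succ_le (divr_gt0 e0 (ltr0Sn _ 1)).
    exists N => n m x Nn Nm.
    apply: (isob (a n - a m)); [exact: ltW|exact: op_subspaceB|move=> {}x].
    rewrite tB// (_ : (t (a n) - t (a m)) x = - (T x - t (a n) x) + (T x - t (a m) x)); last first.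
      by apply: dot_inj => z; rewrite !fctE !(dotDl, dotNl); ring.
    apply: le_trans (rnormD _ _) _; rewrite rnormN; apply: le_trans (lerD (Ta n x) (Ta m x)) _.
    rewrite -mulrDl; apply: ler_wpM2r; first exact: rnorm_ge0.
    by apply: le_trans (lerD (hN _ Nn) (hN _ Nm)) _; rewrite -splitr.
  exists b => //; apply/funext => x; apply/eqP; rewrite -subr_eq0; apply/eqP/rnorm0_eq0/eqP.
  rewrite eq_le rnorm_ge0 andbT; apply/ler_addgt0Pr => e e0; rewrite add0r.
  have x1 : 0 < 2 * (rnorm x + 1) by rewrite mulr_gt0// ltr_wpDl ?rnorm_ge0.
  have e1 := divr_gt0 e0 x1.
  have [N1 h1] := inv_succ_le e1; have [N2 h2] := hb _ e1.
  pose n := maxn N1 N2.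
  have h3 : opbound (t (a n - b)) (e / (2 * (rnorm x + 1))).
    apply: isob'; [exact: ltW|exact: op_subspaceB|move=> y].
    by apply: h2; exact: leq_maxr.
  have {}h3 := h3 x; rewrite tB// in h3.
  rewrite (_ : _ - _ = - (t (a n) - t b) x - (T x - t (a n) x)); last first.
    by apply: dot_inj => z; rewrite !fctE !(dotDl, dotNl); ring.
  apply: le_trans (rnormD _ _) _; rewrite !rnormN.
  have h4 : rnorm (T x - t (a n) x) <= e / (2 * (rnorm x + 1)) * rnorm x.
    apply: le_trans (Ta n x) _; apply: ler_wpM2r; first exact: rnorm_ge0.
    by apply: h1; exact: leq_maxl.
  apply: le_trans (lerD h3 h4) _; rewrite -mulrDr.
  rewrite mulrAC ler_pdivrMr//; apply: ler_wpM2l; first exact: ltW.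
  by rewrite mulrDr mulr1 mulr_natl mulr2n lerDl.
Qed.

Lemma star_hom_inv : isometric_on A t ->
  exists2 g, star_hom (t @` A) A g & forall T, A T -> g (t T) = T.
Proof.
have [sA AM Aa Acl] := cA; have [tb lt tM ta] := ht; have [Ab A0 ADl] := sA.
move=> it; have inj := isometric_inj sA lt it.
have /choice[g hg] S : exists T, (t @` A) S -> A T /\ t T = S.
  have [[T AT e]|n] := pselect ((t @` A) S); last by exists 0.
  by exists T.
have gt T : A T -> g (t T) = T.
  move=> AT; have [|Ag e] := hg (t T); first by exists T.
  exact: inj.
exists g => //; split.
- by move=> S /hg[].
- move=> c _ _ [a Ata <-] [b Atb <-]; rewrite -lt// !gt//; exact: ADl.
- by move=> _ _ [a Ata <-] [b Atb <-]; rewrite -tM// !gt//; exact: AM.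
- move=> _ _ [b Atb <-] [a Ata <-] hab; rewrite !gt//.
  have Aad : A (adj a) := Aa _ _ Ata (adjP (Ab _ Ata)).
  have aa : is_adjoint a (adj a) by exact/adjP/Ab.
  suff <- : adj a = b by [].
  by apply: inj => //; apply: adjoint_uniq hab; exact: ta.
Qed.
End StarImage.

Lemma ucp_image_envelope (R : realType) (H K L : hilbertType R) (A : set (H -> H))
    (psi : (H -> H) -> (K -> K)) (eta : (K -> K) -> (L -> L)) :
  Cstar_subalgebra A -> A id -> ucp A psi -> completely_isometric A psi ->
  Cstar_envelope (psi @` A) eta -> star_isomorphic (Cstar (eta @` (psi @` A))) A.
Proof.
move=> cA A1 [pb lp p1 _] ci [[eb le e1 eci] univ].
have [sA _ _ _] := cA; have [Ab _ ADl] := sA.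
have inj := isometric_inj sA lp (ci_isometric Ab pb ci).
have /choice[g hg] S : exists T, (psi @` A) S -> A T /\ psi T = S.
  have [[T AT e]|n] := pselect ((psi @` A) S); last by exists 0.
  by exists T.
have gp T : A T -> g (psi T) = T.
  by move=> AT; have [|Ag e] := hg (psi T); [exists T|exact: inj].
(* The inverse [g] of a complete isometry is a cover, and its range is the C*-algebra [A] itself. *)
have cov : Cstar_cover (psi @` A) g.
  split.
  - by move=> _ [a Aa <-]; rewrite gp//; exact: Ab.
  - by move=> c _ _ [a Aa <-] [b Ab' <-]; rewrite -lp// !gp//; exact: ADl.
  - by rewrite -{1}p1 gp.
  - move=> n X SX; have AX : mx_in A (map_mx g X) by move=> i j; rewrite mxE; have [] := hg _ (SX i j).
    rewrite -ci//; congr mxopnorm; apply/matrixP => i j; rewrite !mxE.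
    by have [] := hg _ (SX i j).
have [t ht te] := univ _ _ cov.
have gA : g @` (psi @` A) = A.
  apply/seteqP; split=> [_ [_ [a Aa <-] <-]|a Aa]; first by rewrite gp.
  by exists (psi a); [exists a|exact: gp].
rewrite gA Cstar_id// in ht.
have etb : eta @` (psi @` A) `<=` bounded_op by move=> _ [S SS <-]; exact: eb.
have tE a : A a -> t a = eta (psi a) by move=> Aa; rewrite -te ?gp//; exists a.
have cE := Cstar_Cstar etb; have [[Eb _ _] _ _ _] := cE.
have [tf lt tM ta] := ht.
have ht' : star_hom A bounded_op t by split=> // T AT; exact: Eb (tf _ AT).
(* The universal property does not provide isometry; it comes from [t = eta \o psi] on [A]. It makes
   the image of [t] a C*-algebra, which contains the generators of the envelope. *)
have it : isometric_on A t.
  move=> a Aa; rewrite tE//.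
  rewrite (ci_isometric _ eb eci); last by exists a.
    exact: ci_isometric Ab pb ci a Aa.
  by move=> _ [b Ab' <-]; exact: pb.
have tA : t @` A = Cstar (eta @` (psi @` A)).
  apply/seteqP; split=> [_ [a Aa <-]|]; first exact: tf.
  apply: Cstar_min; first exact: star_image_Cstar cA ht' it.
  by move=> _ [_ [a Aa <-] <-]; exists a => //; exact: tE.
have [h hh ht2] := star_hom_inv cA ht' it.
rewrite -tA; exists h => //; split.
- by have [] := hh.
- move=> S T /set_mem[a Aa <-] /set_mem[b Ab' <-].
  by rewrite !ht2// => ->.
- by move=> a Aa; exists (t a); [exists a|exact: ht2].
Qed.

(** * Extension of completely positive maps *)

Section Krein.
Context {R : realType} {V : lmodType R[i]}.
Variable P : V -> Prop.
Hypothesis P0 : P 0.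
Hypothesis PD : forall u v, P u -> P v -> P (u + v).
Hypothesis PZ : forall (a : R) u, 0 <= a -> P u -> P (a%:C *: u).
Implicit Types G : set (V * R).

(* Real-linear functionals on subspaces are handled through their graphs. *)
Definition real_graph G := G (0, 0) /\
  forall (a : R) p q, G p -> G q -> G (a%:C *: p.1 + q.1, a * p.2 + q.2).

Definition positive_graph G := forall p, G p -> P p.1 -> 0 <= p.2.

(** Two values would differ by a value at [0], which lies in [P]; positivity then orders them both
    ways. *)
Lemma positive_graph_uniq G v r s : real_graph G -> positive_graph G ->
  G (v, r) -> G (v, s) -> r = s.
Proof.
move=> [G0 GD] Gp Gr Gs.
have h a b : G (v, a) -> G (v, b) -> a <= b.
  move=> Ga Gb; have := GD (-1) _ _ Ga Gb; rewrite /= rmorphN1 scaleN1r addNr mulN1r.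
  by move=> /Gp/(_ P0)/=; rewrite addrC subr_ge0.
by apply/eqP; rewrite eq_le !h.
Qed.

(** The value at [d] has to lie between those on elements below [d] and those on elements above it,
    in the order given by [P]. The infimum of the latter is taken; the two cofinality hypotheses
    make it finite. *)
Lemma extend_graph G d : real_graph G -> positive_graph G ->
  (exists2 p, G p & P (p.1 - d)) -> (exists2 p, G p & P (p.1 + d)) ->
  exists G', [/\ G `<=` G', real_graph G', positive_graph G' & exists r, G' (d, r)].
Proof.
move=> [G0 GD] Gp [pu Gu Pu] [pl Gl Pl].
have GZ (a : R) p : G p -> G (a%:C *: p.1, a * p.2).
  by move=> Gp'; have := GD a _ _ Gp' G0; rewrite !addr0.
pose U := [set p.2 | p in [set p | G p /\ P (p.1 - d)]].
have lu p q : G p -> P (d - p.1) -> G q -> P (q.1 - d) -> p.2 <= q.2.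
  move=> Gp' Pp Gq Pq; have := GD (-1) _ _ Gp' Gq.
  rewrite rmorphN1 scaleN1r mulN1r => /Gp/= h; rewrite -subr_ge0 addrC; apply: h.
  by have := PD Pq Pp; rewrite addrA addrNK addrC.
have hU : has_inf U.
  split; first by exists pu.2, pu.
  exists (- pl.2) => _ [q [Gq Pq] <-].
  have := lu (- pl.1, - pl.2) q; apply => //.
    by have := GZ (-1) _ Gl; rewrite rmorphN1 scaleN1r mulN1r.
  by rewrite opprK addrC.
pose a := inf U.
exists [set p | exists q (t : R), G q /\ p = (q.1 + t%:C *: d, q.2 + t * a)]; split.
- by move=> p Gp'; exists p, 0; rewrite scale0r mul0r !addr0; case: p Gp'.
- split; first by exists (0, 0), 0; rewrite scale0r mul0r !addr0.
  move=> b _ _ [q [t [Gq ->]]] [q' [t' [Gq' ->]]].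
  exists (b%:C *: q.1 + q'.1, b * q.2 + q'.2), (b * t + t'); split; first exact: GD.
  congr (_, _) => /=; last by ring.
  by rewrite rmorphD rmorphM/= scalerDr scalerDl scalerA addrACA.
(* A nonzero coefficient of [d] is scaled to [-1] or [1], which turns membership in [P] into an
   element above or below [d]. *)
- move=> _ [q [t [Gq ->]]]/=; case: (ltrgtP t 0) => [t0|t0|->].
  + move=> Pq; have tp : 0 < (- t)^-1 by rewrite invr_gt0 oppr_gt0.
    suff: a <= (- t)^-1 * q.2.
      by rewrite ler_pdivlMl ?oppr_gt0// mulNr -subr_ge0 opprK.
    apply: ge_inf hU.2 _ _; exists ((- t)^-1%:C *: q.1, (- t)^-1 * q.2) => //.
    split; first exact: GZ.
    have := PZ (ltW tp) Pq; rewrite scalerDr scalerA -rmorphM/=.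
    by rewrite invrN mulNr mulVf ?lt_eqF// rmorphN1 scaleN1r.
  + move=> Pq; have tp : 0 < t^-1 by rewrite invr_gt0.
    suff: t^-1 * - q.2 <= a.
      by rewrite ler_pdivrMl// lerNl -subr_ge0 opprK addrC.
    apply: lb_le_inf hU.1 _ => _ [p [Gp' Pp] <-].
    apply: (lu (t^-1%:C *: - q.1, t^-1 * - q.2)) => //.
      by have := GZ (- t^-1) _ Gq; rewrite rmorphN scaleNr scalerN mulNr mulrN.
    have := PZ (ltW tp) Pq; rewrite scalerDr scalerA -rmorphM/=.
    by rewrite mulVf ?gt_eqF// scale1r scalerN opprK addrC.
  + by rewrite scale0r mul0r !addr0; exact: Gp.
- by exists a, (0, 0), 1; split=> //; rewrite scale1r mul1r !add0r.
Qed.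

Theorem krein_extension (D : set V) G0 : real_graph G0 -> positive_graph G0 ->
  (forall d, D d -> D (- d)) -> (forall d, D d -> exists2 p, G0 p & P (p.1 - d)) ->
  exists G, [/\ G0 `<=` G, real_graph G, positive_graph G & forall d, D d -> exists r, G (d, r)].
Proof.
move=> rG pG DN cof.
pose Q G := G = set0 \/ [/\ G0 `<=` G, real_graph G & positive_graph G].
have [F FQ Ft|A [QA Amax]] := @Zorn_bigcup _ Q.
  have [[G FG [x Gx]]|n] := pselect (exists2 G, F G & G !=set0); last first.
    left; apply/seteqP; split=> // x [G FG Gx]; case: n.
    by exists G => //; exists x.
  right.
  have QG G' y : F G' -> G' y -> [/\ G0 `<=` G', real_graph G' & positive_graph G'].
    by move=> /FQ[->//|]. 
  have [G0G [G00 _] _] := QG _ _ FG Gx.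
  split.
  - by move=> y /G0G Gy; exists G.
  - split; first by exists G.
    move=> a p q [G1 FG1 Gp1] [G2 FG2 Gq2].
    have [G12|G21] := Ft _ _ FG1 FG2.
      have [_ [_ h] _] := QG _ _ FG2 Gq2; exists G2 => //.
      by apply: h => //; exact: G12.
    have [_ [_ h] _] := QG _ _ FG1 Gp1; exists G1 => //.
    by apply: h => //; exact: G21.
  - by move=> p [G1 FG1 Gp1]; have [_ _ h] := QG _ _ FG1 Gp1; exact: h.
have {QA} [GA rA pA] : [/\ G0 `<=` A, real_graph A & positive_graph A].
  case: QA => // A0; have [G00 _] := rG; case: (Amax G0); last by right; split.
  by rewrite A0; split=> // /(_ (0, 0) G00).
exists A; split=> // d Dd.
have [p Gp Pp] := cof _ Dd; have [q Gq Pq] := cof _ (DN _ Dd).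
have [||G' [AG' rG' pG' [r G'd]]] := @extend_graph A d rA pA.
- by exists p => //; exact: GA.
- by exists q; [exact: GA|rewrite opprK in Pq].
exists r; apply: contrapT => nA; apply: (Amax G').
  by split=> // /(_ _ G'd).
by right; split=> //; exact: subset_trans GA AG'.
Qed.
End Krein.

Lemma exchange_big4 (V : nmodType) (I J K L : finType) (F : I -> J -> K -> L -> V) :
  \sum_i \sum_j \sum_k \sum_l F i j k l = \sum_k \sum_l \sum_i \sum_j F i j k l.
Proof.
rewrite pair_big/= [RHS]pair_big/=; under eq_bigr do rewrite pair_big/=.
by rewrite exchange_big/=; apply: eq_bigr => p _; rewrite pair_big.
Qed.

(** * Finite tensors as operator-valued functions of two vectors *)

Section Tensors.
Context {R : realType} {H L : hilbertType R}.
Local Notation V := (L -> L -> H -> H).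

(* [tens X v] stands for the finite sum of the elementary tensors
   [X k l (x) v l (x) conj (v k)]. *)
Definition tens {I : finType} (X : I -> I -> H -> H) (v : I -> L) : V :=
  fun a b => \sum_k \sum_l if (v k == a) && (v l == b) then X k l else 0.

(** The cone for Krein's theorem. Constraining the real part only makes it cofinal also for tensors
    that are not selfadjoint, since [c - X] is accretive once [|X| <= c]. [Z] is a matrix indexed by
    all vectors of [L], tested on finite families of them. *)
Definition accretive (Z : V) := forall (J : finType) (w : J -> L) (x : J -> H),
  0 <= Re (opform (fun j l => Z (w j) (w l)) x x).

(** Coordinates belonging to equal vectors merge into sums. Hence a tensor inherits accretivity from
    its coefficient matrix. *)
Lemma opform_tens (I J : finType) (X : I -> I -> H -> H) (v : I -> L) (w : J -> L) x :
  (forall i j, linear (X i j)) ->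
  opform (fun j l => tens X v (w j) (w l)) x x =
  opform X (fun k => \sum_j if v k == w j then x j else 0)
           (fun k => \sum_j if v k == w j then x j else 0).
Proof.
move=> lX; rewrite /opform.
pose F j l k m := hdot (X k m (if v m == w l then x l else 0)) (if v k == w j then x j else 0).
transitivity (\sum_j \sum_l \sum_k \sum_m F j l k m).
  apply: eq_bigr => j _; apply: eq_bigr => l _; rewrite /tens fct_sumE dot_suml.
  apply: eq_bigr => k _; rewrite fct_sumE dot_suml; apply: eq_bigr => m _; rewrite /F.
  case: (v m == w l); last by rewrite andbF (linT0 (lX _ _)) -[LHS]/(hdot (0 : H) _) !dot0l.
  by case: (v k == w j); rewrite ?dot0r// -[LHS]/(hdot (0 : H) _) dot0l.
rewrite exchange_big4; apply: eq_bigr => k _; apply: eq_bigr => m _.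
rewrite exchange_big (linT_sum (lX k m)) dot_suml; apply: eq_bigr => l _.
by rewrite dot_sumr.
Qed.

Lemma tens_op (I : finType) (X : I -> I -> H -> H) v a b (A : set (H -> H)) :
  op_subspace A -> (forall i j, A (X i j)) -> A (tens X v a b).
Proof.
move=> sA AX; apply: op_subspace_sum => // k; apply: op_subspace_sum => // l.
by case: ifP => // _; case: sA.
Qed.

Lemma tensD (I J : finType) (X : I -> I -> H -> H) (X' : J -> J -> H -> H) v v' :
  tens (blk X (fun _ _ => 0) (fun _ _ => 0) X') (fun s => match s with inl i => v i | inr j => v' j end)
  = tens X v + tens X' v'.
Proof.
apply/funext => a; apply/funext => b; rewrite /tens.
pose F (s t : I + J) (T : H -> H) := if ((match s with inl i => v i | inr j => v' j end) == a) &&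
   ((match t with inl i => v i | inr j => v' j end) == b) then T else 0.
rewrite !big_sumType/= -[RHS]/(tens X v a b + tens X' v' a b).
congr (_ + _); apply: eq_bigr => i _; rewrite big_sumType/=.
  by rewrite [X in _ + X]big1 ?addr0// => j _; case: ifP.
by rewrite [X in X + _]big1 ?add0r// => j _; case: ifP.
Qed.

Lemma tensZ (I : finType) (X : I -> I -> H -> H) v c :
  tens (fun i j => c *: X i j) v = c *: tens X v.
Proof.
apply/funext => a; apply/funext => b; rewrite -[RHS]/(c *: tens X v a b) /tens.
rewrite scaler_sumr; apply: eq_bigr => k _; rewrite scaler_sumr; apply: eq_bigr => l _.
by case: ifP; rewrite // scaler0.
Qed.

Lemma tensB (I : finType) (X X' : I -> I -> H -> H) v :
  tens (fun i j => X i j - X' i j) v = tens X v - tens X' v.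
Proof.
apply/funext => a; apply/funext => b; rewrite -[RHS]/(tens X v a b - tens X' v a b) /tens.
rewrite -sumrB; apply: eq_bigr => k _; rewrite -sumrB; apply: eq_bigr => l _.
by case: ifP; rewrite // subr0.
Qed.

Definition elem (T : H -> H) (x y : L) : V := fun a b => if (a == y) && (b == x) then T else 0.

Lemma elem_tens T x y :
  elem T x y = tens (fun b b' : bool => if b && ~~ b' then T else 0) (fun b => if b then y else x).
Proof.
apply/funext => a; apply/funext => b; rewrite /tens /elem.
rewrite !big_bool/= !if_same !addr0 add0r.
by rewrite [a == y]eq_sym [b == x]eq_sym.
Qed.

Lemma sum_elem (I : finType) (X : I -> I -> H -> H) v :
  \sum_i \sum_j elem (X i j) (v j) (v i) = tens X v.
Proof.
have sE (J : finType) (F : J -> V) a b : (\sum_j F j) a b = \sum_j F j a b.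
  by elim/big_rec2: _ => // j u w _ <-.
apply/funext => a; apply/funext => b; rewrite sE; apply: eq_bigr => i _.
by rewrite sE; apply: eq_bigr => j _; rewrite /elem [a == _]eq_sym [b == _]eq_sym.
Qed.
End Tensors.

(** * Arveson's extension theorem *)

Section Arveson.
Context {R : realType} {H L : hilbertType R}.
Local Notation V := (L -> L -> H -> H).

Lemma opformDop (I J : finType) (X Y : J -> I -> H -> H) x y :
  opform (fun j i => X j i + Y j i) x y = opform X x y + opform Y x y.
Proof.
rewrite /opform -big_split; apply: eq_bigr => j _; rewrite -big_split.
by apply: eq_bigr => i _; rewrite fctE dotDl.
Qed.

Lemma opformZop (I J : finType) a (X : J -> I -> H -> H) x y :
  opform (fun j i => a *: X j i) x y = a * opform X x y.
Proof.
rewrite /opform mulr_sumr; apply: eq_bigr => j _; rewrite mulr_sumr.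
by apply: eq_bigr => i _; rewrite fctE dotZl.
Qed.

Lemma opform_adj (I : finType) (X : I -> I -> H -> H) x y : (forall i j, bounded_op (X i j)) ->
  opform (fun i j => adj (X j i)) x y = (opform X y x)^*%C.
Proof.
move=> bX; rewrite /opform conjc_sum; under [RHS]eq_bigr do rewrite conjc_sum.
rewrite exchange_big; apply: eq_bigr => j _; apply: eq_bigr => i _.
by rewrite adj_dotl// -dotC.
Qed.

Lemma Re_mulr (a : R) (z : R[i]) : Re (a%:C * z) = a * Re z.
Proof. by case: z => u v /=; rewrite mul0r subr0. Qed.

Lemma accretive0 : accretive (0 : V).
Proof.
move=> J w x; rewrite /opform big1 // => j _; rewrite big1// => l _.
by rewrite -[LHS]/(hdot (0 : H) _) dot0l.
Qed.

Lemma accretiveD (Z Z' : V) : accretive Z -> accretive Z' -> accretive (Z + Z').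
Proof. by move=> h h' J w x; rewrite opformDop raddfD addr_ge0//; [exact: h|exact: h']. Qed.

Lemma accretiveZ (a : R) (Z : V) : 0 <= a -> accretive Z -> accretive (a%:C *: Z).
Proof. by move=> a0 h J w x; rewrite opformZop Re_mulr mulr_ge0//; exact: h. Qed.

(* Compensates for repetitions in the family [v]. *)
Lemma multiplicity_weights (I : finType) (v : I -> L) : exists a : I -> R,
  forall k, \sum_j (if v k == v j then a j else 0) = 1.
Proof.
exists (fun j => #|[pred k | v k == v j]|%:R^-1) => k; rewrite -big_mkcond/=.
rewrite (eq_bigr (fun=> #|[pred j | v j == v k]|%:R^-1)) => [|j /eqP ->//].
rewrite sumr_const; set n := #|_|; set m := #|_|.
have -> : n = m by apply: eq_card => j; rewrite !inE eq_sym.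
rewrite -[LHS]mulr_natr mulVf// pnatr_eq0 -lt0n; apply/card_gt0P.
by exists k; exact: eqxx.
Qed.

Variables (B : set (H -> H)) (f : (H -> H) -> (L -> L)).
Hypotheses (hB : selfadjoint_unital B) (hf : ucp B f).

Let s {I : finType} (X : I -> I -> H -> H) (v : I -> L) := \sum_k \sum_l hdot (f (X k l) (v l)) (v k).

(* Complete positivity of [f] says that the real functional sending [tens X v] to
   [Re (s X v)] is nonnegative on the accretive tensors; Krein's theorem extends it
   from [B] to all bounded operators. *)
Let graph0 : set (V * R) := [set p | exists (I : finType) (X : I -> I -> H -> H) (v : I -> L),
  [/\ forall i j, B (X i j), p.1 = tens X v & p.2 = Re (s X v)]].

Let sB : op_subspace B. Proof. by case: hB. Qed.
Let Bb : B `<=` bounded_op. Proof. by have [+ _ _] := sB. Qed.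
Let B0 : B 0. Proof. by have [_ + _] := sB. Qed.
Let lf : linear_on B f. Proof. by case: hf. Qed.
Let f0 : f 0 = 0. Proof. exact: linear_on0 sB lf. Qed.

Let graph0_real : real_graph graph0.
Proof.
split.
  exists 'I_0, (fun _ _ => 0), (fun=> 0); split=> //.
    by apply/funext => a; apply/funext => b; rewrite /tens big_ord0.
  by rewrite /s big_ord0.
move=> a _ _ [I [X [v [BX -> ->]]]] [J [Y [w [BY -> ->]]]].
exists (I + J)%type, (blk (fun i j => a%:C *: X i j) (fun _ _ => 0) (fun _ _ => 0) Y),
  (fun t => match t with inl i => v i | inr j => w j end); split=> /=.
- by move=> [i|i] [j|j] //=; exact: op_subspaceZ.
- by rewrite tensD tensZ.
- pose F t u (T : H -> H) := hdot (f T (match u with inl i => v i | inr j => w j end : L))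
    (match t with inl i => v i | inr j => w j end : L).
  set Z := blk _ _ _ _; rewrite -[s Z _]/(\sum_t \sum_u F t u (Z t u)) sum_blk {}/F/=.
  rewrite f0 [X in _ + X + _]big1; last by move=> *; rewrite big1// => *; exact: dot0l.
  rewrite [X in _ + (X + _)]big1; last by move=> *; rewrite big1// => *; exact: dot0l.
  rewrite addr0 add0r raddfD/=; congr (_ + _).
  rewrite -Re_mulr /s mulr_sumr; congr Re; apply: eq_bigr => i _; rewrite mulr_sumr.
  by apply: eq_bigr => j _; rewrite (linear_onZ _ sB lf)// fctE dotZl.
Qed.

(** The matrix of [tens X v] at the vectors [v] merges entries of [X] with equal vectors; the
    weights compensate, so that [Y] has the same value of [s] as [X]. Accretivity makes [Y] plus its
    adjoint positive, and complete positivity of [f] there says that twice the real part of this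
    value is nonnegative. *)
Let graph0_positive : positive_graph accretive graph0.
Proof.
move=> _ [I [X [v [BX -> ->]]]] acc.
have [a a1] := multiplicity_weights v.
pose Y j l : H -> H := (a j * a l)%:C *: tens X v (v j) (v l).
have BT j l : B (tens X v (v j) (v l)) by exact: tens_op.
have BY j l : B (Y j l) by exact: op_subspaceZ.
have [_ _ Ba] := hB.
pose W j l := Y j l + adj (Y l j).
have BW j l : B (W j l) by apply: op_subspaceD => //; exact: Ba.
have W0 : fam_ge0 W.
  move=> x; rewrite opformDop opform_adj//; last by move=> *; exact: Bb.
  rewrite addcJ -(rmorph_nat (real_complex R)) -rmorphM ler0c mulr_ge0//.
  have -> : opform Y x x = opform (fun j l => tens X v (v j) (v l))
     (fun j => (a j)%:C *: x j) (fun j => (a j)%:C *: x j).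
    apply: eq_bigr => j _; apply: eq_bigr => l _.
    rewrite (linTZ (bounded_linear (Bb (BT j l)))) dotZl dotZr conjc_real dotZl rmorphM.
    by ring.
  exact: acc.
have [_ _ _ /cp_kcp kf] := hf.
have := kf _ _ BW W0 v.
have -> : \sum_i \sum_j hdot (f (W i j) (v j)) (v i) = s Y v + (s Y v)^*%C.
  rewrite {2}/s conjc_sum; under [X in _ = _ + X]eq_bigr do rewrite conjc_sum.
  rewrite [X in _ = _ + X]exchange_big /s -big_split; apply: eq_bigr => i _.
  rewrite -big_split; apply: eq_bigr => j _; rewrite /W (linear_onD lf)//; last exact: Ba.
  rewrite fctE dotDl (ucp_adj hB hf)// adj_dotl; last by have [fb _ _ _] := hf; exact: fb.
  by rewrite -dotC.
rewrite addcJ -(rmorph_nat (real_complex R)) -rmorphM ler0c pmulr_rge0//.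
suff -> : s Y v = s X v by [].
rewrite /s; pose F j l k m := (if v k == v j then a j else 0)%:C * (if v m == v l then a l else 0)%:C *
  hdot (f (X k m) (v m)) (v k).
transitivity (\sum_j \sum_l \sum_k \sum_m F j l k m).
  apply: eq_bigr => j _; apply: eq_bigr => l _.
  rewrite /Y (linear_onZ _ sB lf)// fctE dotZl /tens.
  rewrite (linear_on_sum _ _ sB lf); last first.
    by move=> k; apply: op_subspace_sum => // m; case: ifP.
  rewrite fct_sumE dot_suml mulr_sumr; apply: eq_bigr => k _.
  rewrite (linear_on_sum _ _ sB lf); last by move=> m; case: ifP.
  rewrite fct_sumE dot_suml mulr_sumr; apply: eq_bigr => m _; rewrite /F.
  case: eqP => [->|_]; last by rewrite f0 !mul0r -[X in hdot X _]/(0 : L) dot0l mulr0.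
  case: eqP => [->|_]; last by rewrite f0 !mulr0 mul0r -[X in hdot X _]/(0 : L) dot0l mulr0.
  by rewrite rmorphM.
rewrite exchange_big4; apply: eq_bigr => k _; apply: eq_bigr => m _; rewrite /F.
under eq_bigr do rewrite -mulr_suml -mulr_sumr.
rewrite -!mulr_suml -!rmorph_sum.
by rewrite !a1 !mul1r.
Qed.

Let dom : set V := [set Z | exists (I : finType) (X : I -> I -> H -> H) (v : I -> L),
  (forall i j, bounded_op (X i j)) /\ Z = tens X v].

Let dom_lin a Z Z' : dom Z -> dom Z' -> dom (a *: Z + Z').
Proof.
move=> [I [X [v [bX ->]]]] [J [Y [w [bY ->]]]].
exists (I + J)%type, (blk (fun i j => a *: X i j) (fun _ _ => 0) (fun _ _ => 0) Y),
  (fun t => match t with inl i => v i | inr j => w j end); split; last by rewrite tensD tensZ.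
move=> [i|i] [j|j] //=; try exact: bounded_op0.
exact: op_subspaceZ (@bounded_op_subspace R H) (bX i j).
Qed.

Let dom0 : dom 0.
Proof.
exists 'I_0, (fun _ _ => 0), (fun=> 0); split=> [[]//|].
by apply/funext => a; apply/funext => b; rewrite /tens big_ord0.
Qed.

(** The diagonal matrix [c] has entries in [B] and dominates [X] as soon as [|X| <= c]. *)
Let cofinal Z : dom Z -> exists2 p, graph0 p & accretive (p.1 - Z).
Proof.
move=> [I [X [v [bX ->]]]]; have [c c0 Xc] := fbound_entries bX.
have [_ B1 _] := hB.
pose D (i j : I) : H -> H := if i == j then c%:C *: id else 0.
have BD i j : B (D i j) by exact: op_if.
exists (tens D v, Re (s D v)); first by exists I, D, v.
rewrite /= -tensB => J w x; rewrite opform_tens; last first.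
  move=> i j; apply: bounded_linear; apply: op_subspaceB => //; [exact: bounded_op_subspace|exact: Bb].
pose y k := \sum_j if v k == w j then x j else 0; rewrite -/y.
rewrite opformDop (_ : opform (fun j i => - X j i) y y = - opform X y y); last first.
  rewrite /opform -sumrN; apply: eq_bigr => i _; rewrite -sumrN.
  by apply: eq_bigr => j _; rewrite fctE dotNl.
have -> : opform D y y = (c * sqn y)%:C.
  rewrite /opform (form_diag (k := fun T x y => hdot (T x) y)); last by move=> *; exact: dot0l.
  rewrite rmorphM/= -sum_dotxx mulr_sumr; apply: eq_bigr => i _.
  by rewrite fctE dotZl.
rewrite raddfB/= subr_ge0; apply: le_trans (Re_le_normc _) _.
rewrite -ler_sqr ?nnegrE ?normc_ge0 ?mulr_ge0 ?sqn_ge0//.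
by apply: le_trans (Xc y y) _; rewrite exprMn expr2.
Qed.

Theorem arveson_extension : exists g : (H -> H) -> (L -> L), ucp bounded_op g /\
  forall T, B T -> g T = f T.
Proof.
have domN Z : dom Z -> dom (- Z).
  by move=> dZ; rewrite -[- Z]addr0 -scaleN1r; exact: dom_lin.
have [G [G0G rG pG Gdom]] := krein_extension accretiveD accretiveZ
  graph0_real graph0_positive domN cofinal.
have uG := positive_graph_uniq accretive0 rG pG.
have /choice[g hg] Z : exists r, dom Z -> G (Z, r).
  have [/Gdom[r Gr]|n] := pselect (dom Z); [by exists r|by exists 0].
have gL (a : R) Z Z' : dom Z -> dom Z' -> g (a%:C *: Z + Z') = a * g Z + g Z'.
  move=> dZ dZ'; apply: uG (hg _ (dom_lin _ dZ dZ')) _.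
  by have [_ h] := rG; exact: h a _ _ (hg _ dZ) (hg _ dZ').
have gp Z : dom Z -> accretive Z -> 0 <= g Z by move=> dZ; exact: pG (hg _ dZ).
have domZ a Z : dom Z -> dom (a *: Z) by move=> dZ; rewrite -[_ *: _]addr0; exact: dom_lin.
have g0 : g 0 = 0.
  have /eqP := gL 1 _ _ dom0 dom0; rewrite scaler0 addr0 mul1r.
  by rewrite -subr_eq0 opprD addNKr oppr_eq0 => /eqP.
have gD Z Z' : dom Z -> dom Z' -> g (Z + Z') = g Z + g Z'.
  by move=> dZ dZ'; have := gL 1 _ _ dZ dZ'; rewrite rmorph1 scale1r mul1r.
have gZ (a : R) Z : dom Z -> g (a%:C *: Z) = a * g Z.
  by move=> dZ; have := gL a _ _ dZ dom0; rewrite addr0 g0 addr0.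
(* The complex-linear functional with real part [g]. *)
pose h Z : R[i] := g Z +i* - g ('i%C *: Z).
have hD Z Z' : dom Z -> dom Z' -> h (Z + Z') = h Z + h Z'.
  move=> dZ dZ'; rewrite /h scalerDr !gD//; try exact: domZ.
  by apply/eqP; rewrite eq_complex/= opprD !eqxx.
have hZ a Z : dom Z -> h (a *: Z) = a * h Z.
  case: a => a b dZ.
  have e1 : (a +i* b) *: Z = a%:C *: Z + b%:C *: ('i%C *: Z).
    rewrite scalerA -scalerDl; congr (_ *: _).
    by apply/eqP; rewrite eq_complex/=; apply/andP; split; apply/eqP; ring.
  have e2 : 'i%C *: ((a +i* b) *: Z) = (- b)%:C *: Z + a%:C *: ('i%C *: Z).
    rewrite !scalerA -scalerDl; congr (_ *: _).
    by apply/eqP; rewrite eq_complex/=; apply/andP; split; apply/eqP; ring.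
  have diZ := domZ 'i%C _ dZ.
  have E1 := gL a _ _ dZ (domZ b%:C _ diZ).
  have E2 := gL (- b) _ _ dZ (domZ a%:C _ diZ).
  rewrite /h e2 e1 E1 E2 !gZ//; apply/eqP; rewrite eq_complex/=; apply/andP.
  by split; apply/eqP; ring.
have hB' (I : finType) (X : I -> I -> H -> H) v : (forall i j, B (X i j)) -> h (tens X v) = s X v.
  move=> BX.
  have ge (Y : I -> I -> H -> H) : (forall i j, B (Y i j)) -> g (tens Y v) = Re (s Y v).
    move=> BY; apply: uG (hg _ _) _; first by exists I, Y, v; split=> // i j; exact: Bb.
    by apply: G0G; exists I, Y, v.
  rewrite /h -tensZ !ge//; last by move=> i j; exact: op_subspaceZ.
  have -> : s (fun i j => 'i%C *: X i j) v = 'i%C * s X v.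
    rewrite /s mulr_sumr; apply: eq_bigr => i _; rewrite mulr_sumr.
    by apply: eq_bigr => j _; rewrite (linear_onZ _ sB lf)// fctE dotZl.
  by case: (s X v) => u w; apply/eqP; rewrite eq_complex/=; apply/andP; split; apply/eqP; ring.
have bt (T : H -> H) : bounded_op T -> forall b b' : bool, bounded_op (if b && ~~ b' then T else 0).
  by move=> bT b b'; case: ifP => // _; exact: bounded_op0.
have dE T x y : bounded_op T -> dom (@elem R H L T x y).
  by move=> bT; rewrite elem_tens; exists bool, (fun b b' => if b && ~~ b' then T else 0), (fun b => if b then y else x); split=> // b b'; exact: bt.
have hE T x y : B T -> h (@elem R H L T x y) = hdot (f T x) y.
  move=> BT; rewrite elem_tens hB'; last by move=> b b'; case: ifP.
  have z0 u w : hdot ((0 : L -> L) u) w = 0 := dot0l w.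
  by rewrite /s !big_bool/= f0 !z0 !addr0 add0r.
have [k [uk kE]] : exists k : (H -> H) -> (L -> L), ucp bounded_op k /\
    forall T x y, bounded_op T -> hdot (k T x) y = h (elem T x y).
  apply: kernel_ucp.
  - move=> I X bX X0 v.
    have hs (J : finType) (F : J -> V) : (forall j, dom (F j)) ->
        dom (\sum_j F j) /\ h (\sum_j F j) = \sum_j h (F j).
      move=> dF; elim/big_rec2: _ => [|j u w _ [dw <-]].
        by split; [exact: dom0|have := hZ 0 _ dom0; rewrite scale0r mul0r].
      by split; [rewrite -[F j]scale1r; exact: dom_lin|rewrite hD].
    have -> : \sum_i \sum_j h (elem (X i j) (v j) (v i)) = h (tens X v).
      rewrite -sum_elem; have [|_ ->] := hs _ (fun i => \sum_j elem (X i j) (v j) (v i)).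
        by move=> i; have [|] := hs _ (fun j => elem (X i j) (v j) (v i)); first by move=> j; exact: dE.
      by apply: eq_bigr => i _; have [|_ ->] := hs _ (fun j => elem (X i j) (v j) (v i)); first by move=> j; exact: dE.
    have lX i j := bounded_linear (bX i j).
    have dT : dom (tens X v) by exists I, X, v.
    (* For positive [X] the tensor remains accretive after multiplication by [1], [i] and [-i]; the
       last two force the imaginary part of [h] to vanish. *)
    have acc (c : R[i]) : Re c >= 0 -> accretive (c *: tens X v).
      move=> c0 J w x; rewrite opformZop opform_tens//; set y := fun k => _.
      have := X0 y; case: (opform X y y) => p q; rewrite lecE/= => /andP[/eqP -> p0].
      by case: c c0 => c1 c2 /= c10; rewrite mulr0 subr0 mulr_ge0.
    have p1 : 0 <= g (tens X v) by apply: gp => //; rewrite -[tens X v]scale1r; apply: acc => /=.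
    have p2 : 0 <= g ('i%C *: tens X v) by apply: gp; [exact: domZ|apply: acc].
    have p3 : 0 <= g ((- 'i%C) *: tens X v) by apply: gp; [exact: domZ|apply: acc; rewrite /= oppr0].
    have : g ((- 'i%C) *: tens X v) = - g ('i%C *: tens X v).
      by rewrite scaleNr -scaleN1r -(rmorphN1 (real_complex R)) gZ ?mulN1r//; exact: domZ.
    rewrite lecE/= p1 andbT => e; rewrite e oppr_ge0 in p3.
    by rewrite oppr_eq0 eq_le p2 p3.
  - move=> a S T x y bS bT; rewrite -(hZ a _ (dE S x y bS)) -(hD _ _ (domZ a _ (dE S x y bS)) (dE T x y bT)).
    congr h; apply/funext => u; apply/funext => w.
    rewrite -[RHS]/(a *: elem S x y u w + elem T x y u w) /elem.
    by case: ifP => //; rewrite scaler0 addr0.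
  - by move=> x y; have [_ B1 _] := hB; rewrite hE//; have [_ _ -> _] := hf.
exists k; split=> // T BT; apply/funext => x; apply: dot_inj => y.
by rewrite kE ?hE//; exact: Bb.
Qed.
End Arveson.

(** * A minimal idempotent dominated by a ucp map *)

Section UltraLimit.
Context {R : realType} {T : Type} (U : set_system T) (UF : UltraFilter U).
Implicit Types (g : T -> R[i]) (l : R[i]).

(** Bounded functions always have a limit along an ultrafilter; this replaces compactness of the set
    of ucp maps for pointwise weak convergence. *)
Definition ulim g l := forall e : R, 0 < e -> U [set t | normc (g t - l) <= e].

Lemma ulim_real (h : T -> R) (c : R) : (forall t, `|h t| <= c) ->
  exists m : R, forall e : R, 0 < e -> U [set t | `|h t - m| <= e].
Proof.
move=> hc; pose E := [set r | U [set t | r <= h t]].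
have Ec : E (- c) by apply: filterS filterT => t _ /=; have := hc t; rewrite ler_norml => /andP[].
have Eub r : E r -> r <= c.
  move=> /filter_ex[t /= rt]; apply: le_trans rt _.
  by have := hc t; rewrite ler_norml => /andP[].
have hE : has_sup E by split; [exists (- c)|exists c => r /Eub].
exists (sup E) => e e0.
have [r Er rs] := sup_adherent e0 hE.
(* The ultrafilter decides this inequality, and its failure would put [sup E + e] into [E]. *)
have U2 : U [set t | h t <= sup E + e].
  have [//|h2] := in_ultra_setVsetC [set t | h t <= sup E + e] UF.
  have : E (sup E + e).
    by apply: filterS h2 => t /= /negP; rewrite -ltNge => /ltW.
  by move=> /(sup_upper_bound hE); rewrite gerDl leNgt e0.
apply: filterS (filterI Er U2) => t /= [h1 h2].
by rewrite ler_norml; apply/andP; split; lra.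
Qed.

Lemma ulim_exists g c : (forall t, normc (g t) <= c) -> exists l, ulim g l.
Proof.
move=> gc.
have n1 (z : R[i]) : `|Re z| <= normc z by rewrite -lecR -normcE' normc_ge_Re.
have n2 (z : R[i]) : `|Im z| <= normc z.
  by case: z => a b /=; rewrite /normc -sqrtr_sqr ler_sqrt ?addr_ge0 ?sqr_ge0// lerDr sqr_ge0.
have [a ha] := ulim_real (fun t => le_trans (n1 (g t)) (gc t)).
have [b hb] := ulim_real (fun t => le_trans (n2 (g t)) (gc t)).
exists (a +i* b) => e e0; have e2 : 0 < e / 2 by rewrite divr_gt0.
apply: filterS (filterI (ha _ e2) (hb _ e2)) => t /= [h1 h2].
have nl (z : R[i]) : normc z <= `|Re z| + `|Im z|.
  case: z => p q /=; rewrite /normc -[leRHS]ger0_norm ?addr_ge0// -sqrtr_sqr.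
  rewrite ler_sqrt ?sqr_ge0// -[p ^+ 2]real_normK ?num_real// -[q ^+ 2]real_normK ?num_real//.
  by rewrite sqrrD addrAC lerDl mulrn_wge0// mulr_ge0.
apply: le_trans (nl _) _; case: (g t) h1 h2 => p q /= h1 h2.
by rewrite [leRHS]splitr lerD.
Qed.

Lemma ulim_uniq g l l' : ulim g l -> ulim g l' -> l = l'.
Proof.
move=> h h'; apply/eqP; rewrite -subr_eq0; apply/eqP/eq0_normc/eqP.
rewrite eq_le normc_ge0 andbT; apply/ler_addgt0Pr => e e0; rewrite add0r.
have e2 : 0 < e / 2 by rewrite divr_gt0.
have [t /= [h1 h2]] := filter_ex (filterI (h _ e2) (h' _ e2)).
rewrite (_ : l - l' = - (g t - l) + (g t - l')); last by ring.
by apply: le_trans (le_normcD _ _) _; rewrite normcN [leRHS]splitr lerD.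
Qed.

Lemma ulim_cst l : ulim (fun=> l) l.
Proof. by move=> e e0; apply: filterS filterT => t _ /=; rewrite subrr normc0 ltW. Qed.

Lemma ulimD g g' l l' : ulim g l -> ulim g' l' -> ulim (fun t => g t + g' t) (l + l').
Proof.
move=> h h' e e0; have e2 : 0 < e / 2 by rewrite divr_gt0.
apply: filterS (filterI (h _ e2) (h' _ e2)) => t /= [h1 h2].
rewrite (_ : _ - _ = (g t - l) + (g' t - l')); last by ring.
by apply: le_trans (le_normcD _ _) _; rewrite [leRHS]splitr lerD.
Qed.

Lemma ulimZ a g l : ulim g l -> ulim (fun t => a * g t) (a * l).
Proof.
move=> h e e0; have a0 : 0 < normc a + 1 by rewrite ltr_wpDl ?normc_ge0.
apply: filterS (h _ (divr_gt0 e0 a0)) => t /= h1; rewrite -mulrBr normcM.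
apply: (@le_trans _ _ ((normc a + 1) * normc (g t - l))).
  by rewrite ler_wpM2r ?normc_ge0// lerDl.
by rewrite mulrC -ler_pdivlMr.
Qed.

Lemma ulim_sum (I : finType) (g : I -> T -> R[i]) (l : I -> R[i]) : (forall i, ulim (g i) (l i)) ->
  ulim (fun t => \sum_i g i t) (\sum_i l i).
Proof.
move=> h; suff H (s : seq I) : ulim (fun t => \sum_(i <- s) g i t) (\sum_(i <- s) l i) by exact: H.
elim: s => [|i s IH].
  rewrite big_nil (_ : (fun _ => _) = fun=> 0); first exact: ulim_cst.
  by apply/funext => t; rewrite big_nil.
rewrite big_cons (_ : (fun _ => _) = fun t => g i t + \sum_(j <- s) g j t); first exact: ulimD.
by apply/funext => t; rewrite big_cons.
Qed.

Lemma ulim_bound g l c : U [set t | normc (g t) <= c] -> ulim g l -> normc l <= c.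
Proof.
move=> hc h; apply/ler_addgt0Pr => e e0.
have [t /= [h1 h2]] := filter_ex (filterI hc (h _ e0)).
rewrite (_ : l = g t - (g t - l)); last by ring.
by apply: le_trans (le_normcD _ _) _; rewrite normcN lerD.
Qed.

Lemma ulim_ge0 g l : (forall t, 0 <= g t) -> ulim g l -> 0 <= l.
Proof.
move=> g0 h.
have gR t : g t = (Re (g t))%:C by rewrite RRe_real// ger0_real.
have n2 (z : R[i]) : `|Im z| <= normc z.
  by case: z => a b /=; rewrite /normc -sqrtr_sqr ler_sqrt ?addr_ge0 ?sqr_ge0// lerDr sqr_ge0.
rewrite lecE/=; apply/andP; split.
  rewrite -normr_eq0 eq_le normr_ge0 andbT; apply/ler_addgt0Pr => e e0; rewrite add0r.
  have [t /= h1] := filter_ex (h _ e0); apply: le_trans h1; apply: le_trans (n2 _).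
  by rewrite gR; case: l {h} => a b /=; rewrite sub0r normrN.
apply/ler_addgt0Pr => e e0.
have [t /= h1] := filter_ex (h _ e0).
have : 0 <= Re (g t) by rewrite -ler0c -gR.
by have := le_trans (Re_le_normc _) h1; rewrite raddfB/=; lra.
Qed.
End UltraLimit.

Lemma ucp_comp (R : realType) (H K L : hilbertType R) (A : set (H -> H)) (B : set (K -> K))
    (S : (K -> K) -> (L -> L)) (T : (H -> H) -> (K -> K)) :
  set_fun A B T -> ucp A T -> ucp B S -> ucp A (S \o T).
Proof.
move=> AB [Tb Tl T1 Tp] [Sb Sl S1 Sp]; split.
- by move=> X AX; apply: Sb; exact: AB.
- by move=> a X Y AX AY /=; rewrite Tl// Sl//; exact: AB.
- by rewrite /= T1.
- move=> n X AX X0; rewrite map_mx_comp; apply: Sp; last exact: Tp.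
  by move=> i j; rewrite mxE; exact: AB.
Qed.

Section Semigroup.
Context {R : realType} {H : hilbertType R}.
Implicit Types S T : (H -> H) -> (H -> H).
Local Notation BH := (@bounded_op R H).

Lemma ucp_iter n S : ucp BH S -> ucp BH (iter n S).
Proof.
move=> uS; elim: n => [|n IH]; last by apply: ucp_comp (IH) uS; case: IH.
split; [by move=> X|by move=> a X Y|by []|move=> m X bX X0].
by rewrite (_ : map_mx _ X = X)//; apply/matrixP => i j; rewrite mxE.
Qed.

Definition mid S T : (H -> H) -> (H -> H) := fun X => 2^-1 *: (S X + T X).

Lemma mid_ucp S T : ucp BH S -> ucp BH T -> ucp BH (mid S T).
Proof.
move=> [Sb Sl S1 /cp_kcp Sp] [Tb Tl T1 /cp_kcp Tp]; have sb := @bounded_op_subspace R H.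
split.
- by move=> X bX; apply: op_subspaceZ => //; apply: op_subspaceD => //; [exact: Sb|exact: Tb].
- move=> a X Y bX bY; apply/funext => x; apply: dot_inj => z.
  by rewrite /mid Sl// Tl// !fctE !(dotZl, dotDl); ring.
- apply/funext => x; apply: dot_inj => z.
  by rewrite /mid S1 T1 !fctE !(dotZl, dotDl); field.
- apply/cp_kcp => I X bX X0 v.
  have := addr_ge0 (Sp _ _ bX X0 v) (Tp _ _ bX X0 v).
  rewrite -(pmulr_rge0 _ (_ : 0 < 2^-1)) ?invr_gt0 ?ltr0n//.
  congr (_ <= _); rewrite -big_split mulr_sumr; apply: eq_bigr => i _.
  rewrite -big_split mulr_sumr; apply: eq_bigr => j _.
  by rewrite /mid !fctE dotZl dotDl.
Qed.

Lemma half_normc (z w : R[i]) (c : R) : normc z <= c -> normc w <= c -> normc (2^-1 * (z + w)) <= c.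
Proof.
move=> h1 h2; rewrite normcM.
have -> : normc (2^-1 : R[i]) = 2^-1.
  have -> : (2^-1 : R[i]) = (2^-1 : R)%:C by rewrite fmorphV rmorph_nat.
  by rewrite normcR ?invr_ge0 ?ler0n.
rewrite mulrC ler_pdivrMr//; apply: le_trans (le_normcD _ _) _.
by rewrite mulr_natr mulr2n lerD.
Qed.

Lemma mid_fbound (I : finType) S T (X : I -> I -> H -> H) c : 0 <= c ->
  fbound (fun i j => S (X i j)) c -> fbound (fun i j => T (X i j)) c ->
  fbound (fun i j => mid S T (X i j)) c.
Proof.
move=> c0 hS hT x y.
have -> : opform (fun i j => mid S T (X i j)) x y =
    2^-1 * (opform (fun i j => S (X i j)) x y + opform (fun i j => T (X i j)) x y).
  rewrite /opform -big_split mulr_sumr; apply: eq_bigr => i _.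
  rewrite -big_split mulr_sumr; apply: eq_bigr => j _.
  by rewrite /mid !fctE dotZl dotDl.
pose K := c ^+ 2 * (sqn x * sqn y).
have K0 : 0 <= K by rewrite mulr_ge0 ?sqr_ge0// mulr_ge0 ?sqn_ge0.
(* The square is removed because the averaging estimate [half_normc] concerns absolute values. *)
have sq (z : R[i]) : normc z ^+ 2 <= K <-> normc z <= Num.sqrt K.
  by rewrite -[X in _ <= X <-> _](sqr_sqrtr K0) ler_sqr ?nnegrE ?normc_ge0 ?sqrtr_ge0.
by apply/sq/half_normc; apply/sq; [exact: hS|exact: hT].
Qed.
End Semigroup.

(** * Hamana's minimality argument *)

Section MinimalIdempotent.
Context {R : realType} {H : hilbertType R}.
Local Notation BH := (@bounded_op R H).
Variables (N : set (H -> H)) (Psi : (H -> H) -> (H -> H)).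
Hypotheses (Nb : N `<=` BH) (uPsi : ucp BH Psi) (PsiN : forall m, N m -> Psi m = m).

Let uBH := @bounded_selfadjoint_unital R H.

(** Fixing [N] will make the induced representation a C*-cover; domination in all matrix norms will
    carry the final estimate back to [Psi]. Both survive averages, limits, and composition on the
    left with ucp maps fixing [N]. *)
Definition dominated (T : (H -> H) -> (H -> H)) :=
  [/\ ucp BH T, forall m, N m -> T m = m &
      forall (I : finType) (X : I -> I -> H -> H) (c : R), 0 <= c -> (forall i j, BH (X i j)) ->
        fbound (fun i j => Psi (X i j)) c -> fbound (fun i j => T (X i j)) c].

(** The preorder of the seminorms [x |-> |T x|], with [T] below [S]. *)
Definition opnorm_le_on (S T : (H -> H) -> (H -> H)) :=
  forall x, BH x -> opnorm (T x) <= opnorm (S x).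

(** The tails of the chain form a filter base; along a finer ultrafilter the matrix coefficients
    converge, and [kernel_ucp] assembles the limits. Positivity, fixed points and norm bounds are
    closed conditions. *)
Lemma dominated_limit (C : set ((H -> H) -> (H -> H))) : C !=set0 -> C `<=` dominated ->
  total_on C opnorm_le_on -> exists2 T, dominated T & forall S, C S -> opnorm_le_on S T.
Proof.
move=> [T0 CT0] Cd Ct.
pose base S := [set T | C T /\ opnorm_le_on S T].
pose F := filter_from C base.
have lexx S : opnorm_le_on S S by move=> x.
have trans S T W : opnorm_le_on S T -> opnorm_le_on T W -> opnorm_le_on S W.
  by move=> h1 h2 x bx; exact: le_trans (h2 x bx) (h1 x bx).
have FP : ProperFilter F.
  apply: filter_from_proper; last by move=> S CS; exists S; split.
  apply: filter_from_filter; first by exists T0.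
  move=> S T CS CT; have [ST|TS] := Ct _ _ CS CT.
    by exists T => // W [CW TW]; split; split=> //; exact: trans TW.
  by exists S => // W [CW SW]; split; split=> //; exact: trans SW.
have [U [UF FU]] := ultraFilterLemma FP.
have UC : U C by apply: FU; exists T0 => // S [].
(* Outside [C] the family is replaced by the identity map, so that all its members are ucp. *)
pose t (S : (H -> H) -> (H -> H)) := if `[< C S >] then S else id.
have tu S : ucp BH (t S).
  rewrite /t; case: asboolP => [CS|_]; first by have [] := Cd _ CS.
  split; [by move=> X|by move=> a X Y|by []|move=> m X bX X0].
  by rewrite (_ : map_mx _ X = X)//; apply/matrixP => i j; rewrite mxE.
have UtC (P : set ((H -> H) -> (H -> H))) : (forall S, C S -> P (t S)) -> U [set S | P (t S)].
  by move=> h; apply: filterS UC => S /h.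
have tE S : C S -> t S = S by rewrite /t => CS; rewrite asboolT.
have tb S X x y : BH X -> normc (hdot (t S X x) y) <= opnorm X * rnorm x * rnorm y.
  move=> bX; apply: le_trans (dot_CS _ _) _; rewrite ler_wpM2r ?rnorm_ge0//.
  exact: (ucp_opbound uBH (tu S) (opnorm_ge0 bX) bX (opnorm_bound bX)).
have /choice[k hk] (p : (H -> H) * H * H) : exists l, BH p.1.1 ->
    ulim U (fun S => hdot (t S p.1.1 p.1.2) p.2) l.
  have [bX|n] := pselect (BH p.1.1); last by exists 0.
  have [l hl] := ulim_exists UF (fun S => tb S _ p.1.2 p.2 bX).
  by exists l.
have {}hk X x y : BH X -> ulim U (fun S => hdot (t S X x) y) (k (X, x, y)).
  by move=> bX; exact: (hk (X, x, y)).
have [T [uT TE]] : exists T : (H -> H) -> (H -> H), ucp BH T /\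
    forall X x y, BH X -> hdot (T X x) y = k (X, x, y).
  apply: (kernel_ucp (k := fun X x y => k (X, x, y))).
  - move=> I X bX X0 v.
    have h := ulim_sum UF (fun i => ulim_sum UF (fun j => hk _ (v j) (v i) (bX i j))).
    apply: (ulim_ge0 UF _ h) => S.
    by have [_ _ _ /cp_kcp] := tu S; apply.
  - move=> a X Y x y bX bY.
    have := ulimD UF (ulimZ UF a (hk X x y bX)) (hk Y x y bY).
    have := hk _ x y (bounded_op_lin a bX bY).
    rewrite (_ : (fun _ => _) = fun S => a * hdot (t S X x) y + hdot (t S Y x) y).
      exact: (ulim_uniq UF).
    apply/funext => S; have [_ Sl _ _] := tu S.
    by rewrite Sl// fctE dotDl dotZl.
  - move=> x y; have := hk _ x y (@bounded_op_id R H).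
    rewrite (_ : (fun _ => _) = fun=> hdot x y); last first.
      by apply/funext => S; have [_ _ -> _] := tu S.
    by move=> h; apply: (ulim_uniq UF h); exact: ulim_cst.
have Tlim X x y : BH X -> ulim U (fun S => hdot (t S X x) y) (hdot (T X x) y).
  by move=> bX; rewrite TE//; exact: hk.
exists T.
  split=> // [m Nm|I X c c0 bX Xc x y].
    apply/funext => x; apply: dot_inj => y.
    apply/eqP; rewrite -subr_eq0; apply/eqP/eq0_normc/eqP.
    rewrite eq_le normc_ge0 andbT.
    have h := ulimD UF (Tlim _ x y (Nb Nm)) (ulim_cst UF (- hdot (m x) y)).
    apply: (ulim_bound UF _ h) => /=.
    apply: (UtC [set S | normc (hdot (S m x) y - hdot (m x) y) <= 0]) => S CS /=.
    by have [_ Sm _] := Cd _ CS; rewrite tE// Sm// subrr normc0.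
  pose K := c ^+ 2 * (sqn x * sqn y).
  have K0 : 0 <= K by rewrite mulr_ge0 ?sqr_ge0// mulr_ge0 ?sqn_ge0.
  have sq (z : R[i]) : normc z ^+ 2 <= K <-> normc z <= Num.sqrt K.
    by rewrite -[X in _ <= X <-> _](sqr_sqrtr K0) ler_sqr ?nnegrE ?normc_ge0 ?sqrtr_ge0.
  apply/sq.
  have h := ulim_sum UF (fun i => ulim_sum UF (fun j => Tlim _ (x j) (y i) (bX i j))).
  apply: (ulim_bound UF _ h).
  apply: (UtC [set S | normc (opform (fun i j => S (X i j)) x y) <= Num.sqrt K]) => S CS /=.
  by apply/sq; have [_ _ Sc] := Cd _ CS; rewrite tE//; exact: Sc.
move=> S CS X bX.
have [_ _] := Cd _ CS => _.
have Sb V : C V -> BH (V X) by move=> /Cd[[Vb _ _ _] _ _]; exact: Vb.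
apply: opnorm_le; first by apply: opnorm_ge0; exact: Sb.
move=> x; apply: rnorm_le => [|y].
  by rewrite mulr_ge0 ?rnorm_ge0 ?opnorm_ge0//; exact: Sb.
apply: (ulim_bound UF _ (Tlim _ x y bX)).
(* On the tail below [S] all values are bounded by [|S X|]. *)
have US : U (base S) by apply: FU; exists S.
apply: filterS US => V [CV SV] /=; rewrite tE//.
apply: le_trans (dot_CS _ _) _; rewrite ler_wpM2r ?rnorm_ge0//.
apply: le_trans (opnorm_bound (Sb _ CV) x) _.
by rewrite ler_wpM2r ?rnorm_ge0//; exact: SV.
Qed.

Lemma exists_minimal : exists2 F, dominated F &
  forall S, dominated S -> opnorm_le_on F S -> opnorm_le_on S F.
Proof.
pose D := {T | dominated T}.
pose rel (S T : D) : bool := `[< opnorm_le_on (sval S) (sval T) >].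
have dPsi : dominated Psi by split.
have [||C Ct|F hF] := @ZL_preorder D (exist _ Psi dPsi) rel.
- by move=> S; apply/asboolP => x.
- move=> S T W /asboolP h1 /asboolP h2; apply/asboolP => x bx.
  exact: le_trans (h2 x bx) (h1 x bx).
- have [C0|C0] := pselect (C !=set0); last first.
    by exists (exist _ Psi dPsi) => s Cs; case: C0; exists s.
  have [|||T dT hT] := @dominated_limit [set sval s | s in C].
  + by have [s Cs] := C0; exists (sval s), s.
  + by move=> _ [s Cs <-]; exact: svalP.
  + by move=> _ _ [s Cs <-] [s' Cs' <-]; have [/asboolP|/asboolP] := Ct _ _ Cs Cs'; [left|right].
  by exists (exist _ T dT) => s Cs; apply/asboolP/hT; exists s.
exists (sval F); first exact: svalP.
move=> S dS FS; have /asboolP : rel (exist _ S dS) F by apply: hF; apply/asboolP.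
by [].
Qed.

Lemma dominated_comp S T : ucp BH S -> (forall m, N m -> S m = m) -> dominated T ->
  dominated (S \o T).
Proof.
move=> uS SN [uT TN Tc]; split; first by apply: ucp_comp (uT) uS; case: uT.
  by move=> m Nm; rewrite /= TN// SN.
move=> I X c c0 bX Xc; apply: (ucp_fbound uBH uS c0); last exact: Tc.
by have [Tb _ _ _] := uT => i j; exact: Tb.
Qed.

Lemma dominated_mid S T : dominated S -> dominated T -> dominated (mid S T).
Proof.
move=> [uS SN Sc] [uT TN Tc]; split; first exact: mid_ucp.
  move=> m Nm; apply/funext => x; apply: dot_inj => z.
  by rewrite /mid SN// TN// !fctE !(dotZl, dotDl); field.
by move=> I X c c0 bX Xc; apply: mid_fbound; [|exact: Sc|exact: Tc].
Qed.

(* The averages [A_n = 2^-n (F + ... + F^(2^n))] satisfy [A_n (x - F x) -> 0],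
   while minimality of [F] forces [|F y| <= |A_n y|]. *)
Lemma minimal_idempotent : exists2 F, dominated F & forall x, BH x -> F (F x) = F x.
Proof.
have [F dF Fmin] := exists_minimal; exists F => // x bx.
have [uF FN Fc] := dF; have [Fb Fl _ _] := uF.
(* [A n.+1] averages [A n] and [F^(2^n) A n], which doubles the number of powers. *)
pose A n := iteri n (fun k S => mid S (iter (2 ^ k) F \o S)) F.
have uFi k : ucp BH (iter k F) by exact: ucp_iter.
have FiN k m : N m -> iter k F m = m.
  by move=> Nm; elim: k => // k IH; rewrite iterS IH FN.
have dA n : dominated (A n).
  elim: n => // n IH; apply: dominated_mid => //.
  by apply: dominated_comp => // m; exact: FiN.
have bA n z : BH z -> BH (A n z) by move=> bz; have [[Ab _ _ _] _ _] := dA n; exact: Ab.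
(* Powers of [F] are contractive, so every [A n] lies below [F], and minimality of [F] reverses the
   comparison. *)
have AF n : opnorm_le_on F (A n).
  move=> z bz; apply: opnorm_le; first exact/opnorm_ge0/Fb.
  elim: n => [|n IH]; first exact/opnorm_bound/Fb.
  apply/fbound1; first exact/opnorm_ge0/Fb.
  apply: (mid_fbound (X := fun _ _ : unit => z)); first exact/opnorm_ge0/Fb.
    by apply/fbound1 => //; exact/opnorm_ge0/Fb.
  apply/fbound1; first exact/opnorm_ge0/Fb.
  exact: (ucp_opbound uBH (uFi _) (opnorm_ge0 (Fb _ bz)) (bA n _ bz) IH).
pose y := x - F x.
have by_ : BH y by apply: op_subspaceB => //; [exact: bounded_op_subspace|exact: Fb].
have FB k u v : BH u -> BH v -> iter k F (u - v) = iter k F u - iter k F v.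
  move=> bu bv; have [_ kl _ _] := uFi k.
  by rewrite addrC -scaleN1r kl// scaleN1r addrC.
(* The average of powers telescopes on [x - F x]. *)
have Ay n : A n y = (2^-1 ^+ n : R)%:C *: (F x - iter (2 ^ n) F (F x)).
  elim: n => [|n IH]; first by have /= e1 := FB 1%N x (F x) bx (Fb _ bx); rewrite expr0 scale1r; exact: e1.
  rewrite -[LHS]/(mid (A n) (iter (2 ^ n) F \o A n) y) /mid /= IH.
  have [_ kl _ _] := uFi (2 ^ n)%N.
  have bF1 : BH (F x) by exact: Fb.
  have bFn : BH (iter (2 ^ n) F (F x)) by have [kb _ _ _] := uFi (2 ^ n)%N; exact: kb.
  have bB : BH (F x - iter (2 ^ n) F (F x)).
    by apply: op_subspaceB => //; exact: bounded_op_subspace.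
  rewrite (linear_onZ _ (@bounded_op_subspace R H) kl bB) FB// -iterD addnn -mul2n -expnS.
  apply/funext => z; apply: dot_inj => w; rewrite !fctE !(dotZl, dotDl, dotNl).
  by rewrite exprS rmorphM/= fmorphV rmorph_nat; ring.
have Fy0 : opnorm (F y) = 0.
  apply/eqP; rewrite eq_le opnorm_ge0 ?andbT; last exact: Fb.
  apply/ler_addgt0Pr => e e0; rewrite add0r.
  pose c := opnorm (F x) + opnorm (F x).
  have o0 : 0 <= opnorm (F x) by exact/opnorm_ge0/Fb.
  have c1 : 0 < c + 1 by rewrite ltr_wpDl// addr_ge0.
  have r01 : 0 <= (2^-1 : R) < 1 by rewrite invr_ge0 ler0n/= invf_lt1 ?ltr1n.
  have [n /(_ n (leqnn n)) hn] := expr_small r01 (divr_gt0 e0 c1).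
  apply: le_trans (Fmin _ (dA n) (AF n) _ by_) _; rewrite Ay.
  have p0 : 0 <= (2^-1 : R) ^+ n by rewrite exprn_ge0 ?invr_ge0.
  apply: opnorm_le; first exact: ltW.
  move=> z; rewrite fctE rnormZ normcR//.
  have h : rnorm ((F x - iter (2 ^ n) F (F x)) z) <= (c + 1) * rnorm z.
    rewrite !fctE; apply: le_trans (rnormD _ _) _; rewrite rnormN.
    apply: (@le_trans _ _ (c * rnorm z)); last by rewrite ler_wpM2r ?rnorm_ge0// lerDl.
    rewrite /c mulrDl lerD//; first exact/opnorm_bound/Fb.
    exact: (ucp_opbound uBH (uFi _) o0 (Fb _ bx) (opnorm_bound (Fb _ bx))).
  apply: le_trans (ler_pM _ _ hn h) _ => //; first exact: rnorm_ge0.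
  by rewrite mulrA mulfVK// gt_eqF.
have Fy : F y = 0.
  apply/funext => z; apply/rnorm0_eq0/eqP; rewrite eq_le rnorm_ge0 andbT.
  by have := opnorm_bound (Fb _ by_) z; rewrite Fy0 mul0r.
have /eqP := FB 1%N x (F x) bx (Fb _ bx); rewrite /= Fy.
by rewrite eq_sym subr_eq0 => /eqP.
Qed.
End MinimalIdempotent.

(** * The Choi-Effros product *)

Section ChoiEffros.
Context {R : realType} {H : hilbertType R}.
Local Notation BH := (@bounded_op R H).
Variable F : (H -> H) -> (H -> H).
Hypothesis uF : ucp BH F.

Let uBH := @bounded_selfadjoint_unital R H.
Let sBH := @bounded_op_subspace R H.
Let Fb : set_fun BH BH F. Proof. by case: uF. Qed.
Let Fl : linear_on BH F. Proof. by case: uF. Qed.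
Let FB S T : BH S -> BH T -> F (S - T) = F S - F T.
Proof. by move=> bS bT; rewrite addrC -scaleN1r Fl// scaleN1r addrC. Qed.
Let Fadj T : BH T -> F (adj T) = adj (F T). Proof. exact: ucp_adj uBH uF. Qed.
Let bcomp := @bounded_op_comp R H.
Let badj := @adj_bounded R H.

(** The block matrix of [adj w_i \o w_j], [adj w_i], [w_j] and [1] is a Gram matrix; its image under
    [F] is tested with the last coordinate [u] chosen to complete the square. *)
Lemma schwarz_family (I : finType) (w : I -> H -> H) : (forall i, BH (w i)) ->
  fam_ge0 (fun i j => F (adj (w i) \o w j) - (adj (F (w i)) \o F (w j))).
Proof.
move=> bw x; pose u := - \sum_j F (w j) (x j).
pose B := blk (fun i j => adj (w i) \o w j) (fun i (_ : unit) => adj (w i)) (fun (_ : unit) j => w j)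
  (fun _ _ => id).
have bB s t : BH (B s t).
  by case: s t => [i|[]] [j|[]] /=; [apply: bcomp => //; exact: badj|exact: badj|exact: bw|exact: bounded_op_id].
have B0 : fam_ge0 B.
  move=> v; pose G s t (T : H -> H) := hdot (T (v t)) (v s).
  change (0 <= \sum_s \sum_t G s t (B s t)).
  rewrite /B sum_blk {}/G !sum_unit.
  under [X in _ + X + _]eq_bigr do rewrite sum_unit.
  set p := \sum_i w i (v (inl i)); set q := v (inr tt).
  have e1 : \sum_i \sum_j hdot ((adj (w i) \o w j) (v (inl j))) (v (inl i)) = hdot p p.
    rewrite /p dot_sumr; apply: eq_bigr => i _; rewrite dot_suml.
    by apply: eq_bigr => j _; rewrite /= adj_dotl.
  have e2 : \sum_i hdot (adj (w i) q) (v (inl i)) = hdot q p.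
    by rewrite /p dot_sumr; apply: eq_bigr => i _; rewrite adj_dotl.
  have e3 : \sum_i hdot (w i (v (inl i))) q = hdot p q by rewrite /p dot_suml.
  have h : 0 <= hdot (p + q) (p + q) by rewrite dotxx ler0c sqr_ge0.
  apply: le_trans h _; rewrite e1 e2 e3 !(dotDl, dotDr) le_eqVlt; apply/orP; left.
  by apply/eqP; ring.
have [_ _ F1 /cp_kcp Fp] := uF.
have := Fp _ _ bB B0 (fun s => if s is inl i then x i else u).
pose G (s t : I + unit) (T : H -> H) := hdot (F T (if t is inl i then x i else u)) (if s is inl i then x i else u).
move=> h; have {h} : 0 <= \sum_s \sum_t G s t (B s t) := h.
rewrite /B sum_blk {}/G !sum_unit F1.
under [X in _ + X + _]eq_bigr do rewrite sum_unit.
have e1 : \sum_j hdot (F (w j) (x j)) u = - hdot u u.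
  by rewrite -dot_suml -dotNl /u opprK.
have e2 : \sum_i hdot (F (adj (w i)) u) (x i) = - hdot u u.
  rewrite -dotNr [in RHS]/u opprK dot_sumr; apply: eq_bigr => i _.
  by rewrite Fadj// adj_dotl//; exact: Fb.
rewrite e1 e2 addNr addr0 => h.
rewrite /opform; move: h; congr (_ <= _).
have -> : hdot u u = \sum_i \sum_j hdot ((adj (F (w i)) \o F (w j)) (x j)) (x i).
  rewrite /u dotNl dotNr opprK dot_sumr; apply: eq_bigr => i _; rewrite dot_suml.
  by apply: eq_bigr => j _; rewrite /= adj_dotl//; exact: Fb.
rewrite -sumrB; apply: eq_bigr => i _; rewrite -sumrB; apply: eq_bigr => j _.
by rewrite -dotBl.
Qed.

Hypothesis FF : forall x, BH x -> F (F x) = F x.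

(** Let [D] be the Schwarz defect of the pair [a], [adj x]. Idempotency and [F a = a] make [F]
    vanish on its diagonal entry at [a], and a positive matrix with a zero diagonal entry is zero
    off the diagonal there. The off-diagonal entry is [F (F (x a) - (F x) a)]. *)
Lemma idempotent_right a x : BH a -> F a = a -> BH x -> F (x \o a) = F (F x \o a).
Proof.
move=> ba Fa bx.
pose w (b : bool) := if b then a else adj x.
have bw b : BH (w b) by case: b => //; exact: badj.
pose D i j := F (adj (w i) \o w j) - (adj (F (w i)) \o F (w j)).
have D0 : fam_ge0 D := schwarz_family bw.
have bD i j : BH (D i j).
  apply: op_subspaceB => //; first by apply/Fb/bcomp => //; exact: badj.
  by apply: bcomp; [exact/badj/Fb|exact: Fb].
have FD : fam_ge0 (fun i j => F (D i j)).
  by have [_ _ _ /cp_kcp Fp] := uF; exact: Fp _ _ bD D0.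
have lD i j : linear (F (D i j)) := bounded_linear (Fb (bD i j)).
have baa : BH (adj a \o a) by apply: bcomp => //; exact: badj.
have Dtt : F (D true true) = 0.
  by rewrite /D /w/= Fa FB//; [rewrite FF// subrr|exact: Fb].
have Dft : F (D false true) = 0.
  apply/funext => xi; apply: dot_inj => eta.
  pose p (b : bool) := if b then xi else 0.
  pose q (b : bool) := if b then 0 else eta.
  have [_] := fam_ge0_CS p q lD FD.
  have z0 u v : hdot ((0 : H -> H) u) v = 0 := dot0l v.
  rewrite [X in _ <= Re X * _]/opform !big_bool/= Dtt z0 !dot0r !addr0.
  rewrite (linT0 (lD _ _)) dot0l add0r mul0r.
  rewrite /opform !big_bool/= !dot0r !add0r (linT0 (lD _ _)) dot0l addr0 => h.
  by apply/eq0_normc/eqP; rewrite -sqrf_eq0 eq_le h sqr_ge0.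
have bF1 : BH (F (x \o a)) by apply/Fb/bcomp.
have bF2 : BH (F x \o a) by apply: bcomp => //; exact: Fb.
move: Dft; rewrite /D /w/= Fa Fadj// !adjK//; last exact: Fb.
by rewrite FB// FF; [move/eqP; rewrite subr_eq0 => /eqP|exact: bcomp].
Qed.

Let right z := forall x, BH x -> F (x \o z) = F (F x \o z).

(* This is a C*-algebra containing the range of [F], hence also every C*-algebra
   generated inside that range. *)
Definition absorbing : set (H -> H) := [set z | [/\ BH z, right z & right (adj z)]].

(** [F] commutes with adjoints, which exchange the two sides. *)
Let right_left z x : BH z -> right (adj z) -> BH x -> F (z \o x) = F (z \o F x).
Proof.
move=> bz rz bx; have bzx : BH (z \o x) by exact: bcomp.
have bzFx : BH (z \o F x) by apply: bcomp => //; exact: Fb.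
rewrite -[LHS]adjK; last exact: Fb.
rewrite -Fadj// adj_comp// rz; last exact: badj.
rewrite Fadj// -adj_comp//; last exact: Fb.
by rewrite Fadj// adjK//; exact: Fb.
Qed.

Lemma absorbing_sandwich z w x : absorbing z -> absorbing w -> BH x ->
  F (z \o x \o w) = F (z \o F x \o w).
Proof.
move=> [bz rz rz'] [bw rw rw'] bx.
rewrite -[z \o x \o w]/(z \o (x \o w)) (right_left bz rz'); last exact: bcomp.
rewrite rw// -(right_left bz rz')//; apply: bcomp => //; exact: Fb.
Qed.

Lemma absorbing_fixed a : BH a -> F a = a -> absorbing a.
Proof.
move=> ba Fa; split=> // x bx; first exact: idempotent_right.
by apply: idempotent_right => //; [exact: badj|rewrite Fadj// Fa].
Qed.

Let right_lin c S T : BH S -> BH T -> right S -> right T -> right (c *: S + T).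
Proof.
move=> bS bT rS rT x bx.
have cE y : BH y -> y \o (c *: S + T) = c *: (y \o S) + (y \o T).
  by move=> by_; apply/funext => u; rewrite /= !fctE (bounded_linear by_).
have bFx := Fb bx.
rewrite (cE x bx) (cE (F x) bFx) (Fl c (bcomp bx bS) (bcomp bx bT)).
by rewrite (Fl c (bcomp bFx bS) (bcomp bFx bT)) (rS x bx) (rT x bx).
Qed.

Let right_closed T : BH T ->
  (forall e : R, 0 < e -> exists2 S, (BH S /\ right S) & opbound (T - S) e) -> right T.
Proof.
move=> bT h x bx; apply/funext => u; apply/eqP; rewrite -subr_eq0; apply/eqP/rnorm0_eq0/eqP.
rewrite eq_le rnorm_ge0 andbT; apply/ler_addgt0Pr => e e0; rewrite add0r.
have o0 := opnorm_ge0 bx.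
(* Two error terms of size at most [|x| (e / c) |u|] occur; the [+ 1] keeps [c] positive. *)
pose c := 2 * opnorm x * rnorm u + 1.
have c0 : 0 < c by rewrite ltr_wpDl// !mulr_ge0// rnorm_ge0.
have d0 := divr_gt0 e0 c0.
have [S [bS rS] TS] := h _ d0.
have bTS : BH (T - S) by exact: op_subspaceB.
have key y : BH y -> opbound y (opnorm x) ->
    opbound (F (y \o (T - S))) (opnorm x * (e / c)).
  move=> by_ yx; apply: ucp_opbound uBH uF _ _ _; [by rewrite mulr_ge0// ltW|exact: bcomp|].
  move=> v; apply: le_trans (yx _) _; rewrite -mulrA ler_wpM2l//; exact: TS.
have bFx := Fb bx.
have cE y : BH y -> F (y \o T) u = F (y \o (T - S)) u + F (y \o S) u.
  move=> by_; have -> : y \o (T - S) = (y \o T) - (y \o S).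
    by apply/funext => v; rewrite !fctE/= (linTB (bounded_linear by_)).
  by rewrite FB; [rewrite !fctE addrNK|exact: bcomp|exact: bcomp].
rewrite !cE// rS// opprD addrACA subrr addr0.
apply: le_trans (rnormD _ _) _; rewrite rnormN.
have k1 := key x bx (opnorm_bound bx) u.
have k2 := key (F x) bFx (ucp_opbound uBH uF o0 bx (opnorm_bound bx)) u.
apply: le_trans (lerD k1 k2) _.
have -> : opnorm x * (e / c) * rnorm u + opnorm x * (e / c) * rnorm u =
    e / c * (2 * opnorm x * rnorm u) by ring.
by rewrite mulrAC ler_pdivrMr// ler_wpM2l ?ltW// /c ltrDl.
Qed.

Lemma absorbing_Cstar : Cstar_subalgebra absorbing.
Proof.
have b0 := @bounded_op0 R H.
have adj0 : adj (0 : H -> H) = 0.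
  by apply: adj_eq => // x y; rewrite dot0r -[LHS]/(hdot (0 : H) _) dot0l.
have r0 : right 0.
  move=> x bx; have z y : BH y -> y \o (0 : H -> H) = 0.
    by move=> by_; apply/funext => u; exact: linT0 (bounded_linear by_).
  by rewrite !z//; exact: Fb.
split.
- split; first by move=> z [].
    by split=> //; rewrite adj0.
  move=> a S T [bS rS rS'] [bT rT rT']; split; first exact: bounded_op_lin.
    exact: right_lin.
  by rewrite adj_lin//; apply: right_lin => //; exact: badj.
- have rM S T : BH S -> BH T -> right S -> right T -> right (S \o T).
    move=> bS bT rS rT x bx.
    rewrite -[x \o (S \o T)]/((x \o S) \o T) rT; last exact: bcomp.
    rewrite rS// -rT//; apply: bcomp => //; exact: Fb.
  move=> S T [bS rS rS'] [bT rT rT']; split; [exact: bcomp|exact: rM|].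
  by rewrite adj_comp//; apply: rM => //; exact: badj.
- move=> S T [bT rT rT'] aS; have <- : adj T = S by apply: adj_eq.
  by split=> //; [exact: badj|rewrite adjK].
- move=> T bT hT; split=> //; apply: right_closed => //; try exact: badj.
    move=> e e0; have [S [bS rS _] TS] := hT e e0; exists S => // x.
    have bTS : BH (T - S) by exact: op_subspaceB.
    apply: le_trans (opnorm_bound bTS x) _.
    by rewrite ler_wpM2r ?rnorm_ge0// ltW.
  move=> e e0; have [S [bS _ rS] TS] := hT e e0; exists (adj S).
    by split=> //; exact: badj.
  have bTS : BH (T - S) by exact: op_subspaceB.
  move=> x; have -> : adj T - adj S = adj (T - S).
    have -> : T - S = (-1) *: S + T by rewrite scaleN1r addrC.
    by rewrite adj_lin// conjcN conjc1 scaleN1r addrC.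
  apply: le_trans (opnorm_adj bTS x) _.
  by rewrite ler_wpM2r ?rnorm_ge0// ltW.
Qed.
End ChoiEffros.

(** * Hilbert space of a positive kernel *)

(** Cauchy sequences come with a bound only from some index on, so the bound is asked on a set of
    [U]; elsewhere the values are replaced by [0]. *)
Lemma ulim_exists_near (R : realType) (T : Type) (U : set_system T) (UF : UltraFilter U)
    (g : T -> R[i]) (c : R) : 0 <= c -> U [set t | normc (g t) <= c] -> exists l, ulim U g l.
Proof.
move=> c0 gc; pose g' t := if normc (g t) <= c then g t else 0.
have [t|l hl] := @ulim_exists R T U UF g' c.
  by rewrite /g'; case: ifP => // _; rewrite normc0.
exists l => e e0; apply: filterS (filterI gc (hl _ e0)) => t /= [h].
by rewrite /g' h.
Qed.

Lemma nat_ultrafilter : exists U : set_system nat, UltraFilter U /\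
  forall N, U [set n | (N <= n)%N].
Proof.
have [U [UF FU]] := ultraFilterLemma (_ : ProperFilter \oo).
by exists U; split=> // N; apply: FU; exists N.
Qed.

Section Combinations.
Context {R : realType} {K0 : Type}.
Local Notation C := (R[i]).
Variable kap : K0 -> K0 -> C.
Local Notation comb := (seq (C * K0)).
Implicit Types (p r s : comb).

(* A list of pairs is a formal combination of points of [K0]; [ev p] is the
   function [b |-> <p, b>] that it represents. *)
Definition ev p (b : K0) : C := \sum_(u <- p) u.1 * kap u.2 b.
Definition qf p r : C := \sum_(w <- r) (w.1)^*%C * ev p w.2.
Definition lc (a : C) p r : comb := [seq (a * u.1, u.2) | u <- p] ++ r.

Lemma ev_lc a p r b : ev (lc a p r) b = a * ev p b + ev r b.
Proof.
rewrite /ev big_cat big_map mulr_sumr; congr (_ + _).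
by apply: eq_bigr => u _; rewrite mulrA.
Qed.

Lemma qf_lcl a p r s : qf (lc a p r) s = a * qf p s + qf r s.
Proof.
rewrite /qf mulr_sumr -big_split; apply: eq_bigr => u _ /=.
by rewrite ev_lc; ring.
Qed.

Lemma qf_lcr a p r s : qf s (lc a p r) = a^*%C * qf s p + qf s r.
Proof.
rewrite /qf big_cat big_map mulr_sumr; congr (_ + _).
by apply: eq_bigr => u _; rewrite /= conjcM mulrA.
Qed.

Hypothesis qf_ge0 : forall p, 0 <= qf p p.

Definition nq p : R := Re (qf p p).

Lemma nq_ge0 p : 0 <= nq p.
Proof. by rewrite -ler0c /nq RRe_real ?ger0_real. Qed.

Lemma qfE p : qf p p = (nq p)%:C.
Proof. by rewrite /nq RRe_real ?ger0_real. Qed.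

Lemma qf_CS p r : qf r p = (qf p r)^*%C /\ normc (qf p r) ^+ 2 <= nq p * nq r.
Proof.
rewrite mulrC; apply: quad_ge0 => z; apply: le_trans (qf_ge0 (lc z p r)) _.
rewrite qf_lcl !qf_lcr le_eqVlt; apply/orP; left; apply/eqP; ring.
Qed.

Definition nm p : R := Num.sqrt (nq p).

Lemma nm_ge0 p : 0 <= nm p. Proof. exact: sqrtr_ge0. Qed.

Lemma nm2 p : nm p ^+ 2 = nq p. Proof. by rewrite sqr_sqrtr// nq_ge0. Qed.

Lemma qf_le p r : normc (qf p r) <= nm p * nm r.
Proof.
rewrite -ler_sqr ?nnegrE ?normc_ge0 ?mulr_ge0 ?nm_ge0// exprMn !nm2.
by have [] := qf_CS p r.
Qed.

Lemma nm_lc a p r : nm (lc a p r) <= normc a * nm p + nm r.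
Proof.
rewrite -ler_sqr ?nnegrE ?addr_ge0 ?mulr_ge0 ?normc_ge0 ?nm_ge0// nm2 /nq.
rewrite qf_lcl !qf_lcr; have [-> _] := qf_CS p r; rewrite !qfE sqrrD exprMn !nm2.
have h := le_trans (Re_le_normc (a * qf p r)) _.
have {}h : Re (a * qf p r) <= normc a * nm p * nm r.
  by apply: h; rewrite normcM -mulrA ler_wpM2l ?normc_ge0// qf_le.
have -> : a * (a^*%C * (nq p)%:C + qf p r) + (a^*%C * (qf p r)^*%C + (nq r)%:C) =
   (a * a^*%C) * (nq p)%:C + (a * qf p r + (a * qf p r)^*%C) + (nq r)%:C.
  by rewrite conjcM; ring.
rewrite mulcJ -rmorphM; move: h; set z := a * qf p r => h.
have -> : Re ((normc a ^+ 2 * nq p)%:C + (z + z^*%C) + (nq r)%:C) =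
    normc a ^+ 2 * nq p + 2 * Re z + nq r by case: z {h} => x y /=; ring.
by lra.
Qed.

Lemma ev_le p b : normc (ev p b) <= nm p * nm [:: (1, b)].
Proof.
have -> : ev p b = qf p [:: (1, b)] by rewrite /qf big_seq1 conjc1 mul1r.
exact: qf_le.
Qed.

Definition sub p r := lc (-1) r p.

Lemma ev_sub p r b : ev (sub p r) b = ev p b - ev r b.
Proof. by rewrite /sub ev_lc; ring. Qed.

Lemma qf_subl p r s : qf (sub p r) s = qf p s - qf r s.
Proof. by rewrite /sub qf_lcl; ring. Qed.

Lemma qf_subr p r s : qf s (sub p r) = qf s p - qf s r.
Proof. by rewrite /sub qf_lcr conjcN conjc1; ring. Qed.

Lemma nm_le_sub p r : nm p <= nm (sub p r) + nm r.
Proof.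
have e : nm p = nm (lc 1 (sub p r) r).
  by rewrite /nm /nq qf_lcl !qf_lcr !(qf_subl, qf_subr) conjc1; congr (Num.sqrt (Re _)); ring.
by rewrite [leLHS]e; apply: le_trans (nm_lc _ _ _) _; rewrite normc1 mul1r.
Qed.

Definition cau (u : nat -> comb) := forall e : R, 0 < e -> exists N, forall n m,
  (N <= n)%N -> (N <= m)%N -> nm (sub (u n) (u m)) <= e.

Lemma cau_lc a u v : cau u -> cau v -> cau (fun n => lc a (u n) (v n)).
Proof.
move=> cu cv e e0; have a0 : 0 < normc a + 1 by rewrite ltr_wpDl ?normc_ge0.
have e2 : 0 < e / 2 by rewrite divr_gt0.
have [N1 h1] := cu _ (divr_gt0 e2 a0); have [N2 h2] := cv _ e2.
exists (maxn N1 N2) => n m; rewrite !geq_max => /andP[n1 n2] /andP[m1 m2].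
have -> : nm (sub (lc a (u n) (v n)) (lc a (u m) (v m))) =
    nm (lc a (sub (u n) (u m)) (sub (v n) (v m))).
  by rewrite /nm /nq !(qf_subl, qf_subr, qf_lcl, qf_lcr); congr (Num.sqrt (Re _)); ring.
apply: le_trans (nm_lc _ _ _) _; rewrite [leRHS]splitr lerD ?h2//.
apply: (@le_trans _ _ ((normc a + 1) * (e / 2 / (normc a + 1)))).
  by apply: ler_pM; rewrite ?normc_ge0 ?nm_ge0 ?lerDl// h1.
by rewrite mulrC divfK// gt_eqF.
Qed.

Lemma cau_cst p : cau (fun=> p).
Proof.
move=> e e0; exists 0%N => n m _ _.
by rewrite /nm /nq !(qf_subl, qf_subr) !subrr ?subr0 raddf0 sqrtr0 ltW.
Qed.

Variables (U : set_system nat) (UF : UltraFilter U) (UN : forall N, U [set n | (N <= n)%N]).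

Lemma cau_bounded u : cau u -> exists c, 0 <= c /\ U [set n | nm (u n) <= c].
Proof.
move=> /(_ 1 ltr01)[N hN]; exists (1 + nm (u N)); split; first by rewrite addr_ge0 ?nm_ge0.
apply: filterS (UN N) => n /= Nn; apply: le_trans (nm_le_sub _ (u N)) _.
by rewrite lerD2r hN.
Qed.

(* Ultrafilter limits stand in for limits along [\oo] because every bounded
   sequence has one. *)
Definition rep (u : nat -> comb) (f : K0 -> C) := cau u /\ forall b, ulim U (fun n => ev (u n) b) (f b).

Lemma cau_rep u : cau u -> exists f, rep u f.
Proof.
move=> cu; have [c [c0 hc]] := cau_bounded cu.
have /choice[f hf] b : exists l, ulim U (fun n => ev (u n) b) l.
  apply: (@ulim_exists_near _ _ _ UF _ (c * nm [:: (1, b)])); first by rewrite mulr_ge0 ?nm_ge0.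
  apply: filterS hc => n /= h; apply: le_trans (ev_le _ _) _.
  by rewrite ler_wpM2r ?nm_ge0.
by exists f.
Qed.

Lemma rep_cst p : rep (fun=> p) (ev p).
Proof. by split=> [|b]; [exact: cau_cst|exact: (ulim_cst UF)]. Qed.

Lemma rep_lc a u v f g : rep u f -> rep v g ->
  rep (fun n => lc a (u n) (v n)) (fun b => a * f b + g b).
Proof.
move=> [cu uf] [cv vg]; split=> [|b]; first exact: cau_lc.
rewrite (_ : (fun _ => _) = fun n => a * ev (u n) b + ev (v n) b).
  exact: (ulimD UF (ulimZ UF a (uf b)) (vg b)).
by apply/funext => n; rewrite ev_lc.
Qed.

(** In [|u_n|^2 = <u_n, u_n - u_N> + <u_n, u_N>] the first term is small by the Cauchy property, and
    the second tends to [0] since pairing with the fixed [u_N] is a finite combination of point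
    values. Independence of the inner product from representatives rests on this. *)
Lemma rep_null u : rep u (fun=> 0) -> forall e : R, 0 < e -> U [set n | nm (u n) <= e].
Proof.
move=> [cu u0] e e0; have [c [c0 hc]] := cau_bounded cu.
have c1 : 0 < c + 1 by rewrite ltr_wpDl.
(* With this [d] the two terms add up to [c d + d = e^2]. *)
have d0 : 0 < e ^+ 2 / (c + 1) by rewrite divr_gt0 ?exprn_gt0.
have [N hN] := cu _ d0.
have h : ulim U (fun n => qf (u n) (u N)) 0.
  rewrite (_ : 0 = \sum_(w <- u N) (w.1)^*%C * 0); last by rewrite big1// => *; rewrite mulr0.
  rewrite /qf; elim: (u N) => [|w s IH].
    rewrite big_nil (_ : (fun _ => _) = fun=> 0); first exact: (ulim_cst UF).
    by apply/funext => n; rewrite big_nil.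
  rewrite big_cons (_ : (fun _ => _) = fun n => (w.1)^*%C * ev (u n) w.2 +
     \sum_(j <- s) (j.1)^*%C * ev (u n) j.2).
    by apply: (ulimD UF) IH; apply: (ulimZ UF); exact: u0.
  by apply/funext => n; rewrite big_cons.
apply: filterS (filterI hc (filterI (UN N) (h _ d0))) => n /= [nc [Nn]].
rewrite subr0 => hq.
rewrite -ler_sqr ?nnegrE ?nm_ge0 ?(ltW e0)// nm2.
have -> : nq (u n) = Re (qf (u n) (sub (u n) (u N)) + qf (u n) (u N)).
  by rewrite qf_subr addrNK.
apply: le_trans (Re_le_normc _) _; apply: le_trans (le_normcD _ _) _.
have k1 : normc (qf (u n) (sub (u n) (u N))) <= c * (e ^+ 2 / (c + 1)).
  by apply: le_trans (qf_le _ _) _; apply: ler_pM; rewrite ?nm_ge0// hN.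
apply: le_trans (lerD k1 hq) _.
rewrite -{2}[e ^+ 2 / (c + 1)]mul1r -mulrDl mulrC divfK// gt_eqF//.
Qed.

Lemma rep_inner u v f g : rep u f -> rep v g -> exists l, ulim U (fun n => qf (u n) (v n)) l.
Proof.
move=> [cu _] [cv _]; have [c [c0 hc]] := cau_bounded cu; have [d [d0 hd]] := cau_bounded cv.
apply: (@ulim_exists_near _ _ _ UF _ (c * d)); first exact: mulr_ge0.
apply: filterS (filterI hc hd) => n /= [h1 h2]; apply: le_trans (qf_le _ _) _.
by apply: ler_pM; rewrite ?nm_ge0.
Qed.

Lemma rep_inner_left u u' v f g l : rep u f -> rep u' f -> rep v g ->
  ulim U (fun n => qf (u n) (v n)) l -> ulim U (fun n => qf (u' n) (v n)) l.
Proof.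
move=> ru ru' [cv _] hl.
have r0 : rep (fun n => sub (u' n) (u n)) (fun=> 0).
  have := rep_lc (-1) ru ru'; congr (rep _ _); apply/funext => b.
  by rewrite mulN1r addNr.
have [c [c0 hc]] := cau_bounded cv.
have z : ulim U (fun n => qf (sub (u' n) (u n)) (v n)) 0.
  move=> e e0; have c1 : 0 < c + 1 by rewrite ltr_wpDl.
  apply: filterS (filterI hc (rep_null r0 (divr_gt0 e0 c1))) => n /= [h1 h2].
  rewrite subr0; apply: le_trans (qf_le _ _) _.
  apply: (@le_trans _ _ (e / (c + 1) * (c + 1))); last by rewrite divfK// gt_eqF.
  by apply: ler_pM; rewrite ?nm_ge0//; apply: le_trans h1 _; rewrite lerDl.
have := ulimD UF hl z; rewrite addr0; congr (ulim _ _ _); apply/funext => n.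
by rewrite qf_subl addrC subrK.
Qed.

Lemma ulim_conj (g : nat -> C) l : ulim U g l -> ulim U (fun n => (g n)^*%C) l^*%C.
Proof.
move=> h e e0; apply: filterS (h _ e0) => n /=.
by rewrite -conjcB normcJ'.
Qed.

Lemma rep_inner_eq u u' v v' f g l : rep u f -> rep u' f -> rep v g -> rep v' g ->
  ulim U (fun n => qf (u n) (v n)) l -> ulim U (fun n => qf (u' n) (v' n)) l.
Proof.
move=> ru ru' rv rv' /(rep_inner_left ru ru' rv) /ulim_conj h.
have e (p q : nat -> comb) : (fun n => (qf (p n) (q n))^*%C) = fun n => qf (q n) (p n).
  by apply/funext => n; have [->] := qf_CS (p n) (q n).
by move: h; rewrite e => /(rep_inner_left rv rv' ru')/ulim_conj; rewrite e conjcK.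
Qed.
End Combinations.

Definition free_ultrafilter : set_system nat := sval (cid nat_ultrafilter).

#[local] Instance free_ultra : UltraFilter free_ultrafilter.
Proof. by have [] := svalP (cid nat_ultrafilter). Qed.

Lemma free_ultraN N : free_ultrafilter [set n | (N <= n)%N].
Proof. by have [_] := svalP (cid nat_ultrafilter); apply. Qed.

(** Positivity is bundled with the kernel so that the Hilbert structure on [rkhs] can be inferred
    from the type alone. *)
Record pdkernel (R : realType) (K0 : Type) := PDKernel {
  pdk : K0 -> K0 -> R[i];
  pdk_ge0 : forall p, 0 <= qf pdk p p }.

(** * The reproducing kernel Hilbert space *)

Section RKHS.
Context {R : realType} {K0 : Type} (k : pdkernel R K0).
Local Notation C := (R[i]).
Local Notation U := free_ultrafilter.
Let UF := free_ultra.
Let UN := free_ultraN.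

Definition rk_in : {pred (K0 -> C^o)} := fun f => `[< exists u, rep (pdk k) U u f >].

Lemma rk_inP u f : rep (pdk k) U u f -> f \in rk_in.
Proof. by move=> r; apply/asboolP; exists u. Qed.

Lemma rk_submod : submod_closed rk_in.
Proof.
split=> [|a f g].
  apply/asboolP; exists (fun=> [::]).
  have -> : (0 : K0 -> C^o) = ev (pdk k) [::] by apply/funext => b; rewrite /ev big_nil.
  exact: rep_cst.
move=> /asboolP[u ru] /asboolP[v rv]; apply/asboolP.
by exists (fun n => lc a (u n) (v n)); exact: (rep_lc (pdk_ge0 k) UF a ru rv).
Qed.

HB.instance Definition _ := GRing.isSubmodClosed.Build _ _ rk_in rk_submod.

(* The completion is realised by functions on [K0], as a reproducing kernel
   Hilbert space. *)
Record rkhs := RK { rk_val :> K0 -> C^o ; _ : rk_val \in rk_in }.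
HB.instance Definition _ := [isSub for rk_val].
HB.instance Definition _ := [Choice of rkhs by <:].
HB.instance Definition _ := [SubChoice_isSubLmodule of rkhs by <:].

Lemma rk_rep (f : rkhs) : exists u, rep (pdk k) U u f.
Proof. by case: f => f /= /asboolP. Qed.

Implicit Types (f g h : rkhs).

Lemma rkhsP f g : (forall b, f b = g b) -> f = g.
Proof. by move=> h; apply/val_inj/funext. Qed.

Definition rk_dot (f g : rkhs) : C := xget 0 [set l | exists u v,
  [/\ rep (pdk k) U u f, rep (pdk k) U v g & ulim U (fun n => qf (pdk k) (u n) (v n)) l]].

Lemma rk_dotP f g u v : rep (pdk k) U u f -> rep (pdk k) U v g ->
  ulim U (fun n => qf (pdk k) (u n) (v n)) (rk_dot f g).
Proof.
move=> ru rv; rewrite /rk_dot; case: xgetP => [l _ [u' [v' [ru' rv' h]]]|h].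
  exact: (rep_inner_eq (pdk_ge0 k) UF UN ru' ru rv' rv h).
have [l hl] := rep_inner (pdk_ge0 k) UF UN ru rv.
by case: (h l); exists u, v.
Qed.

Lemma rk_dot_lin a f g h : rk_dot (a *: f + g) h = a * rk_dot f h + rk_dot g h.
Proof.
have [u ru] := rk_rep f; have [v rv] := rk_rep g; have [w rw] := rk_rep h.
have h1 := @rk_dotP (a *: f + g) h _ _ (rep_lc (pdk_ge0 k) UF a ru rv) rw.
have h2 := ulimD UF (ulimZ UF a (rk_dotP ru rw)) (rk_dotP rv rw).
apply: (ulim_uniq UF h1); move: h2; congr (ulim _ _ _); apply/funext => n.
by rewrite qf_lcl.
Qed.

Lemma rk_dotC f g : rk_dot g f = (rk_dot f g)^*%C.
Proof.
have [u ru] := rk_rep f; have [v rv] := rk_rep g.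
apply: (ulim_uniq UF (rk_dotP rv ru)).
have := ulim_conj UF (rk_dotP ru rv); congr (ulim _ _ _); apply/funext => n.
by have [->] := qf_CS (pdk_ge0 k) (u n) (v n).
Qed.

Lemma rk_dot_linr a f g h : rk_dot h (a *: f + g) = a^*%C * rk_dot h f + rk_dot h g.
Proof. by rewrite rk_dotC rk_dot_lin conjcD conjcM -!rk_dotC. Qed.

Lemma rk_dot_ge0 f : 0 <= rk_dot f f.
Proof.
have [u ru] := rk_rep f.
by apply: (ulim_ge0 UF _ (rk_dotP ru ru)) => n; exact: pdk_ge0.
Qed.

Definition rk_sqn f : R := Re (rk_dot f f).

Lemma rk_sqn_ge0 f : 0 <= rk_sqn f.
Proof. by rewrite -ler0c /rk_sqn RRe_real ?ger0_real// rk_dot_ge0. Qed.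

Lemma rk_dotE f : rk_dot f f = (rk_sqn f)%:C.
Proof. by rewrite /rk_sqn RRe_real ?ger0_real// rk_dot_ge0. Qed.

Lemma rk_dot_CS f g : normc (rk_dot f g) ^+ 2 <= rk_sqn f * rk_sqn g.
Proof.
rewrite mulrC.
have [|_] := @quad_ge0 R (rk_dot g g) (rk_dot f g) (rk_dot g f) (rk_dot f f); last by [].
move=> z; apply: le_trans (rk_dot_ge0 (z *: f + g)) _.
by rewrite rk_dot_lin !rk_dot_linr le_eqVlt; apply/orP; left; apply/eqP; ring.
Qed.

Definition rk_nm f : R := Num.sqrt (rk_sqn f).

Lemma rk_nm_ge0 f : 0 <= rk_nm f. Proof. exact: sqrtr_ge0. Qed.

Lemma rk_nm2 f : rk_nm f ^+ 2 = rk_sqn f. Proof. by rewrite sqr_sqrtr ?rk_sqn_ge0. Qed.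

Lemma rk_dot_le f g : normc (rk_dot f g) <= rk_nm f * rk_nm g.
Proof.
by rewrite -ler_sqr ?nnegrE ?normc_ge0 ?mulr_ge0 ?rk_nm_ge0// exprMn !rk_nm2 rk_dot_CS.
Qed.

Lemma rk_nmD f g : rk_nm (f + g) <= rk_nm f + rk_nm g.
Proof.
rewrite -ler_sqr ?nnegrE ?addr_ge0 ?rk_nm_ge0// rk_nm2 sqrrD !rk_nm2 {1}/rk_sqn.
rewrite -[f]scale1r rk_dot_lin !rk_dot_linr scale1r conjc1 !mul1r !rk_dotE (rk_dotC f g).
have := le_trans (Re_le_normc _) (rk_dot_le f g).
by case: (rk_dot f g) => a b /=; lra.
Qed.

Lemma rk_nmZ a f : rk_nm (a *: f) = normc a * rk_nm f.
Proof.
have e : rk_sqn (a *: f) = normc a ^+ 2 * rk_sqn f.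
  have d0 g : rk_dot 0 g = 0.
    have := rk_dot_lin 1 0 0 g; rewrite scaler0 addr0 mul1r => /eqP.
    by rewrite -subr_eq0 opprD addNKr oppr_eq0 => /eqP.
  rewrite {1}/rk_sqn -[a *: f]addr0 rk_dot_lin rk_dot_linr d0 (rk_dotC 0) d0 conjc0 !addr0.
  by rewrite mulrA mulcJ rk_dotE -rmorphM.
by rewrite /rk_nm e sqrtrM ?sqr_ge0// sqrtr_sqr ger0_norm ?normc_ge0.
Qed.

Definition rk_of p : rkhs := RK (rk_inP (rep_cst (pdk k) UF p)).

Lemma rk_rep_of p : rep (pdk k) U (fun=> p) (rk_of p).
Proof. exact: rep_cst. Qed.

Lemma rk_dot_of p r : rk_dot (rk_of p) (rk_of r) = qf (pdk k) p r.
Proof. exact: (ulim_uniq UF (rk_dotP (rk_rep_of p) (rk_rep_of r)) (ulim_cst UF _)). Qed.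

Definition rk_e b : rkhs := rk_of [:: (1, b)].

Lemma rk_reproducing (f : rkhs) b : rk_dot f (rk_e b) = f b.
Proof.
have [u [cu uf]] := rk_rep f.
have h := rk_dotP (conj cu uf : rep _ _ _ f) (rk_rep_of [:: (1, b)]).
apply: (ulim_uniq UF h); move: (uf b); congr (ulim _ _ _).
by apply/funext => n; rewrite /qf big_seq1 conjc1 mul1r.
Qed.

(** Point evaluations are bounded by the norm, so null vectors are already the zero function and no
    quotient has to be formed. *)
Lemma rk_nm0_eq0 f : rk_nm f = 0 -> f = 0.
Proof.
move=> f0; apply: rkhsP => b; rewrite -rk_reproducing.
apply/eq0_normc/eqP; rewrite eq_le normc_ge0 andbT.
by apply: le_trans (rk_dot_le _ _) _; rewrite f0 mul0r.
Qed.

Definition rk_norm f : C := (rk_nm f)%:C.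

Let rk_normD f g : rk_norm (f + g) <= rk_norm f + rk_norm g.
Proof. by rewrite -rmorphD lecR rk_nmD. Qed.
Let rk_normZ a f : rk_norm (a *: f) = `|a| * rk_norm f.
Proof. by rewrite /rk_norm rk_nmZ rmorphM/= normcE'. Qed.
Let rk_norm0 f : rk_norm f = 0 -> f = 0.
Proof. by move=> /complexI; exact: rk_nm0_eq0. Qed.

HB.instance Definition _ := Lmodule_isNormed.Build C rkhs rk_normD rk_normZ rk_norm0.

Lemma rk_normE (f : rkhs) : `|f| = (rk_nm f)%:C. Proof. by []. Qed.

Lemma rk_approx (f : rkhs) (e : R) : 0 < e -> exists p, rk_nm (f - rk_of p) <= e.
Proof.
move=> e0; have [u [cu uf]] := rk_rep f.
have [N hN] := cu _ e0; exists (u N).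
have r : rep (pdk k) U (fun n => sub (u n) (u N)) (f - rk_of (u N) : rkhs).
  have := rep_lc (pdk_ge0 k) UF (-1) (rk_rep_of (u N)) (conj cu uf).
  by congr (rep _ _ _ _); apply/funext => b; rewrite mulN1r addrC.
rewrite -ler_sqr ?nnegrE ?rk_nm_ge0 ?(ltW e0)// rk_nm2.
apply: le_trans (Re_le_normc _) _.
apply: (ulim_bound UF _ (rk_dotP r r)); apply: filterS (UN N) => n /= Nn.
rewrite qfE; last exact: pdk_ge0.
rewrite normcR ?nq_ge0//; last exact: pdk_ge0.
rewrite -nm2; last exact: pdk_ge0.
by rewrite ler_sqr ?nnegrE ?nm_ge0 ?(ltW e0)//; exact: hN.
Qed.

Lemma rk_nm_of p : rk_nm (rk_of p) = nm (pdk k) p.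
Proof. by rewrite /rk_nm /rk_sqn rk_dot_of. Qed.

Lemma rk_of_sub p r : rk_of (sub p r) = rk_of p - rk_of r.
Proof. by apply: rkhsP => b; rewrite -[LHS]/(ev _ _ _) ev_sub. Qed.

(** Balls of radius [1 / (n + 1)] trace the filter; their centres are replaced by finite
    combinations, so that the limit is represented in the sense of [rk_in]. *)
Lemma rk_complete (F : set_system rkhs) : ProperFilter F -> cauchy F -> cvg F.
Proof.
move=> FF /cauchyP cF.
have ballE (f g : rkhs) (e : R) : ball f e%:C g <-> rk_nm (f - g) < e.
  by rewrite -ball_normE/= rk_normE ltcR.
have Rn n : 0 < n.+1%:R^-1 :> R by rewrite invr_gt0.
have /choice[f hf] n : exists f, F (ball f (n.+1%:R^-1)%:C).
  by apply: cF; rewrite ltcR.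
have /choice[v hv] n := rk_approx (f n) (Rn n).
have nB (g h : rkhs) : rk_nm (g - h) = rk_nm (h - g).
  by rewrite -opprB -scaleN1r rk_nmZ normcN normc1 mul1r.
have tri (g h l : rkhs) : rk_nm (g - l) <= rk_nm (g - h) + rk_nm (h - l).
  by apply: le_trans (rk_nmD _ _); rewrite addrA subrK.
have ff n m : rk_nm (f n - f m) <= n.+1%:R^-1 + m.+1%:R^-1.
  have [g [g1 g2]] := filter_ex (filterI (hf n) (hf m)).
  apply: le_trans (tri _ g _) _; rewrite [X in _ + X]nB.
  by move/ballE: g1 => g1; move/ballE: g2 => g2; rewrite lerD ?ltW.
have vv n m : nm (pdk k) (sub (v n) (v m)) <= (n.+1%:R^-1 + m.+1%:R^-1) *+ 2.
  rewrite -rk_nm_of rk_of_sub; apply: le_trans (tri _ (f n) _) _.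
  rewrite [X in X + _]nB; apply: le_trans (lerD (hv n) (tri _ (f m) _)) _.
  apply: le_trans (lerD (lexx _) (lerD (ff n m) (hv m))) _.
  by rewrite mulr2n; move: (n.+1%:R^-1 : R) (m.+1%:R^-1 : R) => a b; lra.
have cv : cau (pdk k) v.
  move=> e e0; have [N hN] := inv_succ_le (divr_gt0 e0 (ltr0Sn _ 3)).
   exists N => n m /hN n1 /hN m1; apply: le_trans (vv n m) _; move: n1 m1; rewrite mulr2n; move: (n.+1%:R^-1 : R) (m.+1%:R^-1 : R) => a b; lra.
have [l rl] := cau_rep (pdk_ge0 k) UF UN cv.
pose L : rkhs := RK (rk_inP rl).
have Lv n : rk_nm (L - rk_of (v n)) <= (n.+1%:R^-1) *+ 4.
  have r : rep (pdk k) U (fun m => sub (v m) (v n)) (L - rk_of (v n) : rkhs).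
    have := rep_lc (pdk_ge0 k) UF (-1) (rk_rep_of (v n)) rl.
    by congr (rep _ _ _ _); apply/funext => b; rewrite mulN1r addrC.
  have p0 : 0 <= (n.+1%:R^-1 : R) *+ 4 by rewrite mulrn_wge0// ltW.
  rewrite -ler_sqr ?nnegrE ?rk_nm_ge0// rk_nm2.
  apply: le_trans (Re_le_normc _) _.
  apply: (ulim_bound UF _ (rk_dotP r r)); apply: filterS (UN n) => m /= nm'.
  rewrite qfE; last exact: pdk_ge0.
  rewrite normcR ?nq_ge0//; last exact: pdk_ge0.
  rewrite -nm2; last exact: pdk_ge0.
  rewrite ler_sqr ?nnegrE ?nm_ge0//; apply: le_trans (vv _ _) _.
  have : m.+1%:R^-1 <= n.+1%:R^-1 :> R by rewrite lef_pV2 ?posrE// ler_nat.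
  by move: (m.+1%:R^-1 : R) (n.+1%:R^-1 : R) => a b ab; lra.
apply/cvg_ex; exists L; apply/cvg_ballP => e e0.
have [d ed] : exists d, e = d%:C.
  by apply/complex_realP; rewrite ger0_real ?ltW.
subst e; have d0 : 0 < d by rewrite -ltcR.
(* The distance from [L] to a point of the ball splits into [4 + 1 + 1] multiples of [1 / (N + 1)],
   which is at most [d / 7]. *)
have [N /(_ N (leqnn N)) hN] := inv_succ_le (divr_gt0 d0 (ltr0Sn _ 6)).
rewrite near_simpl; apply: filterS (hf N) => g /ballE gN; apply/ballE.
apply: le_lt_trans (tri _ (rk_of (v N)) _) _.
apply: le_lt_trans (lerD (Lv N) (tri _ (f N) _)) _.
rewrite [X in _ + (X + _)]nB; have := hv N; move: gN.
move: (rk_nm _) (rk_nm _) hN (Rn N) => a b; move: (N.+1%:R^-1 : R) => c; lra.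
Qed.

HB.instance Definition _ := Uniform_isComplete.Build rkhs rk_complete.

Let rk_bilin : bilinear_for ( *%R : C -> C -> C) (@Num.conj C \; *%R) rk_dot.
Proof. by split=> [g a f h|g a f h]; [exact: rk_dot_lin|exact: rk_dot_linr]. Qed.

HB.instance Definition _ := bilinear_isBilinear.Build C rkhs rkhs C ( *%R) (@Num.conj C \; *%R) rk_dot rk_bilin.

Let rk_herm (f g : rkhs) : rk_dot f g = (-1) ^+ false * Num.conj (rk_dot g f).
Proof. by rewrite expr0 mul1r rk_dotC. Qed.

HB.instance Definition _ := isHermitianSesquilinear.Build C rkhs false (@Num.conj C) rk_dot rk_herm.

Let rk_dot_gt0 (f : rkhs) : f != 0 -> 0 < rk_dot f f.
Proof.
move=> f0; rewrite lt_def rk_dot_ge0 andbT; apply: contra_neq f0 => d0.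
by apply: rk_nm0_eq0; rewrite /rk_nm /rk_sqn d0 sqrtr0.
Qed.

HB.instance Definition _ := isDotProduct.Build C rkhs rk_dot rk_dot_gt0.

Let rk_hilbert (f : rkhs) : rk_dot f f = `|f| ^+ 2.
Proof. by rewrite rk_normE -rmorphXn rk_nm2 rk_dotE. Qed.

HB.instance Definition _ := isHilbert.Build R rkhs rk_hilbert.

Lemma rk_hdotE (f g : rkhs) : hdot f g = rk_dot f g.
Proof. by []. Qed.
End RKHS.

(** The form is that of [Z] at the sums of [g s (x s)] over the fibres of [tau], which lets an index
    of [Z] be repeated. *)
Lemma fam_ge0_congruence (R : realType) (H : hilbertType R) (S T : finType) (Z : T -> T -> H -> H)
    (tau : S -> T) (g : S -> H -> H) : (forall a b, bounded_op (Z a b)) -> (forall s, bounded_op (g s)) ->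
  fam_ge0 Z -> fam_ge0 (fun s t => adj (g s) \o Z (tau s) (tau t) \o g t).
Proof.
move=> bZ bg Z0 x.
have := Z0 (fun a => \sum_(s | tau s == a) g s (x s)); congr (_ <= _).
rewrite /opform.
transitivity (\sum_a \sum_b \sum_(s | tau s == a) \sum_(t | tau t == b)
   hdot (Z (tau s) (tau t) (g t (x t))) (g s (x s))).
  apply: eq_bigr => a _; apply: eq_bigr => b _.
  rewrite dot_sumr; apply: eq_bigr => s /eqP sa.
  rewrite (linT_sum (bounded_linear (bZ a b))) dot_suml; apply: eq_bigr => t /eqP tb.
  by rewrite sa tb.
rewrite [RHS](partition_big tau predT)//=; apply: eq_bigr => a _.
rewrite exchange_big/=; apply: eq_bigr => s _.
rewrite [RHS](partition_big tau predT)//=; apply: eq_bigr => b _.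
by apply: eq_bigr => t _; rewrite adj_dotl.
Qed.

(** * The representation induced by an idempotent ucp map *)

Section GNS.
Context {R : realType} {H : hilbertType R}.
Local Notation BH := (@bounded_op R H).
Local Notation C := (R[i]).
Variables (F : (H -> H) -> (H -> H)) (B : set (H -> H)).
Hypotheses (uF : ucp BH F).
Hypotheses (cB : Cstar_subalgebra B) (B1 : B id) (BF : B `<=` absorbing F).

Let uBH := @bounded_selfadjoint_unital R H.
Let Bb : B `<=` BH. Proof. by have [[]] := cB. Qed.
Let sB : op_subspace B. Proof. by case: cB. Qed.
Let BM S T : B S -> B T -> B (S \o T). Proof. by have [_ h _ _] := cB; exact: h. Qed.
Let Badj T : B T -> B (adj T). Proof. by have [_ _] := Cstar_selfadjoint cB B1; apply. Qed.
Let Fb : set_fun BH BH F. Proof. by case: uF. Qed.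
Let Fl : linear_on BH F. Proof. by case: uF. Qed.
Let bcomp := @bounded_op_comp R H.
Let badj := @adj_bounded R H.

(* [(x, xi)] stands for the elementary tensor of [x] and [xi]. *)
Definition gns_pt : Type := ({x : H -> H | B x} * H)%type.
Let op (a : gns_pt) : H -> H := sval a.1.
Let Bop a : B (op a). Proof. exact: svalP. Qed.
Let bop a : BH (op a). Proof. exact/Bb/Bop. Qed.

Definition gns_kernel (a b : gns_pt) : C := hdot (F (adj (op b) \o op a) a.2) b.2.

Let comb := seq (C * gns_pt).
Implicit Types (p r : comb).

(** The operator [z] is placed between two tensors and may be any bounded one: [F z] need not lie in
    [B], so it does not act on the tensors themselves. *)
Let pairing (z : H -> H) p r : C :=
  \sum_(w <- r) \sum_(u <- p) (w.1)^*%C * (u.1 * hdot (F (adj (op w.2) \o z \o op u.2) u.2.2) w.2.2).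

(** With one index for every entry of every list, this is complete positivity of [F] on a congruence
    of [Z]. *)
Let pairing_ge0 (T : finType) (Z : T -> T -> H -> H) (P : T -> comb) :
  (forall a b, BH (Z a b)) -> fam_ge0 Z -> 0 <= \sum_a \sum_b pairing (Z a b) (P b) (P a).
Proof.
move=> bZ Z0.
pose S := {a : T & 'I_(size (P a))}.
pose el (s : S) := tnth (in_tuple (P (tag s))) (tagged s).
have [_ _ _ /cp_kcp Fp] := uF.
have bel s : BH (op (el s).2) by exact: bop.
have h := fam_ge0_congruence (fun s : S => tag s) bZ bel Z0.
have bX (s t : S) : BH (adj (op (el s).2) \o Z (tag s) (tag t) \o op (el t).2).
  by apply: bcomp; [apply: bcomp; [exact: badj|]|].
have := Fp _ _ bX h (fun s => (el s).1 *: (el s).2.2); congr (_ <= _).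
pose G a (i : 'I_(size (P a))) b (j : 'I_(size (P b))) :=
  hdot (F (adj (op (tnth (in_tuple (P a)) i).2) \o Z a b \o op (tnth (in_tuple (P b)) j).2)
     ((tnth (in_tuple (P b)) j).1 *: (tnth (in_tuple (P b)) j).2.2))
   ((tnth (in_tuple (P a)) i).1 *: (tnth (in_tuple (P a)) i).2.2).
transitivity (\sum_a \sum_(i < size (P a)) \sum_b \sum_(j < size (P b)) G a i b j).
  rewrite [RHS]sig_big_dep; apply: eq_big => // s _.
  by rewrite [RHS]sig_big_dep; apply: eq_big.
apply: eq_bigr => a _; rewrite exchange_big/=; apply: eq_bigr => b _.
rewrite /pairing [RHS]big_tnth; apply: eq_bigr => i _; rewrite [RHS]big_tnth.
apply: eq_bigr => j _; rewrite /G dotZr.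
rewrite (linTZ (bounded_linear (Fb _))) ?dotZl//.
by apply: bcomp; [apply: bcomp; [exact: badj|]|].
Qed.

Let kap := gns_kernel.

Let pairing_id p r : pairing id p r = qf kap p r.
Proof.
rewrite /pairing /qf; apply: eq_bigr => w _; rewrite /ev mulr_sumr.
by apply: eq_bigr => u _.
Qed.

Lemma gns_kernel_ge0 p : 0 <= qf gns_kernel p p.
Proof.
have h := @pairing_ge0 unit (fun _ _ => id) (fun=> p) (fun _ _ => @bounded_op_id R H).
rewrite -pairing_id; move: h; rewrite !sum_unit; apply => x.
by rewrite /opform !sum_unit dotxx ler0c sqr_ge0.
Qed.

Definition gns_pd : pdkernel R gns_pt := PDKernel gns_kernel_ge0.

(** A point carries a proof of membership in [B], so the action is completed by the default [a]
    outside [B]. *)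
Definition gns_act (z : H -> H) (a : gns_pt) : gns_pt :=
  match pselect (B z) with
  | left Bz => (exist _ (z \o op a) (BM Bz (Bop a)), a.2)
  | right _ => a
  end.

Let op_act z a : B z -> op (gns_act z a) = z \o op a.
Proof. by move=> Bz; rewrite /gns_act; case: pselect. Qed.

Let vec_act z a : (gns_act z a).2 = a.2.
Proof. by rewrite /gns_act; case: pselect. Qed.

Let pt_eq (a b : gns_pt) : op a = op b -> a.2 = b.2 -> a = b.
Proof.
case: a b => [[x Bx] u] [[y By] v]; rewrite /op/= => xy uv.
by rewrite uv; congr (_, _); exact: eq_exist.
Qed.

Let cact z p : comb := [seq (u.1, gns_act z u.2) | u <- p].

Let kap_act z a b : B z -> kap (gns_act z a) b = kap a (gns_act (adj z) b).
Proof.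
move=> Bz; rewrite /kap /gns_kernel !vec_act !op_act//; last exact: Badj.
by rewrite adj_comp ?adjK//; [exact: Bb|exact/badj/Bb].
Qed.

Let ev_act z p b : B z -> ev kap (cact z p) b = ev kap p (gns_act (adj z) b).
Proof.
by move=> Bz; rewrite /ev big_map; apply: eq_bigr => u _; rewrite kap_act.
Qed.

Let qf_act z p r : B z -> qf kap (cact z p) r = qf kap p (cact (adj z) r).
Proof.
move=> Bz; rewrite /qf big_map; apply: eq_bigr => w _ /=.
by rewrite ev_act.
Qed.

(** The Choi-Effros identity enters here: the middle factor [F z] is exchanged for [z], which does
    act on tensors. *)
Let kap_F z a b : B z ->
  hdot (F (adj (op b) \o F z \o op a) a.2) b.2 = kap (gns_act z a) b.
Proof.
move=> Bz; rewrite /kap /gns_kernel vec_act op_act//.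
have ab : absorbing F (adj (op b)) by exact/BF/Badj/Bop.
have aa : absorbing F (op a) by exact/BF/Bop.
by rewrite -(absorbing_sandwich uF ab aa (Bb Bz)).
Qed.

Let pairing_F z p r : B z -> pairing (F z) p r = qf kap (cact z p) r.
Proof.
move=> Bz; rewrite /pairing /qf; apply: eq_bigr => w _.
rewrite /ev mulr_sumr [RHS]big_map; apply: eq_bigr => u _ /=.
by rewrite kap_F.
Qed.

Let pairing0 p r : pairing 0 p r = 0.
Proof.
rewrite /pairing big1// => w _; rewrite big1// => u _.
have -> : adj (op w.2) \o (0 : H -> H) \o op u.2 = 0.
  by apply/funext => x; exact: linT0 (bounded_linear (badj (bop w.2))).
rewrite (linear_on0 (@bounded_op_subspace R H) Fl).
have z0 : hdot ((0 : H -> H) u.2.2) w.2.2 = 0 := dot0l _.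
by rewrite z0 !mulr0.
Qed.

Let pairingZ (c : C) p r : pairing (c *: id) p r = c * qf kap p r.
Proof.
rewrite -pairing_id /pairing mulr_sumr; apply: eq_bigr => w _.
rewrite mulr_sumr; apply: eq_bigr => u _.
have bo : BH (adj (op w.2) \o id \o op u.2).
  by apply: bcomp => //; apply: bcomp; [exact: badj|exact: bounded_op_id].
have -> : adj (op w.2) \o (c *: id) \o op u.2 = c *: (adj (op w.2) \o id \o op u.2).
  by apply/funext => x; rewrite /= (linTZ (bounded_linear (badj (bop w.2)))).
by rewrite (linear_onZ c (@bounded_op_subspace R H) Fl bo) fctE dotZl; ring.
Qed.

(** The positive matrix is Paulsen's for [F X], not for [X]; [pairing_F] then converts its entries
    into the action of [X]. Hence [F X] governs the norm of [X] in the representation. *)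
Let list_positive (I J : finType) (X : J -> I -> H -> H) (c : R) (p : I -> comb) (r : J -> comb) :
  0 <= c -> (forall j i, B (X j i)) -> fbound (fun j i => F (X j i)) c ->
  0 <= \sum_i c%:C * qf kap (p i) (p i) + \sum_i \sum_j qf kap (cact (adj (X j i)) (r j)) (p i) +
    (\sum_j \sum_i qf kap (cact (X j i) (p i)) (r j) + \sum_j c%:C * qf kap (r j) (r j)).
Proof.
move=> c0 BX Xc; have bFX j i : BH (F (X j i)) by exact/Fb/Bb.
have h := norm_block_ge0 c0 bFX Xc.
have bid (b : bool) : BH (if b then c%:C *: id else 0).
  case: b; last exact: bounded_op0.
  by apply: op_subspaceZ; [exact: bounded_op_subspace|exact: bounded_op_id].
have bZ s t : BH (blk (fun i i' : I => if i == i' then c%:C *: id else 0)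
    (fun i j => adj (F (X j i))) (fun j i => F (X j i))
    (fun j j' : J => if j == j' then c%:C *: id else 0) s t).
  by case: s t => [i|j] [i'|j'] //=; exact: badj.
pose P (s : I + J) := match s with inl i => p i | inr j => r j end.
have := pairing_ge0 P bZ h.
pose G s t (T : H -> H) := pairing T (P t) (P s).
move=> hh; have {hh} : 0 <= \sum_s \sum_t G s t (blk (fun i i' : I => if i == i' then c%:C *: id else 0)
    (fun i j => adj (F (X j i))) (fun j i => F (X j i))
    (fun j j' : J => if j == j' then c%:C *: id else 0) s t) := hh.
rewrite sum_blk {}/G /P.
rewrite !(form_diag (k := fun T (x y : comb) => pairing T x y)); try exact: pairing0.
under eq_bigr do rewrite pairingZ.
under [X in _ + X + _]eq_bigr do under eq_bigr do rewrite -(ucp_adj uBH uF (Bb (BX _ _))) (pairing_F _ _ (Badj (BX _ _))).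
under [X in _ + (X + _)]eq_bigr do under eq_bigr do rewrite (pairing_F _ _ (BX _ _)).
by under [X in _ + (_ + X)]eq_bigr do rewrite pairingZ.
Qed.

Lemma qf_act_adj z p r : B z -> qf kap (cact (adj z) r) p = (qf kap (cact z p) r)^*%C.
Proof.
move=> Bz; have [<- _] := qf_CS gns_kernel_ge0 (cact z p) r.
by rewrite qf_act ?adjK//; [exact: Bb|exact: Badj].
Qed.

Let cact_bound z : B z -> exists2 c : R, 0 <= c & forall p, nm kap (cact z p) <= c * nm kap p.
Proof.
move=> Bz; pose c := opnorm (F z) + 1.
have o0 : 0 <= opnorm (F z) by exact/opnorm_ge0/Fb/Bb.
have c0 : 0 < c by rewrite ltr_wpDl.
exists c; first exact: ltW.
move=> p.
have Xc : fbound (fun _ _ : unit => F z) c.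
  apply/fbound1; first exact: ltW.
  move=> x; apply: le_trans (opnorm_bound (Fb (Bb Bz)) x) _.
  by rewrite ler_wpM2r ?rnorm_ge0// lerDl.
(* The second vector [- z p / c] minimises the form and leaves [c |p|^2 - |z p|^2 / c >= 0]. *)
pose q := cact z p; pose s : C := (- c^-1)%:C.
have := list_positive (fun _ : unit => p) (fun _ : unit => lc s q [::]) (ltW c0) (fun _ _ : unit => Bz) Xc.
rewrite !sum_unit qf_act_adj// -/q.
have qn a : qf kap a [::] = 0 by rewrite /qf big_nil.
have nq' a : qf kap [::] a = 0.
  by have [-> _] := qf_CS gns_kernel_ge0 a [::]; rewrite qn conjc0.
rewrite qf_lcl !qf_lcr !qn !nq' !addr0 !(qfE gns_kernel_ge0) => h.
rewrite -ler_sqr ?nnegrE ?nm_ge0 ?mulr_ge0 ?nm_ge0 ?(ltW c0)//.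
rewrite exprMn !(nm2 gns_kernel_ge0).
have e : c * nq kap p + - c^-1 * nq kap q + (- c^-1 * nq kap q + c * (- c^-1 * (- c^-1 * nq kap q)))
   = (c ^+ 2 * nq kap p - nq kap q) / c by field; rewrite gt_eqF.
move: h; rewrite /s conjcM !conjc_real mulr0 addr0 -!rmorphM -!rmorphD ler0c.
by rewrite e pmulr_lge0 ?invr_gt0// subr_ge0.
Qed.

Let cact_sub z p r : cact z (sub p r) = sub (cact z p) (cact z r).
Proof. by rewrite /cact /sub /lc map_cat -!map_comp. Qed.

Local Notation L := (rkhs gns_pd).
Local Notation gns_rep := (rep (pdk gns_pd) free_ultrafilter).
Implicit Types (f g : L).

(* [<z f, b> = <f, z^* b>] determines [z f]. *)
Definition gns_map (z : H -> H) f : L :=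
  xget (0 : L) [set g : L | forall b, g b = f (gns_act (adj z) b)].

Let rep_act z f u : B z -> gns_rep u f ->
  gns_rep (fun n => cact z (u n)) (fun b => f (gns_act (adj z) b)).
Proof.
move=> Bz [cu uf]; split=> [e e0|b]; last first.
  have := uf (gns_act (adj z) b); congr (ulim _ _ _).
  by apply/funext => n; rewrite ev_act.
have [c c0 hc] := cact_bound Bz; have c1 : 0 < c + 1 by rewrite ltr_wpDl.
have [N hN] := cu _ (divr_gt0 e0 c1); exists N => n m nN mN.
rewrite -cact_sub; apply: le_trans (hc _) _.
apply: (@le_trans _ _ ((c + 1) * (e / (c + 1)))); last by rewrite mulrC divfK// gt_eqF.
by apply: ler_pM; rewrite ?nm_ge0 ?lerDl// hN.
Qed.

Let gns_mapE z f b : B z -> gns_map z f b = f (gns_act (adj z) b).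
Proof.
move=> Bz; rewrite /gns_map; case: xgetP => [g _ /= ->//|n].
have [u uf] := rk_rep f.
by case: (n (RK (rk_inP (rep_act Bz uf)) : L)).
Qed.

Let gns_map_rep z f u : B z -> gns_rep u f -> gns_rep (fun n => cact z (u n)) (gns_map z f).
Proof.
move=> Bz uf; have := rep_act Bz uf; congr (rep _ _ _ _).
by apply/funext => b; rewrite gns_mapE.
Qed.

Let gns_map_lin z : B z -> linear (gns_map z).
Proof.
move=> Bz a f g; apply: rkhsP => b.
by rewrite gns_mapE// -[RHS]/(a * gns_map z f b + gns_map z g b) !gns_mapE.
Qed.

Let gns_map_linear_on : linear_on B gns_map.
Proof.
move=> a z w Bz Bw; apply/funext => f; apply: rkhsP => b.
have Bzw : B (a *: z + w) by have [_ _] := sB; apply.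
rewrite -[RHS]/(a * gns_map z f b + gns_map w f b) !gns_mapE//.
have [u [_ uf]] := rk_rep f.
apply: (ulim_uniq free_ultra (uf _)).
have := ulimD free_ultra (ulimZ free_ultra a (uf (gns_act (adj z) b))) (uf (gns_act (adj w) b)).
congr (ulim _ _ _); apply/funext => n; rewrite /ev mulr_sumr -big_split/=.
apply: eq_bigr => v _; rewrite -[gns_kernel]/kap -!kap_act// /kap /gns_kernel !vec_act !op_act//.
have bo y : B y -> BH (adj (op b) \o (y \o op v.2)).
  by move=> By; apply: bcomp; [exact: badj|apply: bcomp => //; exact: Bb].
have -> : adj (op b) \o ((a *: z + w) \o op v.2) =
    a *: (adj (op b) \o (z \o op v.2)) + (adj (op b) \o (w \o op v.2)).
  have la := bounded_linear (badj (bop b)).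
  by apply/funext => x; rewrite /= !fctE (linTD la) (linTZ la).
by rewrite Fl; [rewrite !fctE dotDl dotZl; ring|exact: bo|exact: bo].
Qed.

Let gns_map_comp z w : B z -> B w -> gns_map (z \o w) = gns_map z \o gns_map w.
Proof.
move=> Bz Bw; apply/funext => f; apply: rkhsP => b /=.
rewrite !gns_mapE//; last exact: BM.
congr (rk_val f _); apply: pt_eq; last by rewrite !vec_act.
rewrite (op_act _ (Badj (BM Bz Bw))) (op_act _ (Badj Bw)) (op_act _ (Badj Bz)).
by rewrite adj_comp//; exact: Bb.
Qed.

Let gns_map_id : gns_map id = id.
Proof.
apply/funext => f; apply: rkhsP => b; rewrite gns_mapE//.
congr (rk_val f _); apply: pt_eq; last by rewrite vec_act.
by rewrite op_act ?adj_id.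
Qed.

Let gns_map_adj z f g : B z -> hdot (gns_map z f) g = hdot f (gns_map (adj z) g).
Proof.
move=> Bz; rewrite !rk_hdotE.
have [u ru] := rk_rep f; have [v rv] := rk_rep g.
apply: (ulim_uniq free_ultra (rk_dotP (gns_map_rep Bz ru) rv)).
have := rk_dotP ru (gns_map_rep (Badj Bz) rv); congr (ulim _ _ _).
by apply/funext => n; rewrite qf_act.
Qed.

Let gns_map_bounded z : B z -> bounded_op (gns_map z).
Proof.
move=> Bz; apply/bounded_opP; split; first exact: gns_map_lin.
have [c c0 hc] := cact_bound Bz; exists c => // f.
have nE (h : L) : rnorm h = rk_nm h by rewrite /rnorm rk_normE.
rewrite !nE -ler_sqr ?nnegrE ?mulr_ge0 ?rk_nm_ge0// exprMn !rk_nm2.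
have [u ru] := rk_rep f; have rv := gns_map_rep Bz ru.
rewrite -subr_ge0 -ler0c rmorphB rmorphM /= -!rk_dotE -mulN1r.
apply: (ulim_ge0 free_ultra _ (ulimD free_ultra (ulimZ free_ultra _ (rk_dotP ru ru))
  (ulimZ free_ultra (-1) (rk_dotP rv rv)))) => n.
rewrite !(qfE gns_kernel_ge0) mulN1r -rmorphM -rmorphB ler0c subr_ge0.
by rewrite -!(nm2 gns_kernel_ge0) -exprMn ler_sqr ?nnegrE ?mulr_ge0 ?nm_ge0.
Qed.

(** Positivity on lists passes to limits; scaling the first family by [z], the discriminant gives
    the bound. *)
Let gns_map_upper (I J : finType) (X : J -> I -> H -> H) (c : R) :
  0 <= c -> (forall j i, B (X j i)) -> fbound (fun j i => F (X j i)) c ->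
  fbound (fun j i => gns_map (X j i)) c.
Proof.
move=> c0 BX Xc.
have pos (x : I -> L) (y : J -> L) :
  0 <= \sum_i c%:C * hdot (x i) (x i) + \sum_i \sum_j hdot (gns_map (adj (X j i)) (y j)) (x i) +
    (\sum_j \sum_i hdot (gns_map (X j i) (x i)) (y j) + \sum_j c%:C * hdot (y j) (y j)).
  have /choice[u hu] i := rk_rep (x i); have /choice[v hv] j := rk_rep (y j).
  have UF := free_ultra.
  apply: (ulim_ge0 UF (fun n => list_positive (fun i => u i n) (fun j => v j n) c0 BX Xc)).
  by apply: (ulimD UF); apply: (ulimD UF); apply: (ulim_sum UF) => i;
    do ?[apply: (ulimZ UF)|apply: (ulim_sum UF) => ?]; apply: (@rk_dotP _ _ gns_pd) => //; apply: gns_map_rep => //; exact: Badj.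
move=> x y.
have [|_] := @quad_ge0 R (\sum_j c%:C * hdot (y j) (y j)) (opform (fun j i => gns_map (X j i)) x y)
   (\sum_i \sum_j hdot (gns_map (adj (X j i)) (y j)) (x i)) (\sum_i c%:C * hdot (x i) (x i)).
  move=> z; have := pos (fun i => z *: x i) y; congr (_ <= _).
  have -> : \sum_i c%:C * hdot (z *: x i) (z *: x i) = z * z^*%C * \sum_i c%:C * hdot (x i) (x i).
    by rewrite mulr_sumr; apply: eq_bigr => i _; rewrite dotZl dotZr; ring.
  have -> : \sum_i \sum_j hdot (gns_map (adj (X j i)) (y j)) (z *: x i) =
     z^*%C * \sum_i \sum_j hdot (gns_map (adj (X j i)) (y j)) (x i).
    by rewrite mulr_sumr; apply: eq_bigr => i _; rewrite mulr_sumr; apply: eq_bigr => j _; rewrite dotZr.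
  have -> : \sum_j \sum_i hdot (gns_map (X j i) (z *: x i)) (y j) =
     z * opform (fun j i => gns_map (X j i)) x y.
    rewrite mulr_sumr; apply: eq_bigr => j _; rewrite mulr_sumr; apply: eq_bigr => i _.
    by rewrite (linTZ (gns_map_lin (BX j i))) dotZl.
  by ring.
by rewrite -!mulr_sumr !sum_dotxx -!rmorphM/= => h; apply: le_trans h _; rewrite le_eqVlt; apply/orP; left; apply/eqP; ring.
Qed.

(** The vectors of Stinespring's isometry, isometric because [F] is unital. [F] is the compression
    of the representation to them, whence the lower bound on its norms. *)
Let vac (xi : H) : gns_pt := (exist _ id B1, xi).

Let gns_map_vac z xi eta : B z ->
  hdot (gns_map z (rk_e gns_pd (vac xi))) (rk_e gns_pd (vac eta)) = hdot (F z xi) eta.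
Proof.
move=> Bz; rewrite rk_hdotE rk_reproducing gns_mapE//.
rewrite -[LHS]/(ev kap [:: (1, vac xi)] _) /ev big_seq1 mul1r -kap_act//.
by rewrite /kap /gns_kernel vec_act op_act// /op/= adj_id.
Qed.

Let gns_map_lower (I J : finType) (X : J -> I -> H -> H) (c : R) :
  (forall j i, B (X j i)) -> fbound (fun j i => gns_map (X j i)) c ->
  fbound (fun j i => F (X j i)) c.
Proof.
move=> BX Xc x y.
have := Xc (fun i => rk_e gns_pd (vac (x i))) (fun j => rk_e gns_pd (vac (y j))).
have sE (S : finType) (v : S -> H) : sqn (fun i => rk_e gns_pd (vac (v i))) = sqn v.
  apply: complexI; rewrite -!sum_dotxx; apply: eq_bigr => i _.
  have [_ _ F1 _] := uF.
  by rewrite -{1}[rk_e _ _]/(id (rk_e gns_pd (vac (v i)))) -gns_map_id gns_map_vac// F1.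
rewrite !sE; congr (normc _ ^+ 2 <= _).
by apply: eq_bigr => j _; apply: eq_bigr => i _; rewrite gns_map_vac.
Qed.

Theorem gns : exists (K : hilbertType R) (s : (H -> H) -> (K -> K)),
  [/\ star_hom B bounded_op s, s id = id &
   forall (I J : finType) (X : J -> I -> H -> H) (c : R), 0 <= c -> (forall j i, B (X j i)) ->
     fbound (fun j i => F (X j i)) c <-> fbound (fun j i => s (X j i)) c].
Proof.
exists (rkhs gns_pd), gns_map; split.
- split=> //.
  move=> S T BS BT aTS f g; rewrite (_ : S = adj T); first exact: gns_map_adj.
  by apply/esym/adj_eq => //; exact: Bb.
- exact: gns_map_id.
- by move=> I J X c c0 BX; split; [exact: gns_map_upper|exact: gns_map_lower].
Qed.
End GNS.

Lemma ucp_opnorm (R : realType) (H K : hilbertType R) (A : set (H -> H))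
    (f : (H -> H) -> (K -> K)) T :
  selfadjoint_unital A -> ucp A f -> A T -> opnorm (f T) <= opnorm T.
Proof.
move=> hA hf AT; have bT : bounded_op T by have [[+ _ _] _ _] := hA; apply.
apply: opnorm_le; first exact: opnorm_ge0.
by apply: (ucp_opbound hA hf (opnorm_ge0 bT) AT); exact: opnorm_bound.
Qed.

(** * The corollary *)

Section StarHom.
Context {R : realType} {H K : hilbertType R}.
Variables (A : set (H -> H)) (t : (H -> H) -> (K -> K)).
Hypotheses (cA : Cstar_subalgebra A) (A1 : A id).
Hypotheses (ht : star_hom A bounded_op t) (t1 : t id = id).

Let hA := Cstar_selfadjoint cA A1.
Let ut := star_hom_ucp cA A1 ht t1.

(** Norm closedness holds because [t], being ucp, is contractive. *)
Lemma star_preimage_Cstar (D : set (K -> K)) : Cstar_subalgebra D ->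
  Cstar_subalgebra [set a | A a /\ D (t a)].
Proof.
have [[Ab A0 Al] AM Aa Acl] := cA; have [tb lt tM ta] := ht.
have [sA _ _] := hA.
move=> [[_ D0 Dl] DM Da Dcl]; split.
- split; first by move=> a [/Ab].
    by split=> //; rewrite (linear_on0 sA lt).
  by move=> a S T [AS DS] [AT DT]; split; [exact: Al|rewrite lt//; exact: Dl].
- by move=> S T [AS DS] [AT DT]; split; [exact: AM|rewrite tM//; exact: DM].
- move=> S T [AT DT] TS; have AS := Aa _ _ AT TS.
  by split=> //; apply: Da DT _; exact: ta.
- move=> T bT hT; have AT : A T.
    by apply: Acl => // e e0; have [S [AS _] TS] := hT e e0; exists S.
  split=> //; apply: Dcl => [|e e0]; first exact: tb.
  have [S [AS DS] TS] := hT e e0; exists (t S) => //.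
  apply: le_lt_trans TS.
  rewrite -(linear_onB lt AT AS).
  by apply: ucp_opnorm hA ut _; exact: op_subspaceB.
Qed.

Lemma star_hom_Cstar (M : set (H -> H)) (D : set (K -> K)) : A = Cstar M -> Cstar_subalgebra D ->
  (forall m, M m -> D (t m)) -> forall a, A a -> D (t a).
Proof.
move=> AM cD MD a Aa; have : Cstar M `<=` [set a | A a /\ D (t a)].
  apply: Cstar_min (star_preimage_Cstar cD) _ => m Mm; split; last exact: MD.
  by rewrite AM; exact: sub_Cstar.
by rewrite -AM => /(_ _ Aa) [].
Qed.

(** Lets agreement of two homomorphisms spread from generators to the generated C*-algebra;
    closedness again uses contractivity. *)
Lemma star_equalizer_Cstar (s : (H -> H) -> (K -> K)) : star_hom A bounded_op s -> s id = id ->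
  Cstar_subalgebra [set a | A a /\ t a = s a].
Proof.
have [[Ab A0 Al] AM Aa Acl] := cA; have [tb lt tM ta] := ht.
have [sA _ _] := hA.
move=> hs s1; have us := star_hom_ucp cA A1 hs s1; have [sb ls sM sa] := hs; split.
- split; first by move=> a [/Ab].
    by split=> //; rewrite (linear_on0 sA lt) (linear_on0 sA ls).
  by move=> a S T [AS DS] [AT DT]; split; [exact: Al|rewrite lt// ls// DS DT].
- by move=> S T [AS DS] [AT DT]; split; [exact: AM|rewrite tM// sM// DS DT].
- move=> S T [AT DT] TS; have AS := Aa _ _ AT TS; split=> //.
  by apply: (@adjoint_uniq _ _ (t T)); [exact: ta|rewrite DT; exact: sa].
- move=> T bT hT; have AT : A T.
    by apply: Acl => // e e0; have [S [AS _] TS] := hT e e0; exists S.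
  split=> //; apply/funext => x; apply/eqP; rewrite -subr_eq0; apply/eqP/rnorm0_eq0/eqP.
  rewrite eq_le rnorm_ge0 andbT; apply/ler_addgt0Pr => e e0; rewrite add0r.
  pose c := 2 * (rnorm x + 1); have x1 : 0 < rnorm x + 1 by rewrite ltr_wpDl ?rnorm_ge0.
  have c0 : 0 < c by rewrite mulr_gt0.
  have [S [AS tS] TS] := hT _ (divr_gt0 e0 c0).
  have ATS : A (T - S) by exact: op_subspaceB.
  have b (f : (H -> H) -> (K -> K)) : ucp A f -> rnorm (f (T - S) x) <= e / c * rnorm x.
    move=> uf; have bf : bounded_op (f (T - S)) by have [+ _ _ _] := uf; apply.
    apply: le_trans (opnorm_bound bf x) _; rewrite ler_wpM2r ?rnorm_ge0//.
    by apply: le_trans (ucp_opnorm hA uf ATS) _; exact: ltW.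
  have -> : t T x - s T x = t (T - S) x - s (T - S) x.
    by rewrite (linear_onB lt AT AS) (linear_onB ls AT AS) tS !fctE opprB addrA subrK.
  apply: le_trans (rnormD _ _) _; rewrite rnormN.
  apply: le_trans (lerD (b _ ut) (b _ us)) _.
  have -> : e / c * rnorm x + e / c * rnorm x = e * (rnorm x / (rnorm x + 1)).
    by rewrite /c; field; rewrite gt_eqF.
  by rewrite ler_piMr ?(ltW e0)// ler_pdivrMr// mul1r lerDl.
Qed.
End StarHom.

Lemma star_hom_comp (R : realType) (H K L : hilbertType R) (A : set (H -> H)) (B : set (K -> K))
    (C : set (L -> L)) t s : star_hom A B t -> star_hom B C s -> star_hom A C (s \o t).
Proof.
move=> [tb lt tM ta] [sb ls sM sa]; split=> [a Aa|a S T AS AT|S T AS AT|S T AS AT h] /=.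
- exact/sb/tb.
- by rewrite lt// ls//; exact: tb.
- by rewrite tM// sM//; exact: tb.
- by apply: sa; [exact: tb|exact: tb|exact: ta].
Qed.

Lemma star_hom_sub (R : realType) (H K : hilbertType R) (A : set (H -> H)) (B C : set (K -> K)) t :
  (forall a, A a -> C (t a)) -> star_hom A B t -> star_hom A C t.
Proof. by move=> BC [tb lt tM ta]; split. Qed.

Lemma map_mx_funE (R : realType) (H K : hilbertType R) n (f : (H -> H) -> (K -> K)) (X : 'M[H -> H]_n) :
  (map_mx f X : 'I_n -> 'I_n -> _) = (fun i j => f (X i j)).
Proof. by apply/funext => i; apply/funext => j; rewrite mxE. Qed.

Lemma ucp_extension_ci (R : realType) (H K Hpi : hilbertType R) (M : set (H -> H))
    (eps : (H -> H) -> (K -> K)) (pi psi : (K -> K) -> (Hpi -> Hpi)) :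
  unital_operator_space M -> Cstar_envelope M eps ->
  star_rep (Cstar (eps @` M)) pi -> isometric_on (Cstar (eps @` M)) pi ->
  ucp (Cstar (eps @` M)) psi -> (forall T, M T -> psi (eps T) = pi (eps T)) ->
  completely_isometric (Cstar (eps @` M)) psi.
Proof.
move=> [[Mb M0 Ml] M1] [[eb le e1 eci] univ] [hpi p1] ipi upsi psi_pi.
have emb : eps @` M `<=` bounded_op by move=> _ [m Mm <-]; exact: eb.
have cA := Cstar_Cstar emb; set A := Cstar _ in hpi ipi upsi cA univ *.
have eA m : M m -> A (eps m) by move=> Mm; apply: sub_Cstar; exists m.
have A1 : A id by rewrite -e1; exact: eA.
have [[Ab _ _] _ _ _] := cA; have hA := Cstar_selfadjoint cA A1.
have cB := star_image_Cstar cA hpi ipi; set B := pi @` A in cB.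
have pB a : A a -> B (pi a) by move=> Aa; exists a.
have B1 : B id by exists id.
have [g hg gp] := star_hom_inv cA hpi ipi.
have g1 : g id = id by rewrite -{1}p1 gp.
have gb : star_hom B bounded_op g.
  by apply: star_hom_sub hg => _ [a Aa <-]; rewrite gp//; exact: Ab.
have ug := star_hom_ucp cB B1 gb g1.
have hB := Cstar_selfadjoint cB B1.
have [Psi [uPsi PsiB]] := arveson_extension hB (ucp_comp (let: And4 h _ _ _ := hg in h) ug upsi).
have PsiE a : A a -> Psi (pi a) = psi a by move=> Aa; rewrite PsiB/= ?gp//; exact: pB.
have pb := let: And4 h _ _ _ := hpi in h.
pose N : set (Hpi -> Hpi) := pi @` (eps @` M).
have Nb : N `<=` bounded_op by move=> _ [_ [m Mm <-] <-]; apply: pb; exact: eA.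
have PsiN m : N m -> Psi m = m.
  by move=> [_ [x Mx <-] <-]; rewrite PsiE ?psi_pi//; exact: eA.
have [F [uF FN Fc] FF] := minimal_idempotent Nb uPsi PsiN.
(* [F] fixes the generators [pi (eps m)], which are therefore absorbing, and the absorbing operators
   form a C*-algebra. *)
have BF : B `<=` absorbing F.
  move=> _ [a Aa <-]; apply: (star_hom_Cstar cA A1 hpi p1 (erefl _) (absorbing_Cstar uF)) Aa.
  move=> _ [m Mm <-]; apply: absorbing_fixed => //; first by apply: pb; exact: eA.
  by apply: FN; exists (eps m) => //; exists m.
have [L [s [hs s1 sE]]] := gns uF cB B1 BF.
have hsp : star_hom A bounded_op (s \o pi) by apply: star_hom_comp hs; exact: star_hom_sub hpi.
have sp1 : (s \o pi) id = id by rewrite /= p1.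
have usp := star_hom_ucp cA A1 hsp sp1.
pose i0 := s \o pi \o eps.
have cov : Cstar_cover M i0.
  have [spb lsp _ _] := hsp; split.
  - by move=> m Mm; apply: spb; exact: eA.
  - move=> a S T MS MT; rewrite /i0 /= le//.
    by apply: (lsp a _ _ (eA _ MS) (eA _ MT)).
  - by rewrite /i0/= e1 p1.
  (* One inequality is contractivity of [s \o pi]. For the other, [F] fixes [pi (eps X)], so a bound
     for the representation is one for [pi (eps X)], and the inverse [g] of [pi] is completely
     contractive. *)
  - move=> n X MX; rewrite -eci//; apply/eqP; rewrite eq_le.
    have eX i j : A (eps (X i j)) by apply: eA; exact: MX.
    rewrite !mxopnorm_mono// => [i j|c c0|i j|c c0]; rewrite ?mxE ?map_mx_funE.
    + by apply: spb.
    + move=> h.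
      have {}h := (sE _ _ _ _ c0 (fun i j => pB _ (eX i j))).2 h.
      have {}h : fbound (fun i j => pi (eps (X i j))) c.
        move: h; congr fbound; apply/funext => i; apply/funext => j.
        by apply: FN; exists (eps (X i j)) => //; exists (X i j) => //; exact: MX.
      have := ucp_fbound hB ug c0 (fun i j => pB _ (eX i j)) h.
      by congr fbound; apply/funext => i; apply/funext => j; rewrite gp.
    + exact: Ab.
    + exact: ucp_fbound hA usp c0 eX.
have [th hth the] := univ _ _ cov.
have i0b : i0 @` M `<=` bounded_op by move=> _ [m Mm <-]; have [+ _ _ _] := cov; apply.
have cE := Cstar_Cstar i0b; set E := Cstar _ in cE hth.
have i0E m : M m -> E (i0 m) by move=> Mm; apply: sub_Cstar; exists m.
have i01 : i0 id = id by rewrite /i0/= e1 p1.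
have E1 : E id by rewrite -i01; exact: i0E.
(* [th] is controlled only on [E], the algebra generated by the cover. *)
have spE : forall a, A a -> E (s (pi a)).
  by apply: (star_hom_Cstar cA A1 hsp sp1 (erefl _) cE) => _ [m Mm <-]; exact: i0E.
have th1 : th id = id by rewrite -{1}i01 the.
have hthb : star_hom E bounded_op th.
  by apply: star_hom_sub (hth) => a Ea; apply: Ab; have [+ _ _ _] := hth; apply.
have uth := star_hom_ucp cE E1 hthb th1.
(* The composite homomorphism fixes the generators [eps m] of [A]. *)
have thE a : A a -> th (s (pi a)) = a.
  have h1 : star_hom A bounded_op (th \o (s \o pi)).
    by apply: star_hom_comp hthb; exact: star_hom_sub hsp.
  have h1id : (th \o (s \o pi)) id = id by rewrite /= p1 s1.
  have hid : star_hom A bounded_op id by split.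
  have := Cstar_min (star_equalizer_Cstar cA A1 h1 h1id hid erefl).
  move=> /(_ (eps @` M)) h Aa; have [|_ //] := h _ a Aa.
  by move=> _ [m Mm <-]; split; [exact: eA|exact: the].
have [psib _ _ _] := upsi.
move=> n X AX; apply/eqP; rewrite eq_le.
rewrite !mxopnorm_mono// => [i j|c c0|i j|c c0]; rewrite ?mxE ?map_mx_funE; try exact: Ab.
- exact: psib.
- move=> h.
  have {}h : fbound (fun i j => Psi (pi (X i j))) c.
    by move: h; congr fbound; apply/funext => i; apply/funext => j; rewrite PsiE.
  have {}h := Fc _ _ _ c0 (fun i j => pb _ (AX i j)) h.
  have {}h := (sE _ _ _ _ c0 (fun i j => pB _ (AX i j))).1 h.
  have := ucp_fbound (Cstar_selfadjoint cE E1) uth c0 (fun i j => spE _ (AX i j)) h.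
  by congr fbound; apply/funext => i; apply/funext => j; rewrite thE.
- exact: ucp_fbound hA upsi c0 AX.
Qed.

Theorem corollary4p2 (R : realType) (H : hilbertType R) (M : set (H -> H))
    (hM : unital_operator_space M)
    (K : hilbertType R) (eps : (H -> H) -> (K -> K))
    (heps : Cstar_envelope M eps)
    (Hpi : hilbertType R) (pi psi : (K -> K) -> (Hpi -> Hpi))
    (hpi : star_rep (Cstar (eps @` M)) pi)
    (hpi_isom : isometric_on (Cstar (eps @` M)) pi)
    (hpsi : ucp (Cstar (eps @` M)) psi)
    (hpsi_pi : forall T, M T -> psi (eps T) = pi (eps T)) :
  completely_isometric (Cstar (eps @` M)) psi /\
  (forall (L : hilbertType R) (eta : (Hpi -> Hpi) -> (L -> L)),
     Cstar_envelope (psi @` Cstar (eps @` M)) eta ->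
     star_isomorphic (Cstar (eta @` (psi @` Cstar (eps @` M))))
                     (Cstar (eps @` M))).
Proof.
have ci := ucp_extension_ci hM heps hpi hpi_isom hpsi hpsi_pi.
split=> // L eta; have [_ M1] := hM; have [[eb _ e1 _] _] := heps.
apply: ucp_image_envelope hpsi ci.
- by apply: Cstar_Cstar => _ [m Mm <-]; exact: eb.
- by rewrite -e1; apply: sub_Cstar; exists id.
Qed.
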